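(* Let $R$ be an arbitrary commutative ring and $l\geq 3$. Let $\phi\colon \mathrm{StSp}(2l,R)\to \mathrm{Ep}(2l,R)$, $X_{ij}(a)\mapsto T_{ij}(a)$, be the natural projection from the symplectic Steinberg group onto the elementary symplectic group and $\mathrm{K_2Sp}(2l,R)=\mathrm{Ker}\,\phi$. Then there is a surjective homomorphism from $\mathrm H_2(\mathrm{Ep}(2l,R),\mathbb Z)$ onto $\mathrm{K_2Sp}(2l,R)$ with kernel (isomorphic to) $\mathrm H_2(\mathrm{StSp}(2l,R),\mathbb Z)$. In particular, this map is bijective if $l\geq 4$, or if $l=3$ and $R$ has no residue field isomorphic to $\mathbb F_2$.
   Context: Rings are associative, commutative and unital. $V=R^{2l}$ is the free right $R$-module with basis $e_{-l},\dots,e_{-1},e_1,\dots,e_l$; indices $i,j,h,k$ run over $\{-l,\dots,-1,1,\dots,l\}$. Write $\varepsilon_i=\mathrm{sgn}(i)\in\{1,-1\}$. The symplectic form is the bilinear form with $\langle e_i,e_j\rangle=\varepsilon_i\delta_{i,-j}$, and $\mathrm{Sp}(2l,R)$ is the group of $R$-linear automorphisms of $V$ preserving it. Commutators are $[x,y]=xyx^{-1}y^{-1}$. For $u,v\in V$ with $\langle u,v\rangle=0$ and $a\in R$, $T(u,v,a)\in\mathrm{Sp}(2l,R)$ is the map $w\mapsto w+u(\langle v,w\rangle+a\langle u,w\rangle)+v\langle u,w\rangle$. Put $T_{ij}(a)=T(e_i,e_{-j}a\varepsilon_{-j},0)$ for $i\notin\{\pm j\}$ and $T_{i,-i}(a)=T(e_i,0,a)$.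 The elementary symplectic group $\mathrm{Ep}(2l,R)$ is the subgroup of $\mathrm{Sp}(2l,R)$ generated by all $T_{ij}(a)$, $i\ne j$, $a\in R$. The symplectic Steinberg group $\mathrm{StSp}(2l,R)$ is the group generated by symbols $X_{ij}(a)$, $i\neq j$, $a\in R$, subject to the relations (each imposed only when all symbols in it are defined, i.e. no symbol $X_{ii}$ appears): R0: $X_{ij}(a)=X_{-j,-i}(-a\varepsilon_i\varepsilon_j)$; R1: $X_{ij}(a)X_{ij}(b)=X_{ij}(a+b)$; R2: $[X_{ij}(a),X_{hk}(b)]=1$ for $h\notin\{j,-i\}$, $k\notin\{i,-j\}$; R3: $[X_{ij}(a),X_{jk}(b)]=X_{ik}(ab)$ for $i\notin\{-j,-k\}$, $j\ne -k$; R4: $[X_{i,-i}(a),X_{-i,j}(b)]=X_{ij}(ab\varepsilon_i)X_{-j,j}(-ab^2)$; R5: $[X_{ij}(a),X_{j,-i}(b)]=X_{i,-i}(2ab\varepsilon_i)$. The assignment $X_{ij}(a)\mapsto T_{ij}(a)$ defines the natural epimorphism $\phi$. $\mathrm H_2(G,\mathbb Z)$ denotes the second integral group homology (trivial coefficients). A residue field of $R$ is a quotient $R/\mathfrak m$ by a maximal ideal $\mathfrak m$. *)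

(* Defs.v *)
From HB Require Import structures.
From mathcomp Require Import all_boot all_algebra.
From mathcomp Require Import boolp.
From mathcomp.multinomials Require Import freeg.
From mathcomp Require Import ring.

(** Commutative rings are [comPzRingType]s, so that the zero ring is allowed. *)

Set Implicit Arguments.
Unset Strict Implicit.
Unset Printing Implicit Defensive.

Import GRing.Theory.
Local Open Scope ring_scope.
Local Open Scope quotient_scope.

Section GeneratedSubgroup.
Variables (G : groupType) (S : G -> Prop).

Inductive in_gen : G -> Prop :=
| in_gen_base x : S x -> in_gen x
| in_gen1 : in_gen 1%g
| in_genM x y : in_gen x -> in_gen y -> in_gen (x * y)%g
| in_genV x : in_gen x -> in_gen (x^-1)%g.

Definition gen_pred : pred G := fun x => `[< in_gen x >].

Fact gen_group_closed : group_closed gen_pred.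
Proof.
split; first by apply/asboolP; constructor.
move=> x y /asboolP gx /asboolP gy; apply/asboolP.
by apply: in_genM => //; apply: in_genV.
Qed.

Record gen_subgroup := GenSubgroup { gen_val :> G; _ : gen_pred gen_val }.

HB.instance Definition _ := [isSub for gen_val].
HB.instance Definition _ := [Choice of gen_subgroup by <:].
HB.instance Definition _ :=
  SubChoice_isSubGroup.Build G gen_pred gen_subgroup gen_group_closed.

Lemma gen_mem x : S x -> gen_pred x.
Proof. by move=> Sx; apply/asboolP; apply: in_gen_base. Qed.

Definition gen_in x (Sx : S x) : gen_subgroup := GenSubgroup (gen_mem Sx).

End GeneratedSubgroup.

Section Kernel.
Variables (G H : groupType) (f : {multiplicative G -> H}).

Definition kernel_pred : pred G := fun x => f x == 1%g.

Fact kernel_group_closed : group_closed kernel_pred.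
Proof.
have f1 : f 1%g = 1%g.
  by apply: (@mulgI _ (f 1%g)); rewrite -gmulfM !mulg1.
split; first by apply/eqP.
move=> x y /eqP fx /eqP fy; apply/eqP; rewrite gmulfM fx mul1g.
by apply: (@mulgI _ (f y)); rewrite -gmulfM divgg f1 fy mulg1.
Qed.

Record kernel := Kernel { kernel_val :> G; _ : kernel_pred kernel_val }.

HB.instance Definition _ := [isSub for kernel_val].
HB.instance Definition _ := [Choice of kernel by <:].
HB.instance Definition _ :=
  SubChoice_isSubGroup.Build G kernel_pred kernel kernel_group_closed.

End Kernel.

Definition surjective (A B : Type) (f : A -> B) : Prop :=
  forall y, exists x, f x = y.

Definition isomorphic (G H : groupType) : Prop :=
  exists f : {multiplicative G -> H}, bijective f.

(** The letter [(x, false)] stands for the generator [x] and [(x, true)] for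
    its inverse; a pair [rel u v] is the defining relation [u = v]. *)

Section Presentation.
Variable gen : choiceType.

Definition word := seq (gen * bool).

Definition word_inv (w : word) : word := rev [seq (x.1, ~~ x.2) | x <- w].

Definition word_comm (u v : word) : word :=
  u ++ v ++ word_inv u ++ word_inv v.

Variable rel : word -> word -> Prop.

Inductive word_eq : word -> word -> Prop :=
| word_eq_refl u : word_eq u u
| word_eq_sym u v : word_eq u v -> word_eq v u
| word_eq_trans u v w : word_eq u v -> word_eq v w -> word_eq u w
| word_eq_cat u u' v v' :
    word_eq u u' -> word_eq v v' -> word_eq (u ++ v) (u' ++ v')
| word_eq_cancel x b : word_eq [:: (x, b); (x, ~~ b)] [::]
| word_eq_rel u v : rel u v -> word_eq u v.

Definition word_eqb (u v : word) : bool := `[< word_eq u v >].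

Fact word_eqb_equiv : equiv_class_of word_eqb.
Proof.
split=> [u|u v|v u w].
- exact/asboolP/word_eq_refl.
- by apply/asboolP/asboolP; apply: word_eq_sym.
- by move=> /asboolP uv /asboolP vw; apply/asboolP/(word_eq_trans uv).
Qed.

Canonical word_eqb_equivRel := EquivRelPack word_eqb_equiv.
Canonical word_eqb_encModRel := defaultEncModRel word_eqb.

Definition presented := {eq_quot word_eqb}.
HB.instance Definition _ := Choice.on presented.
HB.instance Definition _ : EqQuotient word word_eqb presented :=
  EqQuotient.on presented.

Lemma presented_eqP u v :
  reflect (word_eq u v) (\pi_presented u == \pi_presented v).
Proof. by rewrite piE; apply: asboolP. Qed.

Lemma word_eq_repr u : word_eq (repr (\pi_presented u)) u.
Proof. by apply/presented_eqP; rewrite reprK. Qed.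

Lemma word_inv_cat u v : word_inv (u ++ v) = word_inv v ++ word_inv u.
Proof. by rewrite /word_inv map_cat rev_cat. Qed.

Lemma word_invK : involutive word_inv.
Proof.
move=> u; rewrite /word_inv map_rev revK -map_comp.
by rewrite -[RHS]map_id; apply: eq_map => -[x b] /=; rewrite negbK.
Qed.

Lemma word_eq_mulV u : word_eq (u ++ word_inv u) [::].
Proof.
elim: u => [|[x b] u IHu]; first exact: word_eq_refl.
have -> : word_inv ((x, b) :: u) = word_inv u ++ [:: (x, ~~ b)].
  by rewrite -cat1s word_inv_cat.
rewrite -cat1s -catA.
apply: (word_eq_trans (v := [:: (x, b)] ++ [:: (x, ~~ b)])); last first.
  exact: word_eq_cancel.
apply: word_eq_cat (word_eq_refl _) _; rewrite catA -[X in word_eq _ X]cat0s.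
exact: word_eq_cat IHu (word_eq_refl _).
Qed.

Lemma word_eq_Vmul u : word_eq (word_inv u ++ u) [::].
Proof. by rewrite -{2}[u]word_invK; apply: word_eq_mulV. Qed.

Lemma word_eq_inv u v : word_eq u v -> word_eq (word_inv u) (word_inv v).
Proof.
move=> uv; apply: (word_eq_trans (v := word_inv u ++ v ++ word_inv v)).
  rewrite -[X in word_eq X _]cats0; apply: word_eq_cat (word_eq_refl _) _.
  exact/word_eq_sym/word_eq_mulV.
rewrite catA -[X in word_eq _ X]cat0s.
apply: word_eq_cat (word_eq_refl _).
apply: word_eq_trans (word_eq_Vmul u).
exact: word_eq_cat (word_eq_refl _) (word_eq_sym uv).
Qed.

Definition pres_one : presented := \pi_presented [::].
Definition pres_mul (x y : presented) : presented :=
  \pi_presented (repr x ++ repr y).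
Definition pres_inv (x : presented) : presented :=
  \pi_presented (word_inv (repr x)).

Lemma pres_mulE u v :
  pres_mul (\pi u) (\pi v) = \pi_presented (u ++ v).
Proof. by apply/eqP/presented_eqP/word_eq_cat; apply: word_eq_repr. Qed.

Lemma pres_invE u : pres_inv (\pi u) = \pi_presented (word_inv u).
Proof. by apply/eqP/presented_eqP/word_eq_inv/word_eq_repr. Qed.

Fact pres_mulA : associative pres_mul.
Proof.
move=> x y z; rewrite -[x]reprK -[y]reprK -[z]reprK.
by rewrite !pres_mulE catA.
Qed.

Fact pres_mul1 : left_id pres_one pres_mul.
Proof. by move=> x; rewrite -[x]reprK pres_mulE. Qed.

Fact pres_mulr1 : right_id pres_one pres_mul.
Proof. by move=> x; rewrite -[x]reprK pres_mulE cats0. Qed.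

Fact pres_mulV : left_inverse pres_one pres_inv pres_mul.
Proof.
move=> x; rewrite -[x]reprK pres_invE pres_mulE.
exact/eqP/presented_eqP/word_eq_Vmul.
Qed.

Fact pres_mulrV : right_inverse pres_one pres_inv pres_mul.
Proof.
move=> x; rewrite -[x]reprK pres_invE pres_mulE.
exact/eqP/presented_eqP/word_eq_mulV.
Qed.

HB.instance Definition _ := isGroup.Build presented
  pres_mulA pres_mul1 pres_mulr1 pres_mulV pres_mulrV.

Definition pres_gen (x : gen) : presented := \pi_presented [:: (x, false)].

End Presentation.

Section PresentationLift.
Variables (gen : choiceType) (rel : word gen -> word gen -> Prop).
Variables (H : groupType) (f : gen -> H).

Definition word_eval (w : word gen) : H :=
  (\prod_(x <- w) (if x.2 then (f x.1)^-1 else f x.1))%g.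

Lemma word_eval_cat u v : word_eval (u ++ v) = (word_eval u * word_eval v)%g.
Proof. by rewrite /word_eval big_cat. Qed.

Lemma word_eval1 x : word_eval [:: (x, false)] = f x.
Proof. by rewrite /word_eval big_seq1. Qed.

Lemma word_eval_inv u : word_eval (word_inv u) = (word_eval u)^-1%g.
Proof.
elim: u => [|[x b] u IHu]; first by rewrite /word_eval !big_nil invg1.
rewrite -cat1s word_inv_cat !word_eval_cat IHu invgM; congr (_ * _)%g.
by rewrite /word_eval !big_seq1 /=; case: b => //=; rewrite invgK.
Qed.

Lemma word_eval_comm u v : word_eval (word_comm u v) =
  (word_eval u * word_eval v * (word_eval u)^-1 * (word_eval v)^-1)%g.
Proof. by rewrite /word_comm !word_eval_cat !word_eval_inv !mulgA. Qed.

Hypothesis f_rel : forall u v, rel u v -> word_eval u = word_eval v.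

Lemma word_eval_eq u v : word_eq rel u v -> word_eval u = word_eval v.
Proof.
elim=> {u v} [//|//|u v w _ -> _ -> //|u u' v v' _ IHu _ IHv|x b|u v /f_rel//].
  by rewrite !word_eval_cat IHu IHv.
rewrite /word_eval big_cons big_seq1 big_nil /=.
by case: b; rewrite /= ?mulVg ?mulgV.
Qed.

Definition pres_lift of (forall u v, rel u v -> word_eval u = word_eval v) :=
  fun x : presented rel => word_eval (repr x).

Lemma pres_lift_pi w : pres_lift f_rel (\pi w) = word_eval w.
Proof. exact/word_eval_eq/word_eq_repr. Qed.

Fact pres_liftM : {morph pres_lift f_rel : x y / (x * y)%g}.
Proof.
move=> x y; rewrite -[x]reprK -[y]reprK.
rewrite [(_ * _)%g]pres_mulE !pres_lift_pi; exact: word_eval_cat.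
Qed.

HB.instance Definition _ :=
  isMultiplicative.Build (presented rel) H (pres_lift f_rel) pres_liftM.

Lemma pres_lift_gen x : pres_lift f_rel (pres_gen rel x) = f x.
Proof. by rewrite pres_lift_pi word_eval1. Qed.

End PresentationLift.

(** [H2 G] is the homology in degree 2 of the bar complex of [G] with trivial
    integral coefficients; the free abelian group on [G ^ n] is
    [{freeg G ^ n / int}]. *)

Section Homology.
Variable G : groupType.

Local Notation bar1 := {freeg G / int}.
Local Notation bar2 := {freeg (G * G)%type / int}.
Local Notation bar3 := {freeg (G * G * G)%type / int}.

Definition bar_d2 : bar2 -> bar1 :=
  fglift (fun x => (<< x.2 >> - << (x.1 * x.2)%g >> + << x.1 >> : bar1)).

Definition bar_d3 : bar3 -> bar2 :=
  fglift (fun x => let: (g, h, k) := x in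
    (<< (h, k) >> - << ((g * h)%g, k) >> + << (g, (h * k)%g) >> - << (g, h) >>
      : bar2)).

Fact bar_d2_zmod : zmod_morphism bar_d2. Proof. exact: lift_is_additive. Qed.
HB.instance Definition _ :=
  GRing.isZmodMorphism.Build bar2 bar1 bar_d2 bar_d2_zmod.

Fact bar_d3_zmod : zmod_morphism bar_d3. Proof. exact: lift_is_additive. Qed.
HB.instance Definition _ :=
  GRing.isZmodMorphism.Build bar3 bar2 bar_d3 bar_d3_zmod.

Lemma bar_d2_d3 c : bar_d2 (bar_d3 c) = 0.
Proof.
rewrite -[c]freeg_sumE !raddf_sum big1 // => -[[g h] k] _ /=.
rewrite [bar_d3 _]liftU -[coeff _ c]intz scaler_int raddfMz.
rewrite [X in X *~ _](_ : _ = 0) ?mul0rz //.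
rewrite raddfB raddfD raddfB /= /bar_d2 !liftU !scale1r /= mulgA.
by apply/eqP/freeg_eqP => x; rewrite !(coeffB, coeffD) coeff0; ring.
Qed.

Definition cycle_pred : pred bar2 := fun z => bar_d2 z == 0.

Fact cycle_zmod_closed : zmod_closed cycle_pred.
Proof.
split=> [|x y /eqP dx /eqP dy]; first by apply/eqP; rewrite raddf0.
by apply/eqP; rewrite raddfB /= dx dy subr0.
Qed.

Record cycles2 := Cycles2 { cycle_val :> bar2; _ : cycle_pred cycle_val }.

HB.instance Definition _ := [isSub for cycle_val].
HB.instance Definition _ := [Choice of cycles2 by <:].
HB.instance Definition _ :=
  GRing.SubChoice_isSubZmodule.Build bar2 cycle_pred cycles2 cycle_zmod_closed.

Definition boundary_pred : {pred cycles2} :=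
  fun z => `[< exists c, bar_d3 c = val z >].

Fact boundary_zmod_closed : zmod_closed boundary_pred.
Proof.
split=> [|x y /asboolP[c dc] /asboolP[c' dc']]; apply/asboolP.
  by exists 0; rewrite !raddf0.
by exists (c - c'); rewrite !raddfB /= dc dc'.
Qed.
HB.instance Definition _ :=
  GRing.isZmodClosed.Build cycles2 boundary_pred boundary_zmod_closed.

(** [to_multiplicative] turns the additive quotient group into a
    [groupType]. *)
Definition H2 : Type :=
  Algebra.to_multiplicative (@Quotient.quot cycles2 boundary_pred).
HB.instance Definition _ := Group.on H2.

End Homology.

Section ResidueField.
Variable R : comPzRingType.

Definition ideal_closed (I : {pred R}) : Prop :=
  zmod_closed I /\ forall a, {in I, forall x, a * x \in I}.

Record ideal :=
  Ideal { ideal_pred :> {pred R}; idealP : ideal_closed ideal_pred }.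

Definition maximal (m : ideal) : Prop :=
  1 \notin (m : {pred R}) /\
  forall I : ideal, 1 \notin (I : {pred R}) ->
    {subset (m : {pred R}) <= (I : {pred R})} ->
    {subset (I : {pred R}) <= (m : {pred R})}.

Section QuotientRing.
Variable I : ideal.

HB.instance Definition _ :=
  GRing.isZmodClosed.Build R (ideal_pred I) (proj1 (idealP I)).

Definition quot_ring := @Quotient.quot R (ideal_pred I).
HB.instance Definition _ := GRing.Zmodule.on quot_ring.
HB.instance Definition _ := Quotient.on quot_ring.

Lemma quot_ring_eqP (x y : R) :
  (\pi_quot_ring x == \pi_quot_ring y) = (x - y \in (I : {pred R})).
Proof. by rewrite -Quotient.idealrBE. Qed.

Definition qmul (x y : quot_ring) : quot_ring :=
  \pi_quot_ring (repr x * repr y).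

Lemma qaddE (x y : R) :
  \pi_quot_ring (x + y) = \pi_quot_ring x + \pi_quot_ring y.
Proof. exact: (Quotient.pi_add _ x y). Qed.

Lemma qmulE (x y : R) :
  qmul (\pi_quot_ring x) (\pi_quot_ring y) = \pi_quot_ring (x * y).
Proof.
have reprP (z : R) : repr (\pi_quot_ring z) - z \in (I : {pred R}).
  by rewrite -quot_ring_eqP reprK.
apply/eqP; rewrite quot_ring_eqP; set x' := repr _; set y' := repr _.
have -> : x' * y' - x * y = x' * (y' - y) + y * (x' - x) by ring.
by apply: rpredD; apply: (proj2 (idealP I)); apply: reprP.
Qed.

Lemma quot_ring_surj (x : quot_ring) : exists y : R, x = \pi_quot_ring y.
Proof. by exists (repr x); rewrite reprK. Qed.

Fact qmulA : associative qmul.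
Proof.
move=> x y z; have [[[a ->] [b ->]] [c ->]] :=
  (quot_ring_surj x, quot_ring_surj y, quot_ring_surj z).
by rewrite (qmulE b c) (qmulE a (b * c)) (qmulE a b) (qmulE (a * b) c) mulrA.
Qed.

Fact qmulC : commutative qmul.
Proof.
move=> x y; have [[a ->] [b ->]] := (quot_ring_surj x, quot_ring_surj y).
by rewrite (qmulE a b) (qmulE b a) mulrC.
Qed.

Fact qmul1 : left_id (\pi_quot_ring 1) qmul.
Proof. by move=> x; have [a ->] := quot_ring_surj x; rewrite qmulE mul1r. Qed.

Fact qmulDl : left_distributive qmul +%R.
Proof.
move=> x y z; have [[[a ->] [b ->]] [c ->]] :=
  (quot_ring_surj x, quot_ring_surj y, quot_ring_surj z).
rewrite -(qaddE a b) (qmulE (a + b) c) (qmulE a c) (qmulE b c).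
by rewrite mulrDl qaddE.
Qed.

HB.instance Definition _ := GRing.Zmodule_isComPzRing.Build quot_ring
  qmulA qmulC qmul1 qmulDl.

End QuotientRing.

Definition has_residue_field (k : fieldType) : Prop :=
  exists m : ideal, maximal m /\
    exists f : {rmorphism quot_ring m -> k}, bijective f.

End ResidueField.

(** [(true, n)] encodes the index [n + 1] and [(false, n)] the index
    [- (n + 1)], so that [idx l] is the set of -l, ..., -1, 1, ..., l. *)
Definition idx (l : nat) := (bool * 'I_l)%type.

Definition negi l (i : idx l) : idx l := (~~ i.1, i.2).

Definition eps (R : pzRingType) l (i : idx l) : R := if i.1 then 1 else - 1.

Section Symplectic.
Variables (R : comPzRingType) (l : nat).

Implicit Types (i j h k : idx l) (a b : R).

Local Notation eps := (@eps R l).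

(** As [R] is commutative, the right multiple [v a] is written [a *: v]. *)
Definition V := {ffun idx l -> R^o}.
HB.instance Definition _ := GRing.Lmodule.on V.

Implicit Types u v w x y : V.

Definition e_ i : V := [ffun k => (k == i)%:R].

Definition form u v : R := \sum_i eps i * u i * v (negi i).

Lemma V_add u v i : (u + v) i = (u i : R) + v i :> R.
Proof. exact: ffunE. Qed.

Lemma V_scale a v i : (a *: v) i = a * v i :> R.
Proof. exact: ffunE. Qed.

Lemma V_zero i : (0 : V) i = 0 :> R.
Proof. exact: ffunE. Qed.

Lemma e_E i k : e_ i k = (k == i)%:R :> R.
Proof. exact: ffunE. Qed.

Definition VE := (V_add, V_scale, V_zero, e_E).

Lemma negiK : involutive (@negi l).
Proof. by case=> s n; rewrite /negi /= negbK. Qed.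

Lemma eq_negi i j : (negi i == negi j) = (i == j).
Proof. exact: (inj_eq (inv_inj negiK)). Qed.

Lemma eq_negiC i j : (negi i == j) = (i == negi j).
Proof. by rewrite -[j in LHS]negiK eq_negi. Qed.

Lemma negi_neq i : (negi i == i) = false.
Proof. by case: i => [] [] n; apply/negbTE; rewrite xpair_eqE. Qed.

Lemma epsN i : eps (negi i) = - eps i.
Proof. by rewrite /eps /=; case: i.1; rewrite /= ?opprK. Qed.

Lemma eps_sqr i : eps i * eps i = 1.
Proof. by rewrite /eps; case: i.1; ring. Qed.

Lemma form_basisl i v : form (e_ i) v = eps i * v (negi i).
Proof.
rewrite /form (bigD1 i) //= big1 => [|k /negbTE ki]; rewrite e_E ?ki ?eqxx.
  by rewrite addr0 mulr1.
by rewrite mulr0 mul0r.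
Qed.

Lemma form_basis i j : form (e_ i) (e_ j) = eps i * (i == negi j)%:R.
Proof. by rewrite form_basisl e_E eq_negiC. Qed.

Lemma formDr u v w : form u (v + w) = form u v + form u w.
Proof.
by rewrite -big_split; apply: eq_bigr => i _; rewrite V_add mulrDr.
Qed.

Lemma formZr a u v : form u (a *: v) = a * form u v.
Proof.
rewrite mulr_sumr; apply: eq_bigr => i _.
by rewrite V_scale; ring.
Qed.

Lemma formC u v : form u v = - form v u.
Proof.
rewrite /form (reindex_inj (inv_inj negiK)) -sumrN; apply: eq_bigr => i _.
by rewrite epsN negiK; ring.
Qed.

Lemma formDl u v w : form (u + v) w = form u w + form v w.
Proof. by rewrite !(formC _ w) formDr; ring. Qed.

Lemma formZl a u v : form (a *: u) v = a * form u v.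
Proof. by rewrite !(formC _ v) formZr; ring. Qed.

Lemma formvv u : form u u = 0.
Proof.
pose F (s : bool) (n : 'I_l) := eps (s, n) * u (s, n) * u (negi (s, n)).
rewrite /form (eq_bigr (fun p => F p.1 p.2)) => [|[] //].
rewrite -(pair_bigA _ F) /= big_bool /= -big_split big1 // => n _.
by rewrite /F /eps /negi /=; ring.
Qed.

Lemma form0l v : form 0 v = 0.
Proof. by rewrite -(scale0r (0 : V)) formZl mul0r. Qed.

Lemma form0r v : form v 0 = 0.
Proof. by rewrite formC form0l oppr0. Qed.

Definition symplectic (f : V -> V) : Prop :=
  [/\ linear f, bijective f & forall u v, form (f u) (f v) = form u v].

Record Sp := MkSp { Sp_fun :> V -> V; _ : `[< symplectic Sp_fun >] }.

HB.instance Definition _ := [isSub for Sp_fun].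
HB.instance Definition _ := [Choice of Sp by <:].

Lemma SpP (g : Sp) : symplectic g.
Proof. exact/asboolP/(valP g). Qed.

Lemma Sp_eqP (g h : Sp) : g =1 h -> g = h.
Proof. by move=> gh; apply: val_inj; apply: funext. Qed.

Fact Sp_one_subproof : symplectic idfun.
Proof. by split=> //; exists idfun. Qed.

Definition Sp_one : Sp := MkSp (asboolT Sp_one_subproof).

Fact Sp_mul_subproof (g h : Sp) : symplectic (g \o h).
Proof.
have [[gl gb gf] [hl hb hf]] := (SpP g, SpP h).
split; [by move=> a u v /=; rewrite hl gl | exact: bij_comp |].
by move=> u v /=; rewrite gf hf.
Qed.

Definition Sp_mul (g h : Sp) : Sp := MkSp (asboolT (Sp_mul_subproof g h)).

Fact Sp_inv_ex (g : Sp) : exists h : Sp, cancel g h /\ cancel h g.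
Proof.
have [gl [h gK hK] gf] := SpP g.
have h_sp : symplectic h.
  split; [|by exists g|by move=> u v; rewrite -gf !hK].
  by move=> a u v; apply: (can_inj gK); rewrite gl !hK.
by exists (MkSp (asboolT h_sp)).
Qed.

Definition Sp_inv (g : Sp) : Sp := sval (cid (Sp_inv_ex g)).

Fact Sp_mulA : associative Sp_mul.
Proof. by move=> f g h; apply: Sp_eqP. Qed.
Fact Sp_mul1 : left_id Sp_one Sp_mul.
Proof. by move=> g; apply: Sp_eqP. Qed.
Fact Sp_mulr1 : right_id Sp_one Sp_mul.
Proof. by move=> g; apply: Sp_eqP. Qed.
Fact Sp_mulV : left_inverse Sp_one Sp_inv Sp_mul.
Proof.
by move=> g; apply: Sp_eqP => v /=; rewrite /Sp_inv; case: cid => h [gK hK] /=.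
Qed.
Fact Sp_mulrV : right_inverse Sp_one Sp_inv Sp_mul.
Proof.
by move=> g; apply: Sp_eqP => v /=; rewrite /Sp_inv; case: cid => h [gK hK] /=.
Qed.

HB.instance Definition _ :=
  isGroup.Build Sp Sp_mulA Sp_mul1 Sp_mulr1 Sp_mulV Sp_mulrV.

Definition T_fun u v a : V -> V := fun w =>
  w + (form v w + a * form u w) *: u + form u w *: v.

Lemma T_funM u v v' a b : form u v = 0 -> form u v' = 0 ->
  T_fun u v a \o T_fun u v' b =1 T_fun u (v + v') (a + b + form v v').
Proof.
move=> uv uv' w; have vu : form v u = 0 by rewrite formC uv oppr0.
apply/ffunP => k; rewrite /T_fun /= !(formDr, formDl, formZr) !formvv uv' vu.
rewrite !VE; ring.
Qed.

Fact T_subproof u v a : form u v = 0 -> symplectic (T_fun u v a).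
Proof.
move=> uv; have vu : form v u = 0 by rewrite formC uv oppr0.
have T0 w : T_fun u 0 0 w = w.
  by rewrite /T_fun form0l mul0r addr0 scale0r scaler0 !addr0.
split.
- move=> b x y; rewrite /T_fun !(formDr, formZr); apply/ffunP => k.
  by rewrite !VE; ring.
- have uNv : form u (- v) = 0 by rewrite -scaleN1r formZr uv mulr0.
  exists (T_fun u (- v) (- a)) => w.
    rewrite -[LHS]/((T_fun u (- v) (- a) \o T_fun u v a) w) T_funM //.
    rewrite addNr -scaleN1r formZl formvv mulr0 addr0.
    by rewrite addNr T0.
  rewrite -[LHS]/((T_fun u v a \o T_fun u (- v) (- a)) w) T_funM //.
  by rewrite subrr -scaleN1r formZr formvv mulr0 addr0 subrr T0.
- move=> x y; rewrite /T_fun !(formDr, formDl, formZr, formZl) !formvv uv vu.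
  by rewrite (formC x u) (formC x v); ring.
Qed.

Definition T u v a (uv : form u v = 0) : Sp :=
  MkSp (asboolT (@T_subproof u v a uv)).

Definition Tij_vec i j a : V :=
  if j == negi i then 0 else (a * eps (negi j)) *: e_ (negi j).

Definition Tij_scal i j a : R := if j == negi i then a else 0.

Fact Tij_orth i j a : i != j -> form (e_ i) (Tij_vec i j a) = 0.
Proof.
move=> /negbTE ij; rewrite /Tij_vec; case: ifP => _; first exact: form0r.
by rewrite formZr form_basis negiK ij !mulr0.
Qed.

(** [Tij ij a] is $T_{ij}(a)$, that is $T(e_i, e_{-j} a \varepsilon_{-j}, 0)$
    if j is not -i and $T(e_i, 0, a)$ if j = -i. *)
Definition Tij i j (ij : i != j) a : Sp :=
  T (Tij_scal i j a) (Tij_orth a ij).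

Lemma TijE i j (ij : i != j) a : j != negi i -> forall w k,
  Tij ij a w k = w k + (k == i)%:R * a * w j
    - (k == negi j)%:R * a * eps i * eps j * w (negi i) :> R.
Proof.
move=> /negbTE jNi w k; rewrite /= /T_fun /Tij_vec /Tij_scal jNi.
rewrite formZl !form_basisl negiK !VE.
have e1 := eps_sqr j; rewrite epsN.
have -> : a * - eps j * (- eps j * w j) = a * w j * (eps j * eps j) by ring.
by rewrite e1; ring.
Qed.

Lemma TiiE i j (ij : i != j) a : j = negi i -> forall w k,
  Tij ij a w k = w k + (k == i)%:R * a * eps i * w (negi i) :> R.
Proof.
move=> jNi w k; rewrite /= /T_fun /Tij_vec /Tij_scal jNi eqxx.
by rewrite form0l !form_basisl !VE; ring.
Qed.

Inductive is_Tij : Sp -> Prop := IsTij i j (ij : i != j) a : is_Tij (Tij ij a).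

Definition Ep := gen_subgroup is_Tij.
HB.instance Definition _ := Group.on Ep.

Definition Ep_T i j (ij : i != j) a : Ep := gen_in (IsTij ij a).

Definition St_gen := ({ij : idx l * idx l | ij.1 != ij.2} * R)%type.
HB.instance Definition _ := Choice.on St_gen.

Definition Xw i j (ij : i != j) a : word St_gen :=
  [:: (exist _ (i, j) ij : {ij : idx l * idx l | ij.1 != ij.2}, a, false)].

(** The proofs of inequality of indices occurring as arguments of [Xw] restrict
    each relation to the case where all symbols in it are defined. *)
Inductive St_rel : word St_gen -> word St_gen -> Prop :=
| St_R0 i j a (ij : i != j) (ji : negi j != negi i) :
    St_rel (Xw ij a) (Xw ji (- a * eps i * eps j))
| St_R1 i j a b (ij : i != j) :
    St_rel (Xw ij a ++ Xw ij b) (Xw ij (a + b))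
| St_R2 i j h k a b (ij : i != j) (hk : h != k) :
    h \notin [:: j; negi i] -> k \notin [:: i; negi j] ->
    St_rel (word_comm (Xw ij a) (Xw hk b)) [::]
| St_R3 i j k a b (ij : i != j) (jk : j != k) (ik : i != k) :
    i \notin [:: negi j; negi k] -> j != negi k ->
    St_rel (word_comm (Xw ij a) (Xw jk b)) (Xw ik (a * b))
| St_R4 i j a b (iNi : i != negi i) (Nij : negi i != j) (ij : i != j)
      (Njj : negi j != j) :
    St_rel (word_comm (Xw iNi a) (Xw Nij b))
           (Xw ij (a * b * eps i) ++ Xw Njj (- (a * b ^+ 2)))
| St_R5 i j a b (ij : i != j) (jNi : j != negi i) (iNi : i != negi i) :
    St_rel (word_comm (Xw ij a) (Xw jNi b)) (Xw iNi (2%:R * a * b * eps i)).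

Definition StSp := presented St_rel.
HB.instance Definition _ := Group.on StSp.

Definition X i j (ij : i != j) a : StSp :=
  pres_gen _ (exist _ (i, j) ij : {ij : idx l * idx l | ij.1 != ij.2}, a).

Definition phi_gen (x : St_gen) : Ep := Ep_T (valP x.1) x.2.

Lemma phi_gen_eval i j (ij : i != j) a :
  word_eval phi_gen (Xw ij a) = Ep_T ij a.
Proof.
rewrite word_eval1 /phi_gen /=; congr (Ep_T _ a).
exact: bool_irrelevance.
Qed.

Lemma TE i j (ij : i != j) a : exists c d : R,
  [/\ if j == negi i then c = a * eps i /\ d = 0
      else c = a /\ d = - (a * eps i * eps j) &
      forall w k, Tij ij a w k =
        w k + (k == i)%:R * c * w j + (k == negi j)%:R * d * w (negi i) :> R].
Proof.
have [jNi|jNi] := eqVneq j (negi i).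
  exists (a * eps i), 0; split=> // w k; rewrite (TiiE _ _ jNi) jNi; ring.
exists a, (- (a * eps i * eps j)); split=> // w k; rewrite TijE //; ring.
Qed.

Lemma Ep_eqP (g h : Ep) :
  (forall w k, (val g : Sp) w k = (val h : Sp) w k :> R) -> g = h.
Proof.
by move=> gh; apply/val_inj/Sp_eqP => w; apply/ffunP => k; apply: gh.
Qed.

Lemma Ep_mulE (g h : Ep) w :
  (val (g * h)%g : Sp) w = (val g : Sp) ((val h : Sp) w).
Proof. by rewrite valM. Qed.

Lemma commE (G : groupType) (x y z : G) :
  (x * y = z * (y * x) -> x * y * x^-1 * y^-1 = z)%g.
Proof. by move=> ->; rewrite !mulgA mulgK mulgK. Qed.

Lemma neq_negi i : (i == negi i) = false.
Proof. by rewrite eq_sym negi_neq. Qed.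

Lemma neqs i j : i != j -> ((i == j) = false) * ((j == i) = false).
Proof. by move=> /negbTE ij; split=> //; rewrite eq_sym. Qed.

Lemma neqNs i j : i != negi j ->
  ((i == negi j) = false) * ((negi j == i) = false) *
  ((negi i == j) = false) * ((j == negi i) = false).
Proof.
by move=> /negbTE ij; do !split; rewrite // 1?eq_negiC // eq_sym ?eq_negiC.
Qed.

Lemma Ep_TE i j (ij : i != j) a : val (Ep_T ij a) = Tij ij a.
Proof. by []. Qed.

Lemma phi_rel p q : St_rel p q -> word_eval phi_gen p = word_eval phi_gen q.
Proof.
have evX := phi_gen_eval.
have idxE := (eq_negi, negi_neq, neq_negi, negiK).
case=> {p q}.
- move=> i j a ij ji; rewrite !evX; apply: Ep_eqP => w k.
  rewrite !Ep_TE; have [jNi|jNi] := eqVneq j (negi i).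
    subst j; rewrite !TiiE ?negiK // epsN.
    have := eps_sqr i; set e := eps i => e1.
    have -> : (k == i)%:R * (- a * e * - e) * e * w (negi i) =
      (k == i)%:R * a * e * w (negi i) * (e * e) by ring.
    by rewrite e1 mulr1.
  have iNj : negi i != negi (negi j) by rewrite negiK eq_sym.
  rewrite !TijE // !epsN !negiK.
  have := eps_sqr i; have := eps_sqr j; set e := eps i; set f := eps j => f1 e1.
  have -> : (k == i)%:R * (- a * e * f) * - f * - e * w j =
    - ((k == i)%:R * a * w j) * (e * e) * (f * f) by ring.
  by rewrite f1 e1; ring.
- move=> i j a b ij; rewrite word_eval_cat !evX; apply: Ep_eqP => w k.
  rewrite Ep_mulE !Ep_TE; have [jNi|jNi] := eqVneq j (negi i).
    by subst j; rewrite !TiiE // !idxE /=; ring.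
  by rewrite !TijE // !idxE ?(neqs ij) /=; ring.
- move=> i j h k a b ij hk; rewrite !inE !negb_or.
  move=> /andP[hj hNi] /andP[ki kNj].
  rewrite word_eval_comm !evX /word_eval big_nil; apply: commE; rewrite mul1g.
  apply: Ep_eqP => w m; rewrite !Ep_mulE !Ep_TE.
  have [c [d [_ TA]]] := TE ij a; have [c' [d' [_ TB]]] := TE hk b.
  rewrite !(TA, TB) !idxE ?(neqs hj) ?(neqs ki) ?(neqNs hNi) ?(neqNs kNj) /=.
  ring.
- move=> i j k a b ij jk ik; rewrite !inE !negb_or => /andP[iNj iNk] jNk.
  rewrite word_eval_comm !evX; apply: commE.
  apply: Ep_eqP => w m; rewrite !Ep_mulE !Ep_TE.
  have [jNi kNi kNj] : [/\ j != negi i, k != negi i & k != negi j].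
    by split; rewrite ?(neqNs iNj) ?(neqNs iNk) ?(neqNs jNk).
  rewrite !TijE // !idxE !eqxx ?(neqs ij) ?(neqs ik) ?(neqs jk).
  rewrite ?(neqNs iNj) ?(neqNs iNk) ?(neqNs jNk) /=.
  have := eps_sqr j; set f := eps j => f1.
  ring: f1.
- move=> i j a b iNi Nij ij Njj.
  rewrite word_eval_comm word_eval_cat !evX; apply: commE.
  apply: Ep_eqP => w m; rewrite !Ep_mulE !Ep_TE.
  have iNj : i != negi j by rewrite -eq_negiC.
  have jNi : j != negi i by rewrite (neqNs iNj).
  have jNNi : j != negi (negi i) by rewrite negiK eq_sym.
  have jNNj : j = negi (negi j) by rewrite negiK.
  move: (TiiE iNi a erefl) (TijE Nij b jNNi) (TijE ij (a * b * eps i) jNi)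
    (TiiE Njj (- (a * b ^+ 2)) jNNj).
  move: (Tij iNi a) (Tij Nij b) (Tij ij _) (Tij Njj _) => A B C D TA TB TC TD.
  do 4!rewrite ?TA ?TB ?TC ?TD.
  rewrite !idxE !eqxx ?(neqs ij) ?(neqNs iNj) /= !epsN.
  have := eps_sqr i; have := eps_sqr j; set e := eps i; set f := eps j => f1 e1.
  ring: e1 f1.
- move=> i j a b ij jNi iNi.
  rewrite word_eval_comm !evX; apply: commE.
  apply: Ep_eqP => w m; rewrite !Ep_mulE !Ep_TE.
  have iNj : i != negi j by rewrite (neqNs jNi).
  have NiNj : negi i != negi j by rewrite eq_negi.
  move: (TijE ij a jNi) (TijE jNi b NiNj) (TiiE iNi (2 * a * b * eps i) erefl).
  move: (Tij ij a) (Tij jNi b) (Tij iNi _) => A B C TA TB TC.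
  do 3!rewrite ?TA ?TB ?TC.
  rewrite !idxE !eqxx ?(neqs ij) ?(neqNs iNj) /= !epsN.
  have := eps_sqr i; have := eps_sqr j; set e := eps i; set f := eps j => f1 e1.
  ring: e1 f1.
Qed.

Definition phi : StSp -> Ep := pres_lift phi_rel.
HB.instance Definition _ := Multiplicative.on phi.

Lemma phiE i j (ij : i != j) a : phi (X ij a) = Ep_T ij a.
Proof.
rewrite /phi pres_lift_gen /phi_gen /=; congr (Ep_T _ a).
exact: bool_irrelevance.
Qed.

Lemma phi_surj : surjective phi.
Proof.
have phi1 : phi 1%g = 1%g.
  by apply: (@mulgI _ (phi 1%g)); rewrite -gmulfM !mulg1.
suff sur s : in_gen is_Tij s -> exists g, val (phi g) = s.
  by move=> h; have [g /val_inj <-] := sur _ (asboolW (valP h)); exists g.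
elim=> {s} [_ [i j ij a]||s t _ [g <-] _ [h <-]|s _ [g <-]].
- by exists (X ij a); rewrite phiE.
- by exists 1%g; apply: (congr1 val phi1).
- by exists (g * h)%g; rewrite gmulfM.
- exists (g^-1)%g; apply: (@mulgI _ (val (phi g))).
  by rewrite -valM -gmulfM !mulgV; apply: (congr1 val phi1).
Qed.

Definition K2Sp := kernel phi.
HB.instance Definition _ := Group.on K2Sp.

End Symplectic.

(* Main.v *)
Require Import Defs.
From HB Require Import structures.
From mathcomp Require Import all_boot all_algebra.
From mathcomp Require Import boolp classical_sets.
From mathcomp.multinomials Require Import freeg.
From mathcomp Require Import ring.
Import Defs.
Set Implicit Arguments.
Unset Strict Implicit.
Unset Printing Implicit Defensive.
Import GRing.Theory.
Local Open Scope ring_scope.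
Local Open Scope quotient_scope.

(** For a surjective homomorphism p : S -> E with central kernel and perfect
    S there is a surjection of H2(E) onto the kernel of p whose kernel is
    isomorphic to H2(S), and H2(S) vanishes as soon as every central extension
    of S splits ([H2_central_extension]). The theorem is the case p = phi, so
    three facts about StSp(2l, R) are needed: it is perfect, the kernel of phi
    is central, and under the last hypotheses its central extensions split.
    Perfectness is immediate from R3 and R4 ([StSp_perfect]).

    Centrality ([ker_central]). Every vector u of V gets an element
    X(u, a) of StSp(2l, R) over the transvection T(u, 0, a), such that
    g X(u, a) g^-1 = X(phi(g) u, a) for all g and X(e_i, a) = X_{i,-i}(a).
    If phi(k) = 1, then k commutes with all X_{i,-i}(a); the kernel being
    normal, k also commutes with their conjugates, and by R4 these generate the
    group. To build X(u, a), split u = u' + p with p in the hyperbolic plane of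
    e_n and u' orthogonal to it. The unipotent radical of the stabiliser of the
    line of e_n is a Heisenberg group on which phi is injective
    ([unip_act_inj]), so it has well defined elements over T(e_n, v, a) for v
    orthogonal to the plane; words in them, for n and -n, lie over T(u', 0, a)
    and over T(u', p a, 0), and a second plane takes care of T(p, 0, a)
    ([transvX]). The result is equivariant under the root elements that fix
    e_n and e_-n. The point is that it does not depend on n
    ([transvX_indep]): since l >= 3, each root element fixes some hyperbolic
    plane, and equivariance under all of the group follows ([transvX_conj]).

    Splitting ([splitting], [splittingK]). In a central extension the commutator
    of lifts of x and y depends on x and y only. Define the lift of X_ij(ab) as
    the commutator of lifts of X_ik(a) and X_kj(b); the Hall-Witt identity
    shows that it depends neither on k nor on the factorisation ([via_shift]).
    The lifts of X_{i,-i}(a) are read off from R4 in the same manner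
    ([R4tail_shift]). These lifts satisfy all the relations R0-R5. The delicate
    one is R2: commuting root elements must have commuting lifts. If one of the
    two is a commutator of elements that commute with the other, this is
    automatic ([lcommute_commut]). The exception is the pair X_{i,-i}(c),
    X_{k,-k}(t) ([lcommute_long_long]). A fourth hyperbolic plane settles it;
    without one, R4 still gives it for t in the ideal generated by all
    b^2 - b, which is R unless R has a residue field with two elements
    ([no_boolean_quotientP]).

    Homology. A set-theoretic section of p has a 2-cocycle with values in the
    kernel A of p; it extends to a homomorphism kappa from 2-chains of E to A
    that kills boundaries. Its restriction to cycles is the required map. That
    it is onto, and that its kernel consists of the classes coming from S,
    follows because S and E are perfect ([kappa_onto], [kappa_exact]). The map
    from H2(S) to H2(E) is injective because the extension of S by the
    2-chains modulo boundaries is central also as an extension of E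
    ([push2_boundary]). *)

(** * Commutators and identities between words *)

(** The convention of the relations of StSp; the notation [[~ x, y]] stands
    for x^-1 y^-1 x y instead. *)
Definition commut (G : groupType) (x y : G) : G := (x * y * x^-1 * y^-1)%g.

Section Morphisms.
Variables (G H : groupType) (f : {multiplicative G -> H}).

Lemma multiplicative1 : f 1%g = 1%g.
Proof. by apply: (@mulgI _ (f 1%g)); rewrite -gmulfM !mulg1. Qed.

Lemma multiplicativeV x : f (x^-1)%g = (f x)^-1%g.
Proof. by apply: (@mulgI _ (f x)); rewrite -gmulfM !mulgV multiplicative1. Qed.

End Morphisms.

Section Words.
Variable G : groupType.
Implicit Types k m s u x y z A B D E F P : G.
Local Open Scope group_scope.

Lemma commut1P x y : commut x y = 1 <-> x * y = y * x.
Proof.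
split=> [|xy]; last by rewrite /commut xy !gnorm.
by move=> /(congr1 (fun z => z * y * x)); rewrite /commut !gnorm.
Qed.

Lemma conj_commut x y : x * y * x^-1 = commut x y * y.
Proof. by rewrite /commut !gnorm. Qed.

Lemma commutMl x y z : commut (x * y) z = x * commut y z * x^-1 * commut x z.
Proof. by rewrite /commut !gnorm. Qed.

Lemma commutMr x y z : commut x (y * z) = commut x y * (y * commut x z * y^-1).
Proof. by rewrite /commut !gnorm. Qed.

Lemma commut_inv x y : (commut x y)^-1 = commut y x.
Proof. by rewrite /commut !gnorm. Qed.

Lemma conj_eqP x y z : x * y = z * x <-> x * y * x^-1 = z.
Proof. by split=> [->|<-]; rewrite !gnorm. Qed.

Lemma commute_conjP x y : commute x y <-> x * y * x^-1 = y.
Proof. exact: conj_eqP. Qed.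

Lemma conj_mul x y z : (x * y) * z * (x * y)^-1 = x * (y * z * y^-1) * x^-1.
Proof. by rewrite !gnorm. Qed.

Lemma commuteMl x y z : commute x z -> commute y z -> commute (x * y) z.
Proof. by move=> xz yz; apply/commute_sym/commuteM; apply: commute_sym. Qed.

Lemma commuteVl x y : commute x y -> commute x^-1 y.
Proof. by move=> xy; apply/commute_sym/commuteV/commute_sym. Qed.

Lemma commute_commut x y z : commute z x -> commute z y -> commute z (commut x y).
Proof. by move=> zx zy; rewrite /commut; do !apply: commuteM => //; apply: commuteV. Qed.

(** The Hall-Witt identity, in which the third factor vanishes because x and z
    commute. *)
Lemma hall_witt x y z : commute x z ->
  commut x (commut y z) = y * commut (commut y^-1 x) z * y^-1.
Proof.
move=> xz; have xzx : x^-1 * z * x = z by rewrite -mulgA -xz mulKg.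
have zxz : z^-1 * x^-1 * z = x^-1 by rewrite -mulgA (commuteVl xz) mulKg.
transitivity (x * y * z * y^-1 * (z^-1 * x^-1 * z) * y * z^-1 * y^-1).
  by rewrite /commut !gnorm.
transitivity (x * y * (x^-1 * z * x) * y^-1 * x^-1 * y * z^-1 * y^-1).
  by rewrite zxz xzx.
by rewrite /commut !gnorm.
Qed.

Lemma cancel_word u x m : commute u x -> u^-1 * x * (u * m) = x * m.
Proof. by move=> ux; rewrite -!mulgA [x * (u * m)]mulgA -ux -!mulgA mulKg. Qed.

Lemma mid_word u k m x : x = u * k * m -> k = u^-1 * x * m^-1.
Proof. by move=> ->; rewrite !gnorm. Qed.

Lemma swap_word s s' m m' : commute s m' -> commute s s' -> commute m m' ->
  (s' * m') * (s * m) = (s * s') * (m * m').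
Proof.
by move=> sm ss mm; rewrite !mulgA -(mulgA s' m' s) -sm !mulgA ss -!mulgA mm.
Qed.

Lemma swap_word3 s s' k m m' : commute s' k -> commute s' m ->
  (s * m) * (k * s' * m') = (s * s') * (m * k * m').
Proof.
by move=> sk sm; rewrite -sk !mulgA -(mulgA s m s') -sm !mulgA.
Qed.

Lemma conj_word x B P A : x * (B * P * A * P^-1) * x^-1 =
  (x * B * x^-1) * (x * P * x^-1) * (x * A * x^-1) * (x * P * x^-1)^-1.
Proof. by rewrite !gnorm. Qed.

(** The words B P A P^-1 below are those of [longX]; D measures the failure of
    x to commute with P and drops out because it commutes with P and A. *)
Lemma comm_word1 x B P A D : commute x B -> commute x A ->
  x * P * x^-1 = D * P -> commute D P -> commute D A ->
  commute x (B * P * A * P^-1).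
Proof.
move=> /commute_conjP xB /commute_conjP xA xP DP DA; apply/commute_conjP.
by rewrite conj_word xB xA xP DP invgM !mulgA -(mulgA _ D) DA !mulgA mulgK.
Qed.

(** Here x moves both B and A, and the two errors E and F' cancel. *)
Lemma comm_word2 x B P A E F F' : x * B * x^-1 = E * B -> commute x P ->
  x * A * x^-1 = F * A -> P * F * P^-1 = F' -> commute B F' -> E * F' = 1 ->
  commute x (B * P * A * P^-1).
Proof.
move=> xB /commute_conjP xP xA /conj_eqP PF BF EF; apply/commute_conjP.
rewrite conj_word xB xA xP.
by rewrite !mulgA -(mulgA _ P) PF !mulgA -(mulgA E) BF !mulgA EF mul1g.
Qed.

(** Substituting for L a commutator of x and A turns the word for the long
    element of one hyperbolic plane into a conjugate of that of another one,
    see [longX_indep]. *)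
Lemma flip_word Bm Cm Pm A B P E x Z L :
  L = Cm * (x * A * x^-1 * A^-1) ->
  commute Pm A -> Pm * x * Pm^-1 = x * P -> Z = B * P * A * P^-1 ->
  commute x Z -> x * B * x^-1 = E * B ->
  Bm * (Pm * Cm * Pm^-1) * B^-1 * E^-1 = A ->
  Bm * Pm * L * Pm^-1 = A * Z * A^-1.
Proof.
move=> -> /commute_conjP PA Px YE /commute_conjP xY xB H.
have -> : Bm * Pm * (Cm * (x * A * x^-1 * A^-1)) * Pm^-1 =
  Bm * (Pm * Cm * Pm^-1) * ((Pm * x * Pm^-1) * (Pm * A * Pm^-1)
    * (Pm * x * Pm^-1)^-1 * (Pm * A * Pm^-1)^-1) by rewrite !gnorm.
rewrite PA Px.
have -> : x * P * A * (x * P)^-1 = (x * B * x^-1)^-1 * (x * Z * x^-1).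
  by rewrite YE !gnorm.
by rewrite xB xY -H !gnorm.
Qed.

(** The reordering behind the additivity of [longX] in the vector. *)
Lemma add_word W Bv Pv Pw A Bw Yv Yw : Bw = W * A^-1 ->
  Yv = Bv * Pv * A * Pv^-1 -> Yw = Bw * Pw * A * Pw^-1 ->
  commute Pv Yw -> commute W Yv ->
  W * Bv * (Pv * Pw) * A * (Pv * Pw)^-1 = Yv * commut W Pv * Yw.
Proof.
move=> BwE YvE YwE PY WY.
have -> : W * Bv * (Pv * Pw) * A * (Pv * Pw)^-1 =
  W * (Bv * Pv * A * Pv^-1) * Pv * A^-1 * Bw^-1 * (Bw * Pw * A * Pw^-1) * Pv^-1.
  by rewrite !gnorm.
rewrite -YvE -YwE WY -!mulgA (commuteV (commute_sym PY)) BwE /commut.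
by rewrite !gnorm.
Qed.

Lemma swap_blocks (Yv Qm Qn Pp Pq Z : G) :
  commute Pp Qn -> commute Qm Qn -> commute Pp Z -> commute Pq Z ->
  commute Pq Qm -> commute Pp Pq ->
  Yv * Qm * Pp * (Qn * Z) * Pq = Yv * Qn * Pq * (Qm * Z) * Pp.
Proof.
move=> c1 c2 c3 c4 c5 c6.
have A1 : commute Pp (Qn * (Pq * Z)) by do !apply: commuteM.
have A2 : commute Qm (Qn * Pq) by apply: commuteM => //; apply: commute_sym.
transitivity (Yv * (Qm * (Pp * (Qn * (Pq * Z))))).
  by rewrite c4 !mulgA.
rewrite A1; transitivity (Yv * (Qm * (Qn * Pq)) * Z * Pp); first by rewrite !mulgA.
by rewrite A2 !mulgA.
Qed.

End Words.

(** * Root elements and their action on the module *)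

Section Roots.
Variables (R : comPzRingType) (l : nat).
Local Notation idx := (idx l).
Local Notation St := (StSp R l).
Local Notation eps := (@eps R l).

Implicit Types (i j h k m n : idx) (a b c d : R) (g : St).

Lemma pres_gen_eval (gen : choiceType) (rel : word gen -> word gen -> Prop)
  (w : word gen) :
  word_eval (pres_gen rel) w = \pi_(presented rel) w.
Proof.
elim: w => [|[x b] w IH]; first by rewrite /word_eval big_nil.
rewrite -cat1s word_eval_cat IH -[RHS]pres_mulE; congr (_ * _)%g.
rewrite /word_eval big_seq1 /=; case: b => //=.
exact: pres_invE.
Qed.

Lemma St_rel_eval u v : @St_rel R l u v ->
  word_eval (pres_gen (@St_rel R l)) u = word_eval (pres_gen (@St_rel R l)) v.
Proof. by move=> uv; rewrite !pres_gen_eval; apply/eqP/presented_eqP/word_eq_rel. Qed.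

(** Defined for all pairs of indices, with the value 1 on the diagonal, so
    that no proof of i <> j is carried along. *)
Definition xroot i j a : St :=
  if insub (i, j) is Some p then pres_gen _ ((p, a) : St_gen R l) else 1%g.

Lemma xrootE i j (ij : i != j) a : xroot i j a = X ij a.
Proof. by rewrite /xroot insubT. Qed.

Lemma eval_Xw i j (ij : i != j) a :
  word_eval (pres_gen (@St_rel R l)) (Xw ij a) = xroot i j a.
Proof. by rewrite word_eval1 (xrootE ij). Qed.

Lemma xroot_id i a : xroot i i a = 1%g.
Proof. by rewrite /xroot insubF //= eqxx. Qed.

Lemma xroot_R0 i j a : i != j ->
  xroot i j a = xroot (negi j) (negi i) (- a * eps i * eps j).
Proof.
move=> ij; have ji : negi j != negi i by rewrite eq_negi eq_sym.
by rewrite -!eval_Xw; apply/St_rel_eval/St_R0.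
Qed.

Lemma xrootD i j a b : (xroot i j a * xroot i j b)%g = xroot i j (a + b).
Proof.
have [<-|ij] := eqVneq i j; first by rewrite !xroot_id mul1g.
by have /St_rel_eval := St_R1 a b ij; rewrite word_eval_cat !eval_Xw.
Qed.

Lemma xroot_R2 i j h k a b : i != j -> h != k ->
  h \notin [:: j; negi i] -> k \notin [:: i; negi j] ->
  (xroot i j a * xroot h k b = xroot h k b * xroot i j a)%g.
Proof.
move=> ij hk c1 c2; apply/commut1P.
have /St_rel_eval := St_R2 a b ij hk c1 c2; rewrite word_eval_comm !eval_Xw.
by rewrite /commut => ->; rewrite /word_eval big_nil.
Qed.

Lemma xroot_R3 i j k a b : i != j -> j != k -> i != k ->
  i \notin [:: negi j; negi k] -> j != negi k ->
  commut (xroot i j a) (xroot j k b) = xroot i k (a * b).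
Proof.
move=> ij jk ik c1 c2.
have /St_rel_eval := St_R3 a b ij jk ik c1 c2.
by rewrite word_eval_comm !eval_Xw.
Qed.

Lemma negiN i : i != negi i.
Proof. by rewrite eq_sym negi_neq. Qed.

Lemma xroot_R4 i j a b : negi i != j -> i != j ->
  commut (xroot i (negi i) a) (xroot (negi i) j b) =
  (xroot i j (a * b * eps i) * xroot (negi j) j (- (a * b ^+ 2)))%g.
Proof.
move=> Nij ij; have Njj : negi j != j by rewrite negi_neq.
have /St_rel_eval := St_R4 a b (negiN i) Nij ij Njj.
by rewrite word_eval_comm word_eval_cat !eval_Xw.
Qed.

Lemma xroot_R5 i j a b : i != j -> j != negi i ->
  commut (xroot i j a) (xroot j (negi i) b) = xroot i (negi i) (2%:R * a * b * eps i).
Proof.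
move=> ij jNi.
have /St_rel_eval := St_R5 a b ij jNi (negiN i).
by rewrite word_eval_comm !eval_Xw.
Qed.

Lemma xroot_0 i j : xroot i j 0 = 1%g.
Proof. by apply: (@mulgI _ (xroot i j 0)); rewrite xrootD addr0 mulg1. Qed.

Lemma xrootV i j a : (xroot i j a)^-1%g = xroot i j (- a).
Proof. by apply: (@mulgI _ (xroot i j a)); rewrite xrootD subrr xroot_0 mulgV. Qed.

Lemma StSp_ind (P : St -> Prop) : P 1%g ->
  (forall i j a g, i != j -> P g -> P (xroot i j a * g)%g) -> forall g, P g.
Proof.
move=> P1 PM g; rewrite -[g]reprK; elim: (repr g) => [|[[[[i j] ij] a] b] w IH];
  first exact: P1.
rewrite -pres_gen_eval -cat1s word_eval_cat (pres_gen_eval _ w).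
rewrite /word_eval big_seq1 /=.
have /= E : pres_gen (@St_rel R l)
  (exist _ (i, j) ij : {ij : idx * idx | ij.1 != ij.2}, a) = xroot i j a.
  by rewrite (xrootE ij).
by case: b; rewrite /= E ?xrootV; apply: PM.
Qed.

Definition act g : V R l -> V R l := val (phi g) : Sp R l.

Lemma act1 v : act 1%g v = v.
Proof. by rewrite /act multiplicative1. Qed.

Lemma actM g g' v : act (g * g')%g v = act g (act g' v).
Proof. by rewrite /act gmulfM Ep_mulE. Qed.

Lemma actVK g v : act g (act g^-1%g v) = v.
Proof. by rewrite -actM mulgV act1. Qed.

Lemma act_linear g : linear (act g).
Proof. by have [] := SpP (val (phi g)). Qed.

Lemma actD g v w : act g (v + w) = act g v + act g w.
Proof. by have := act_linear g 1 v w; rewrite !scale1r. Qed.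

Lemma act0 g : act g 0 = 0.
Proof. by apply: (@addrI _ (act g 0)); rewrite -actD !addr0. Qed.

Lemma actZ g a v : act g (a *: v) = a *: act g v.
Proof. by have := act_linear g a v 0; rewrite act0 !addr0. Qed.

Lemma act_form g u v : form (act g u) (act g v) = form u v.
Proof. by have [_ _ fg] := SpP (val (phi g)); apply: fg. Qed.

Lemma act_ker g : phi g = 1%g -> forall v, act g v = v.
Proof. by move=> g1 v; rewrite /act g1. Qed.

Lemma act_xroot i j a : i != j ->
  act (xroot i j a) =1 T_fun (e_ R i) (Tij_vec i j a) (Tij_scal i j a).
Proof. by move=> ij w; rewrite (xrootE ij) /act phiE. Qed.

Lemma act_T_fun g u v a w : act g (T_fun u v a w) = T_fun (act g u) (act g v) a (act g w).
Proof. by rewrite /T_fun !actD !actZ !act_form. Qed.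

(** Root elements named after the transvections that they lift: [xshort n j c]
    lies over T(e_n, c e_j, 0) and [xlong n a] over T(e_n, 0, a). *)
Definition xshort n j c : St := xroot n (negi j) (c * eps j).
Definition xlong n a : St := xroot n (negi n) a.

(** The indices belong to different hyperbolic planes. *)
Definition indep i j := (i != j) && (i != negi j).

Lemma indepE i j : indep i j -> ((i == j) = false) * ((j == i) = false) *
 ((i == negi j) = false) * ((negi i == j) = false) * ((j == negi i) = false)
 * ((negi j == i) = false).
Proof.
move=> /andP[/negbTE ij /negbTE ij']; do !split => //; rewrite 1?[RHS]eq_sym //.
- by rewrite eq_sym.
- by rewrite eq_negiC.
- by rewrite eq_sym eq_negiC.
- by rewrite eq_sym.
Qed.

Lemma indep_sym i j : indep i j = indep j i.
Proof. by rewrite /indep eq_sym; congr (_ && _); rewrite eq_sym eq_negiC. Qed.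
Lemma indepNl i j : indep (negi i) j = indep i j.
Proof. by rewrite /indep !eq_negiC negiK andbC. Qed.
Lemma indepNr i j : indep i (negi j) = indep i j.
Proof. by rewrite indep_sym indepNl indep_sym. Qed.
Lemma indep_snd i j : indep i j = (i.2 != j.2).
Proof.
case: i j => [[] i] [[] j]; rewrite /indep /negi /= !xpair_eqE /= ?andbT //.
Qed.

Lemma act_xshort n j c : indep n j ->
  act (xshort n j c) =1 T_fun (e_ R n) (c *: e_ R j) 0.
Proof.
move=> nj w; rewrite act_xroot ?(indepE nj) //
  /Tij_vec /Tij_scal eq_negi [j == n]eq_sym !(indepE nj).
by rewrite negiK -mulrA eps_sqr mulr1.
Qed.

Lemma act_xlong n a : act (xlong n a) =1 T_fun (e_ R n) 0 a.
Proof. by move=> w; rewrite act_xroot ?negiN // /Tij_vec /Tij_scal eqxx. Qed.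

Lemma xshort_sym n h c : indep n h -> xshort n h c = xshort h n c.
Proof.
move=> nh; rewrite /xshort xroot_R0 ?(indepE nh) // negiK; congr xroot.
rewrite epsN; have := eps_sqr R h; set e := eps h => e1.
by ring: e1.
Qed.

Lemma xshortD n j a b : (xshort n j a * xshort n j b)%g = xshort n j (a + b).
Proof. by rewrite xrootD -mulrDl. Qed.
Lemma xlongD n a b : (xlong n a * xlong n b)%g = xlong n (a + b).
Proof. exact: xrootD. Qed.
Lemma xshort_0 n j : xshort n j 0 = 1%g. Proof. by rewrite /xshort mul0r xroot_0. Qed.
Lemma xlong_0 n : xlong n 0 = 1%g. Proof. exact: xroot_0. Qed.

Lemma xlong_xshort n j a c : indep n j ->
  (xlong n a * xshort n j c = xshort n j c * xlong n a)%g.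
Proof.
move=> nj; apply: xroot_R2; rewrite ?inE ?eq_negi ?negi_neq ?negiN ?(indepE nj) //.
by rewrite (negbTE (negiN n)).
Qed.

(** The short root elements of the unipotent radical of e_n commute up to a
    long one: by R5 for opposite indices j and k, and by R2 otherwise. *)
Lemma xshort_comm n j k c d : indep n j -> indep n k ->
  exists b, (xshort n j c * xshort n k d = xlong n b * (xshort n k d * xshort n j c))%g.
Proof.
move=> nj nk; have [->|jk] := eqVneq k (negi j).
  exists (2%:R * (c * eps j) * (- (d * eps (negi j)) * eps n * eps j)* eps n).
  rewrite /xlong -(@xroot_R5 n (negi j)) ?(indepE nj) //; last first.
    by rewrite eq_negi eq_sym (indepE nj).
  rewrite [xshort n (negi j) d]xroot_R0 ?negiK ?(indepE nj) //.
  by rewrite /commut !gnorm.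
exists 0; rewrite xlong_0 mul1g; apply: xroot_R2;
  rewrite ?inE ?(indepE nj) ?(indepE nk) //.
  by rewrite (negbTE (negiN n)).
by rewrite eq_negi (negbTE jk).
Qed.

(** * Unipotent radicals and Levi subgroups *)

(** Orthogonality to the hyperbolic plane of e_n, see [offP]. *)
Definition off n (v : V R l) := (v n = 0 :> R) /\ (v (negi n) = 0 :> R).

Lemma offP n v : off n v <-> form (e_ R n) v = 0 /\ form (e_ R (negi n)) v = 0.
Proof.
rewrite !form_basisl negiK epsN; have e1 := eps_sqr R n; split=> [[-> ->]|[h1 h2]].
  by rewrite !mulr0.
split; last by rewrite -[LHS]mul1r -e1 -mulrA h1 mulr0.
by rewrite -[LHS]mul1r -e1 -mulrA -[X in _ * X]opprK -mulNr h2 oppr0 mulr0.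
Qed.

Lemma offN n v : off (negi n) v <-> off n v.
Proof. by rewrite /off negiK; split=> -[]. Qed.

Lemma off_form n v : off n v -> form (e_ R n) v = 0.
Proof. by case/offP. Qed.

Lemma offD n v w : off n v -> off n w -> off n (v + w).
Proof. by move=> [v1 v2] [w1 w2]; rewrite /off !VE v1 v2 w1 w2 addr0. Qed.
Lemma offZ n c v : off n v -> off n (c *: v).
Proof. by move=> [v1 v2]; rewrite /off !VE v1 v2 mulr0. Qed.
Lemma off_e n j : indep n j -> off n (e_ R j).
Proof. by move=> nj; rewrite /off !VE !(indepE nj). Qed.
Lemma off0 n : off n 0. Proof. by rewrite /off !VE. Qed.

Definition indeps n := [seq j <- enum {: idx} | indep n j].

Definition shortprod n (s : seq idx) (v : V R l) : St :=
  (\prod_(j <- s) xshort n j (v j : R))%g.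

(** Normal form for the unipotent radical of the stabiliser of the line of
    e_n: one long root element times the short ones in a fixed order. *)
Definition in_unip n (g : St) :=
  exists a v, off n v /\ g = (xlong n a * shortprod n (indeps n) v)%g.

Lemma xshort_shortprod n s k c v : all (indep n) s -> uniq s -> k \in s ->
  exists d, (xshort n k c * shortprod n s v =
    xlong n d * shortprod n s (v + c *: e_ R k))%g.
Proof.
elim: s => [//|j s IH] /=; rewrite inE => /andP[nj ns] /andP[js us].
rewrite /shortprod !big_cons; have [kj|kj] := eqVneq k j => /= ks.
  rewrite kj {IH}.
  exists 0; rewrite xlong_0 mul1g mulgA xshortD !VE eqxx mulr1 [c + _]addrC;
    congr (_ * _)%g.
  apply: eq_big_seq => i is_; rewrite !VE; case: eqP => [ij|];
    last by rewrite mulr0 addr0.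
  by move: js; rewrite -ij is_.
have [d E] := IH ns us ks; have nk : indep n k by move/allP: ns; apply.
have [b Eb] := xshort_comm c (v j) nk nj.
exists (b + d); rewrite mulgA Eb -!mulgA [X in (_ * (_ * X))%g]E -xlongD -!mulgA;
  congr (_ * _)%g.
by rewrite !VE eq_sym (negbTE kj) mulr0 addr0 [RHS]mulgA xlong_xshort // -mulgA.
Qed.

Lemma all_indeps n : all (indep n) (indeps n).
Proof. exact: filter_all. Qed.

Lemma mem_indeps n j : (j \in indeps n) = indep n j.
Proof. by rewrite mem_filter mem_enum andbT. Qed.

Lemma indeps_uniq n : uniq (indeps n).
Proof. by rewrite filter_uniq ?enum_uniq. Qed.

Lemma in_unip_xlongM n a g : in_unip n g -> in_unip n (xlong n a * g)%g.
Proof. by move=> [b [v [ov ->]]]; exists (a + b), v; rewrite mulgA xlongD. Qed.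

Lemma in_unip_xshortM n j c g : indep n j -> in_unip n g ->
  in_unip n (xshort n j c * g)%g.
Proof.
move=> nj [b [v [ov ->]]]; rewrite mulgA -xlong_xshort // -mulgA.
have /= [||d ->] := @xshort_shortprod n _ j c v (all_indeps n);
  rewrite ?indeps_uniq ?mem_indeps //.
do 2!apply: in_unip_xlongM; exists 0, (v + c *: e_ R j); rewrite xlong_0 mul1g;
  split=> //.
by apply: offD => //; apply/offZ/off_e.
Qed.

Lemma in_unip1 n : in_unip n 1%g.
Proof.
exists 0, 0; split; first exact: off0.
by rewrite xlong_0 mul1g /shortprod big1 // => j _; rewrite VE xshort_0.
Qed.

Lemma in_unip_shortprodM n s v g : all (indep n) s -> in_unip n g ->
  in_unip n (shortprod n s v * g)%g.
Proof.
elim: s => [|j s IH] /=; first by rewrite /shortprod big_nil mul1g.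
move=> /andP[nj ns] ug; rewrite /shortprod big_cons -mulgA; apply: in_unip_xshortM => //.
exact: IH.
Qed.

Lemma in_unipM n g g' : in_unip n g -> in_unip n g' -> in_unip n (g * g')%g.
Proof.
move=> [a [v [ov ->]]] ug'; rewrite -mulgA; apply: in_unip_xlongM.
by apply: in_unip_shortprodM; rewrite ?all_indeps.
Qed.

Lemma form_sum u (I : Type) (s : seq I) (F : I -> V R l) :
  form u (\sum_(i <- s) F i) = \sum_(i <- s) form u (F i).
Proof.
elim: s => [|i s IH]; first by rewrite !big_nil form0r.
by rewrite !big_cons formDr IH.
Qed.

Lemma act_shortprod n s v : all (indep n) s -> exists c,
  act (shortprod n s v) =1 T_fun (e_ R n) (\sum_(j <- s) (v j : R) *: e_ R j) c.
Proof.
elim: s => [|j s IH] /=.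
  exists 0 => w; rewrite /shortprod !big_nil act1 /T_fun form0l mul0r.
  by rewrite scaler0 add0r scale0r !addr0.
move=> /andP[nj ns]; have [c E] := IH ns.
exists (0 + c + form ((v j : R) *: e_ R j) (\sum_(j <- s) (v j : R) *: e_ R j)) => w.
rewrite [in RHS]big_cons -T_funM /=; first last.
- rewrite form_sum big1_seq // => i /andP[_ /(allP ns) ni].
  by rewrite formZr form_basis !(indepE ni) !mulr0.
- by rewrite formZr form_basis !(indepE nj) !mulr0.
by rewrite -E -(act_xshort _ nj) -actM /shortprod big_cons.
Qed.

Lemma coord_sum (s : seq idx) v k : uniq s ->
  (\sum_(j <- s) (v j : R) *: e_ R j : V R l) k = (if k \in s then v k else 0) :> R.
Proof.
elim: s => [|j s IH] /=; first by rewrite big_nil VE.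
move=> /andP[js us]; rewrite big_cons V_add V_scale e_E (IH us) inE.
have [->|kj] /= := eqVneq k j; first by rewrite (negbTE js) mulr1 addr0.
by rewrite mulr0 add0r.
Qed.

Lemma indepPn i j : ~~ indep i j -> j = i \/ j = negi i.
Proof.
rewrite /indep negb_and !negbK => /orP[/eqP->|/eqP ->]; first by left.
by right; rewrite negiK.
Qed.

Lemma indeps_sum n v : off n v -> \sum_(j <- indeps n) (v j : R) *: e_ R j = v.
Proof.
move=> [v1 v2]; apply/ffunP => k; rewrite coord_sum ?indeps_uniq // mem_indeps.
by case: ifPn => // /indepPn[->|->]; rewrite ?v1 ?v2.
Qed.

Lemma unip_lift_ex n v a : off n v ->
  exists g, in_unip n g /\ act g =1 T_fun (e_ R n) v a.
Proof.
move=> ov; have [c E] := act_shortprod v (all_indeps n).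
exists (xlong n (a - c) * shortprod n (indeps n) v)%g; split;
  first by exists (a - c), v; split.
move=> w; rewrite actM act_xlong E indeps_sum //.
rewrite -[LHS]/((T_fun _ _ _ \o T_fun _ _ _) w) T_funM ?form0r ?off_form //.
by rewrite form0l !add0r subrK addr0.
Qed.

Lemma T_fun_opp n v a : off n v ->
  T_fun (e_ R n) v a (e_ R (negi n)) =
  e_ R (negi n) + (a * eps n) *: e_ R n + eps n *: v.
Proof.
move=> /offP[_ v2]; rewrite /T_fun form_basis negiK eqxx mulr1.
by rewrite formC v2 oppr0 add0r.
Qed.

(** The image of e_{-n} under T(e_n, v, a) determines v and a, and these
    determine the normal form. *)
Lemma unip_act_inj n g g' : in_unip n g -> in_unip n g' -> act g =1 act g' -> g = g'.
Proof.
move=> [a [v [ov ->]]] [a' [v' [ov' ->]]] E.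
have /= [c Ec] := act_shortprod v (all_indeps n).
have /= [c' Ec'] := act_shortprod v' (all_indeps n).
have T2 u x y w : off n u -> T_fun (e_ R n) 0 x (T_fun (e_ R n) u y w) =
    T_fun (e_ R n) u (x + y) w.
  move=> ou; rewrite -[LHS]/((T_fun _ _ _ \o T_fun _ _ _) w) T_funM ?form0r ?off_form //.
  by rewrite form0l add0r addr0.
have := E (e_ R (negi n));
  rewrite !actM !act_xlong Ec Ec' !indeps_sum // !T2 // !T_fun_opp //.
set x := a + c; set x' := a' + c' => /ffunP H.
have e1 := eps_sqr R n.
have vv : v = v'.
  apply/ffunP => k; have [kn|kn] := eqVneq k n; first by rewrite kn ov.1 ov'.1.
  have [->|kn'] := eqVneq k (negi n); first by rewrite ov.2 ov'.2.
  have := H k; rewrite !VE (negbTE kn) (negbTE kn') !mulr0 !add0r =>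
    /(congr1 (fun z => eps n * z)).
  by rewrite !mulrA e1 !mul1r.
have xx : x = x'.
  have := H n; rewrite !VE eqxx (negbTE (negiN n)) ov.1 ov'.1 !mulr0 !addr0 !add0r !mulr1.
  by move=> /(congr1 (fun z => z * eps n)); rewrite -!mulrA e1 !mulr1.
have cc : c = c'.
  have := Ec (e_ R (negi n));
    rewrite {1}vv Ec' !indeps_sum // vv !T_fun_opp // => /ffunP/(_ n).
  rewrite !VE eqxx (negbTE (negiN n)) ov'.1 !mulr0 !addr0 !add0r !mulr1.
  by move=> /(congr1 (fun z => z * eps n)); rewrite -!mulrA e1 !mulr1.
by rewrite vv; congr (xlong n _ * _)%g; apply: (addIr c); rewrite -/x xx /x' cc.
Qed.

(** The element of the unipotent radical of e_n over T(e_n, v, a), for v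
    orthogonal to the plane of e_n. *)
Definition Xlift n v a : St :=
  if pselect (exists g, in_unip n g /\ act g =1 T_fun (e_ R n) v a) is left h
  then sval (cid h) else 1%g.

Lemma XliftP n v a : off n v ->
  in_unip n (Xlift n v a) /\ act (Xlift n v a) =1 T_fun (e_ R n) v a.
Proof.
move=> ov; rewrite /Xlift; case: pselect => [h|]; first by case: cid.
by case; apply: unip_lift_ex.
Qed.

Lemma Xlift_unip n v a : off n v -> in_unip n (Xlift n v a).
Proof. by case/(XliftP a). Qed.
Lemma act_Xlift n v a : off n v -> act (Xlift n v a) =1 T_fun (e_ R n) v a.
Proof. by case/(XliftP a). Qed.

Lemma Xlift_uniq n v a g : off n v -> in_unip n g -> act g =1 T_fun (e_ R n) v a ->
  g = Xlift n v a.
Proof.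
by move=> ov ug E; apply: (unip_act_inj ug (Xlift_unip a ov)) => w; rewrite E act_Xlift.
Qed.

Lemma XliftM n v w a b : off n v -> off n w ->
  (Xlift n v a * Xlift n w b)%g = Xlift n (v + w) (a + b + form v w).
Proof.
move=> ov ow; apply: Xlift_uniq; first exact: offD.
  by apply: in_unipM; apply: Xlift_unip.
by move=> x; rewrite actM !act_Xlift // -T_funM ?off_form.
Qed.

Lemma Xlift_long n a : Xlift n 0 a = xlong n a.
Proof.
apply/esym/Xlift_uniq; [exact: off0| |exact: act_xlong].
by rewrite -[xlong n a]mulg1; apply/in_unip_xlongM/in_unip1.
Qed.

Lemma Xlift_short n j c : indep n j -> Xlift n (c *: e_ R j) 0 = xshort n j c.
Proof.
move=> nj; apply/esym/Xlift_uniq; [exact/offZ/off_e| |exact: act_xshort].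
by rewrite -[xshort n j c]mulg1; apply/in_unip_xshortM/in_unip1.
Qed.

Lemma Xlift0 n : Xlift n 0 0 = 1%g. Proof. by rewrite Xlift_long xlong_0. Qed.

(** Generated by the root elements that fix e_n and e_{-n}; inverses need not
    be added because the inverse of a root element is one. *)
Inductive Levi n : St -> Prop :=
| Levi1 : Levi n 1%g
| LeviM h k b g : h != k -> indep n h -> indep n k -> Levi n g ->
  Levi n (xroot h k b * g)%g.

Lemma Levi_xroot n h k b : h != k -> indep n h -> indep n k -> Levi n (xroot h k b).
Proof.
by move=> hk nh nk; rewrite -[xroot h k b]mulg1; apply: LeviM => //; apply: Levi1.
Qed.

Lemma Levi_M n g g' : Levi n g -> Levi n g' -> Levi n (g * g')%g.
Proof.
elim=> [|h k b {}g hk nh nk _ IH] Lg'; first by rewrite mul1g.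
by rewrite -mulgA; apply: LeviM => //; apply: IH.
Qed.

Lemma act_xroot_fix n h k b j : h != k -> indep n h -> indep n k -> ~~ indep n j ->
  act (xroot h k b) (e_ R j) = e_ R j.
Proof.
move=> hk nh nk nj; have fh : form (e_ R h) (e_ R j) = 0.
  rewrite form_basis; case: eqVneq => [E|]; last by rewrite mulr0.
  by move: nj; rewrite -indepNr -E nh.
have fk : form (e_ R (negi k)) (e_ R j) = 0.
  rewrite form_basis eq_negi; case: eqVneq => [E|]; last by rewrite mulr0.
  by move: nj; rewrite -E nk.
rewrite act_xroot // /T_fun fh mulr0 scale0r addr0 /Tij_vec.
by case: ifP; rewrite ?form0l ?formZl ?fk ?mulr0 addr0 scale0r addr0.
Qed.

Lemma Levi_fix n g j : Levi n g -> ~~ indep n j -> act g (e_ R j) = e_ R j.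
Proof.
move=> Lg nj; elim: Lg => [|h k b {}g hk nh nk _ IH]; first by rewrite act1.
by rewrite actM IH (act_xroot_fix b hk nh nk nj).
Qed.

Lemma indepnn n : ~~ indep n n. Proof. by rewrite /indep eqxx. Qed.
Lemma indepnN n : ~~ indep n (negi n). Proof. by rewrite indepNr indepnn. Qed.

Lemma Levi_off n g v : Levi n g -> off n v -> off n (act g v).
Proof.
move=> Lg /offP[v1 v2]; apply/offP.
by rewrite -{1}(Levi_fix Lg (indepnn n)) -{1}(Levi_fix Lg (indepnN n)) !act_form.
Qed.

End Roots.

Section Radicals.
Variables (R : comPzRingType) (l : nat).
Local Notation idx := (idx l).
Local Notation St := (StSp R l).
Local Notation eps := (@eps R l).
Implicit Types (i j h k m n : idx) (a b c d : R) (g : St).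

Lemma in_unip_xshort n j c : indep n j -> in_unip n (xshort n j c : St).
Proof. by move=> nj; rewrite -[xshort _ _ _]mulg1; apply/in_unip_xshortM/in_unip1. Qed.

Lemma in_unip_xlong n a : in_unip n (xlong n a : St).
Proof. by rewrite -[xlong n a]mulg1; apply/in_unip_xlongM/in_unip1. Qed.

Lemma xroot_xshort n h d : indep n h -> xroot h (negi n) d = xshort n h (d * eps n).
Proof. by move=> nh; rewrite xshort_sym // /xshort -mulrA eps_sqr mulr1. Qed.

Lemma xroot_R4N k j a b : indep k j ->
  commut (xroot (negi k) k a) (xroot k j b) =
  (xroot (negi k) j (- (a * b * eps k)) * xroot (negi j) j (- (a * b ^+ 2)))%g.
Proof.
move=> kj; have := @xroot_R4 R l (negi k) j a b; rewrite negiK epsN mulrN; apply.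
  by rewrite (indepE kj).
by rewrite (indepE kj).
Qed.

(** By R0 it is enough to treat the pairs that share an end, where R3, or R4
    if the conjugating element is long, keeps the result in the radical; all
    other pairs commute. *)
Lemma in_unip_conj_xshort n h k b j c : h != k -> indep n h -> indep n k -> indep n j ->
  in_unip n (xroot h k b * xshort n j c * (xroot h k b)^-1 : St)%g.
Proof.
have key h' k' b' : h' != k' -> indep n h' -> indep n k' ->
    in_unip n (xroot h' k' b' * xshort n k' c * (xroot h' k' b')^-1 : St)%g.
  move=> hk nh nk; rewrite conj_commut; apply: in_unipM; last exact: in_unip_xshort.
  rewrite xshort_sym // /xshort; have [hNk|hNk] := eqVneq h' (negi k').
    rewrite hNk xroot_R4N ?indepNr 1?indep_sym // negiK; apply: in_unipM;
      last exact: in_unip_xlong.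
    by rewrite xroot_xshort ?indepNr //; apply: in_unip_xshort; rewrite indepNr.
  rewrite xroot_R3 ?negiK ?(indepE nk) ?(indepE nh) //;
    first by rewrite xroot_xshort //; apply: in_unip_xshort.
  by rewrite !inE ?negiK (negbTE hNk) (indepE nh).
move=> hk nh nk nj; have [->|jk] := eqVneq j k; first exact: key.
have [->|jh] := eqVneq j (negi h).
  by rewrite xroot_R0 //; apply: key; rewrite ?indepNr // eq_negi eq_sym.
have -> : (xroot h k b * xshort n j c = xshort n j c * xroot h k b :> St)%g.
  apply: xroot_R2; rewrite ?(indepE nj) // !inE ?negb_or ?(indepE nh) ?(indepE nk) //.
  by rewrite eq_negi eq_negiC jh jk.
by rewrite mulgK; apply: in_unip_xshort.
Qed.

Lemma in_unip_conj n h k b u : h != k -> indep n h -> indep n k -> in_unip n u ->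
  in_unip n (xroot h k b * u * (xroot h k b)^-1 : St)%g.
Proof.
move=> hk nh nk [a [v [ov ->]]].
have -> : (xroot h k b * (xlong n a * shortprod n (indeps n) v) * (xroot h k b)^-1 =
   (xroot h k b * xlong n a * (xroot h k b)^-1)
     * (xroot h k b * shortprod n (indeps n) v * (xroot h k b)^-1) :> St)%g.
  by rewrite !gnorm.
apply: in_unipM.
  have -> : (xroot h k b * xlong n a = xlong n a * xroot h k b :> St)%g;
    last by rewrite mulgK; apply: in_unip_xlong.
  apply: xroot_R2; rewrite ?negiN // !inE ?negb_or ?(indepE nh) ?(indepE nk) //=.
  by rewrite eq_negi (indepE nk).
have := all_indeps n; elim: (indeps n) => [|j s IH] /=.
  by move=> _; rewrite /shortprod big_nil mulg1 mulgV; apply: in_unip1.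
move=> /andP[nj /IH IHs]; rewrite /shortprod big_cons -/(shortprod n s v).
have -> : (xroot h k b * (xshort n j (v j : R) * shortprod n s v) * (xroot h k b)^-1 =
   (xroot h k b * xshort n j (v j : R) * (xroot h k b)^-1)
     * (xroot h k b * shortprod n s v * (xroot h k b)^-1) :> St)%g.
  by rewrite !gnorm.
by apply: in_unipM => //; apply: in_unip_conj_xshort.
Qed.

(** By uniqueness it suffices to know that the conjugate stays in the radical
    and what it does to V. *)
Lemma Levi_conj n g v a : Levi n g -> off n v ->
  (g * Xlift n v a * g^-1 = Xlift n (act g v) a)%g.
Proof.
move=> Lg; elim: Lg v => [|h k b {}g hk nh nk Lg IH] v ov.
  by rewrite act1 invg1 mul1g mulg1.
have -> : (xroot h k b * g * Xlift n v a * (xroot h k b * g)^-1 =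
  xroot h k b * (g * Xlift n v a * g^-1) * (xroot h k b)^-1)%g by rewrite !gnorm.
rewrite IH // actM; have ogv := Levi_off Lg ov.
have Lx : Levi n (xroot h k b : St) by apply: Levi_xroot.
apply: Xlift_uniq; first exact: Levi_off.
  by apply: in_unip_conj => //; apply: Xlift_unip.
move=> w; rewrite !actM act_Xlift // act_T_fun actVK (Levi_fix Lx) //; exact: indepnn.
Qed.

Lemma Levi_shortprod m n s v : indep n m -> off m v -> all (indep n) s ->
  Levi m (shortprod n s v : St).
Proof.
move=> nm ov; elim: s => [|j s IH] /=; first by rewrite /shortprod big_nil => _;
  apply: Levi1.
move=> /andP[nj /IH Ls]; rewrite /shortprod big_cons; apply: Levi_M => //.
case mj: (indep m j).
  by apply: Levi_xroot; rewrite ?indepNr ?(indepE nj) // indep_sym.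
by case/negbT/indepPn: mj => ->; rewrite ?ov.1 ?ov.2 xshort_0; apply: Levi1.
Qed.

Lemma Levi_Xlift m n v a : indep n m -> off n v -> off m v -> Levi m (Xlift n v a : St).
Proof.
move=> nm ov om.
have [c E] : exists c, Xlift n v a = (xlong n c * shortprod n (indeps n) v)%g.
  have [c E] := act_shortprod v (all_indeps n); exists (a - c);
    apply/esym/Xlift_uniq => //.
    by exists (a - c), v.
  move=> w; rewrite actM act_xlong E indeps_sum //.
  rewrite -[LHS]/((T_fun _ _ _ \o T_fun _ _ _) w) T_funM ?form0r ?off_form //.
  by rewrite form0l !add0r subrK addr0.
rewrite E; apply: Levi_M; last by apply: Levi_shortprod; rewrite ?all_indeps.
by apply: Levi_xroot; rewrite ?negiN // ?indepNr indep_sym.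
Qed.

Lemma Levi_comm n g v a : Levi n g -> off n v ->
  (g * Xlift n v a = Xlift n (act g v) a * g)%g.
Proof. by move=> Lg ov; rewrite -(Levi_conj a Lg ov) mulgVK. Qed.

Lemma Xlift_sym n h c : indep n h -> Xlift n (c *: e_ R h) 0 = Xlift h (c *: e_ R n) 0.
Proof.
by move=> nh; rewrite !Xlift_short ?[indep h n]indep_sym //; apply: xshort_sym.
Qed.

Lemma LeviN n g : Levi n g -> Levi (negi n) g.
Proof.
elim=> [|h k b {}g hk nh nk _ IH]; first exact: Levi1.
by apply: LeviM; rewrite ?indepNl.
Qed.

End Radicals.

(** * Lifts of the transvections T(u, 0, a) *)

(** The lifts of T(u, 0, a) are built from elements X n v a over T(e_n, v, a), for
    v orthogonal to the plane of e_n, and compared by means of subgroups Levi n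
    that fix this plane. The hypotheses are the relations between these two. *)
Section Transvections.
Variables (R : comPzRingType) (l : nat).
Local Notation idx := (idx l).
Local Notation eps := (@eps R l).
Local Notation V := (V R l).
Local Notation e i := (@e_ R l i).
Variables (St : groupType) (act : St -> V -> V) (X : idx -> V -> R -> St).
Variable (Levi : idx -> St -> Prop).
Implicit Types (i j h k m n : idx) (a b c d : R) (g : St) (u v w p q : V).

Hypothesis actZ : forall g a v, act g (a *: v) = a *: act g v.
Hypothesis Levi_off : forall n g v, Levi n g -> off n v -> off n (act g v).
Hypothesis LeviN : forall n g, Levi n g -> Levi (negi n) g.
Hypothesis LeviX : forall n g v a, Levi n g -> off n v ->
  (g * X n v a = X n (act g v) a * g)%g.
Hypothesis XLevi : forall m n v a, indep n m -> off n v -> off m v -> Levi m (X n v a).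
Hypothesis XM : forall n v w a b, off n v -> off n w ->
  (X n v a * X n w b)%g = X n (v + w) (a + b + form v w).
Hypothesis X00 : forall n, X n 0 0 = 1%g.
Hypothesis X_sym : forall n h c, indep n h -> X n (c *: e h) 0 = X h (c *: e n) 0.
Hypothesis actX : forall n v a, off n v -> act (X n v a) =1 T_fun (e n) v a.

Lemma V_opp v i : (- v) i = - (v i : R) :> R.
Proof. by rewrite -scaleN1r V_scale mulN1r. Qed.

Lemma V_ext u v : (forall k, u k = v k :> R) -> u = v.
Proof. by move=> uv; apply/ffunP. Qed.

Lemma offNv n v : off n v -> off n (- v : V).
Proof. by rewrite -scaleN1r; apply: offZ. Qed.

Lemma offNi n v : off n v -> off (negi n) (v : V).
Proof. by move/offN. Qed.

Ltac indt := solve [ done | by rewrite ?indepNl ?indepNr // indep_sym ?indepNl ?indepNr ].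
Ltac offt := repeat first [ assumption | apply: off0 | apply: offNv | apply: offNi
  | apply: offZ | apply: offD | (apply: off_e; indt) ].
Ltac vring := apply: V_ext => ?; rewrite !(V_opp, VE); ring.

Lemma form_off n v : off n v -> form v (e n) = 0.
Proof. by move=> ov; rewrite formC off_form ?oppr0. Qed.
Lemma form_offN n v : off n v -> form v (e (negi n)) = 0.
Proof. by move=> ov; apply: form_off; apply: offNi. Qed.
Lemma off_formN n v : off n v -> form (e (negi n)) v = 0.
Proof. by move=> ov; apply: off_form; apply: offNi. Qed.

Lemma formNl u v : form (- u) v = - form u v.
Proof. by rewrite -scaleN1r formZl mulN1r. Qed.
Lemma formNr u v : form u (- v) = - form u v.
Proof. by rewrite -scaleN1r formZr mulN1r. Qed.

Lemma form_eN n : form (e n) (e (negi n)) = eps n.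
Proof. by rewrite form_basis negiK eqxx mulr1. Qed.
Lemma form_Ne n : form (e (negi n)) (e n) = - eps n.
Proof. by rewrite form_basis eqxx mulr1 epsN. Qed.

Definition formE :=
  (@formDl R l, @formDr R l, formNl, formNr, @formZl R l, @formZr R l, @formvv R l,
   @form0l R l, @form0r R l, form_eN, form_Ne).

Lemma form0C v w : form v w = 0 -> form w v = 0.
Proof. by move=> vw; rewrite formC vw oppr0. Qed.

Lemma X_comm n v w a b : off n v -> off n w -> form v w = 0 ->
  commute (X n v a) (X n w b).
Proof.
move=> ov ow vw; rewrite /commute !XM // vw (form0C vw) !addr0.
by rewrite addrC [a + b]addrC.
Qed.

Lemma LeviXcj n g v a : Levi n g -> off n v -> (g * X n v a * g^-1 = X n (act g v) a)%g.
Proof. by move=> Lg ov; apply/conj_eqP/LeviX. Qed.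

Lemma LeviX_comm n g v a : Levi n g -> off n v -> act g v = v -> commute g (X n v a).
Proof. by move=> Lg ov gv; rewrite /commute (LeviX a Lg ov) gv. Qed.

Lemma XV n v a : off n v -> ((X n v a)^-1)%g = X n (- v) (- a).
Proof.
move=> ov; apply: (@mulgI _ (X n v a)); rewrite mulgV XM; [|offt..].
by rewrite !formE oppr0 addr0 !subrr X00.
Qed.

Lemma actX_perp n v a w : off n v -> form (e n) w = 0 -> form v w = 0 ->
  act (X n v a) w = w.
Proof.
by move=> ov uw vw; rewrite actX // /T_fun uw vw mulr0 addr0 !scale0r !addr0.
Qed.

Lemma actX_opp n v a : off n v ->
  act (X n v a) (e (negi n)) = e (negi n) + (a * eps n) *: e n + eps n *: v.
Proof. by move=> ov; rewrite actX // T_fun_opp. Qed.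

Lemma actXN_opp n v a : off n v ->
  act (X (negi n) v a) (e n) = e n - (a * eps n) *: e (negi n) - eps n *: v.
Proof.
move=> ov; have := @actX_opp (negi n) v a; rewrite negiK epsN => ->; last by offt.
by rewrite mulrN !scaleNr.
Qed.

(** Over T(v, 0, a): conjugation by X (negi n) v 0 turns T(e_n, 0, a) into
    T(e_n - eps_n v, 0, a), and the first factor removes from it everything
    that involves e_n. *)
Definition longX n v a : St :=
  (X n ((a * eps n) *: v) (- a) * X (negi n) v 0 * X n 0 a * (X (negi n) v 0)^-1)%g.

Lemma Levi_longX n g v a : Levi n g -> off n v ->
  (g * longX n v a * g^-1 = longX n (act g v) a)%g.
Proof.
move=> Lg ov; have LNg := LeviN Lg; have oNv := offNi ov.
rewrite /longX conj_word !LeviXcj //; [|offt..]; rewrite actZ.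
by have := actZ g 0 0; rewrite !scale0r => ->.
Qed.

Lemma Levi_longX_comm n g v a : Levi n g -> off n v -> act g v = v ->
  commute g (longX n v a).
Proof. by move=> Lg ov gv; apply/commute_conjP; rewrite Levi_longX ?gv. Qed.

Lemma commute_longX n v a g : (forall c b, commute g (X n (c *: v) b)) ->
  (forall c b, commute g (X (negi n) (c *: v) b)) -> commute g (longX n v a).
Proof.
move=> h1 h2; rewrite /longX; have h0 : commute g (X n 0 a) by rewrite -(scale0r v).
have hN : commute g (X (negi n) v 0) by rewrite -[v]scale1r.
by do !apply: commuteM => //; apply: commuteV.
Qed.

(** Only the conjugating factor of [longX] fails to commute with X n (c e_m)
    0. The error is an element of the radical of e_m, which commutes with that
    factor and with X n 0 a. *)
Lemma longX_comm1 n m v a c : indep n m -> off n v -> off m v ->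
  commute (X n (c *: e m) 0) (longX n v a).
Proof.
move=> nm on om; have mn : indep m n by indt.
have LP : Levi m (X (negi n) v 0) by apply: XLevi; [indt | offt..].
apply: (@comm_word1 _ _ _ _ _ (X m ((c * eps n) *: v) 0)).
- by apply: X_comm; [offt..|]; rewrite !formE off_form //; ring.
- by apply: X_comm; [offt..|]; rewrite !formE; ring.
- apply/conj_eqP; rewrite -mulgA X_sym // (LeviX _ LP); last by offt.
  rewrite mulgA; congr (_ * _)%g; rewrite actZ actXN_opp // XM; [|offt..].
  by congr X; [vring | rewrite !formE form_off // form_offN //; ring].
- apply/commute_sym/(LeviX_comm 0 LP); first by offt.
  by rewrite actZ actX_perp ?formvv ?off_formN //; offt.
- apply/commute_sym/LeviX_comm; [apply: XLevi; [indt|offt..]|offt|].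
  by rewrite actZ actX_perp ?form0l // ?off_form //; offt.
Qed.

Lemma conj_Xlong n m a c : indep n m ->
  (X (negi n) (c *: e m) 0 * X n 0 a * (X (negi n) (c *: e m) 0)^-1 =
   X m (- (c * a * eps n) *: e n) (c ^+ 2 * a) * X n 0 a)%g.
Proof.
move=> nm; have mn : indep m n by indt.
have LA : Levi m (X n 0 a) by apply: XLevi => //; offt.
apply/conj_eqP; rewrite -mulgA X_sym; last by indt.
rewrite (LeviX _ LA); last by offt.
rewrite mulgA; congr (_ * _)%g; rewrite actZ actX_opp; last by offt.
rewrite XM; [|offt..].
congr X; first by vring.
by rewrite !formE; ring: (eps_sqr R n).
Qed.

Lemma conj_Xheis n m v a c : indep n m -> off n v -> off m v ->
  let B := X n ((a * eps n) *: v) (- a) in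
  (X (negi n) (c *: e m) 0 * B * (X (negi n) (c *: e m) 0)^-1 =
   X m ((c * a * eps n) *: e n - (c * a) *: v) (- (c ^+ 2 * a)) * B)%g.
Proof.
move=> nm on om B; have mn : indep m n by indt.
have LB : Levi m B by apply: XLevi => //; offt.
apply/conj_eqP; rewrite -mulgA X_sym; last by indt.
rewrite (LeviX _ LB); last by offt.
rewrite mulgA; congr (_ * _)%g; rewrite actZ actX_opp; last by offt.
rewrite XM; [|offt..]; have e1 := eps_sqr R n.
congr X; first by (apply: V_ext => ?; rewrite !(V_opp, VE); ring: e1).
by rewrite !formE !(form_off on, form_offN on, off_form on, off_formN on); ring: e1.
Qed.

Lemma longX_comm2 n m v a c : indep n m -> off n v -> off m v ->
  commute (X (negi n) (c *: e m) 0) (longX n v a).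
Proof.
move=> nm on om; have mn : indep m n by indt.
have LP : Levi m (X (negi n) v 0) by apply: XLevi; [indt | offt..].
have LB : Levi m (X n ((a * eps n) *: v) (- a)) by apply: XLevi => //; offt.
have e1 := eps_sqr R n.
apply: comm_word2 (conj_Xheis a c nm on om) _ (conj_Xlong a c nm) (LeviXcj _ LP _) _ _.
- by apply: X_comm; [offt..|]; rewrite !formE off_form //; ring.
- by offt.
- apply: LeviX_comm => //; first by apply: Levi_off => //; offt.
  rewrite actZ actXN_opp // mul0r scale0r subr0 actX_perp //; first by offt.
    by rewrite !formE off_form //; ring.
  by rewrite !formE form_off //; ring.
- rewrite actZ actXN_opp // XM; [|offt..].
  rewrite -[RHS](X00 m); congr X.
    by (apply: V_ext => ?; rewrite !(V_opp, VE); ring: e1).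
  by rewrite !formE !(form_off on, form_offN on, off_form on, off_formN on); ring: e1.
Qed.

(** With x = X (negi n) (-eps_m e_m) 0, the long element X m 0 a is the
    commutator of x and A = X n 0 a up to an element X m (s e_n) b. As x
    commutes with the word for n, inserting this into the word for m gives
    longX m v a = A (longX n v a) A^-1, and A commutes with longX m v a. *)
Lemma longX_indep n m v a : indep n m -> off n v -> off m v -> longX n v a = longX m v a.
Proof.
move=> nm on om; have mn : indep m n by indt.
have e1 := eps_sqr R n; have f1 := eps_sqr R m.
(* c is kept abstract so that it is not simplified away in the words below *)
have [c cE] : exists c, c = - eps m by exists (- eps m).
pose x := X (negi n) (c *: e m) 0; pose A := X n 0 a.
have LA : Levi m A by apply: XLevi => //; offt.
have AY : commute A (longX m v a).
  by apply: Levi_longX_comm => //; apply: actX_perp; rewrite ?form0l ?off_form //; offt.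
suff H : longX m v a = (A * longX n v a * A^-1)%g.
  by apply: (@mulgI _ A); rewrite AY H mulgVK.
have LPm : Levi n (X (negi m) v 0) by apply: XLevi; [indt|offt..].
have cc : c ^+ 2 = 1 by rewrite cE; ring: f1.
apply: (@flip_word _ _ (X n ((c * a * eps n) *: e m) 0) _ _ _ _ _ x _ _ _ _ _ (erefl _)
  (longX_comm2 _ _ nm on om) (conj_Xheis a c nm on om)).
- rewrite (conj_Xlong a c nm) mulgK X_sym // XM; [|offt..].
  by rewrite !formE; congr X; [vring | ring: cc].
- apply: LeviX_comm; [by []|by offt|].
  by rewrite actX_perp ?form0r //; offt.
- rewrite LeviXcj; [|exact: LeviN|offt..].
  rewrite actZ actXN_opp // XM; [|offt..]; rewrite !formE off_form //.
  by congr X; [rewrite cE; apply: V_ext => ?; rewrite !(V_opp, VE); ring: f1|ring].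
- rewrite LeviXcj //; last by offt.
  rewrite actZ actXN_opp // mul0r scale0r subr0.
  set E := X m _ (- (c ^+ 2 * a)); pose s := c * a * eps n.
  have sE : s = - (a * eps n * eps m) by rewrite /s cE; ring.
  have EA : commute A E.
    apply: LeviX_comm; [by []|by offt|].
    by apply: actX_perp; [offt|rewrite !formE off_form //; ring|rewrite form0l].
  rewrite -/A; transitivity (E * A * E^-1)%g; last by rewrite -EA mulgK.
  congr (_ * _)%g; rewrite -mulgA.
  have -> : (X n (s *: (e m - eps m *: v)) 0 * (X n ((a * eps n) *: v) (- a))^-1 =
             X m (s *: e n) 0 * A)%g.
    rewrite -X_sym // XV; [|offt..]; rewrite opprK !XM; [|offt..].
    rewrite !formE off_form //; congr X; last by ring.
    by rewrite sE; apply: V_ext => ?; rewrite !(V_opp, VE); ring: f1.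
  rewrite mulgA XM; [|offt..]; congr (X _ _ _ * _)%g.
    by rewrite /s cE; vring.
  by rewrite !formE form_off // cc; ring.
Qed.

Lemma X_plane n m c d b : indep n m ->
  X n (c *: e m + d *: e (negi m)) b =
  (X n (c *: e m) 0 * X n (d *: e (negi m)) 0 * X n 0 (b - c * d * eps m))%g.
Proof.
move=> nm; rewrite XM; [|offt..]; rewrite XM; [|offt..].
by rewrite !formE addr0; congr X; ring.
Qed.

Lemma X_split n v w b c : off n v -> off n w ->
  X n (v + w) b = (X n v c * X n w (b - c - form v w))%g.
Proof. by move=> ov ow; rewrite XM //; congr X; ring. Qed.

Definition plane m u : V := (u m : R) *: e m + (u (negi m) : R) *: e (negi m).
(** The component orthogonal to the hyperbolic plane of e_m. *)
Definition perp m u : V := u - plane m u.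

Lemma perp_off m u : off m (perp m u).
Proof.
have mN := negiN m; rewrite /off /perp /plane !(V_opp, VE) !eqxx !negi_neq (negbTE mN) /=.
by split; ring.
Qed.

Lemma perpD m u : perp m u + plane m u = u. Proof. exact: subrK. Qed.

Lemma plane_off n m u : indep n m -> off n (plane m u).
Proof. by move=> nm; rewrite /plane; offt. Qed.

Lemma perp_offW n m u : indep n m -> off n u -> off n (perp m u).
Proof. by move=> nm on; apply/offD => //; apply/offNv/plane_off. Qed.

Lemma form_planel m u v : off m v -> form (plane m u) v = 0.
Proof. by move=> om; rewrite /plane !formE off_form // off_formN // !mulr0 addr0. Qed.

Lemma form_planer m u v : off m v -> form v (plane m u) = 0.
Proof. by move=> om; rewrite form0C // form_planel. Qed.

Lemma longX_neg n m v a : indep n m -> off n v -> off m v ->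
  longX (negi n) v a = longX n v a.
Proof.
move=> nm on om; rewrite (longX_indep _ nm on om); apply: longX_indep => //;
  first by indt.
exact: offNi.
Qed.

(** Split w along the plane of m. The part orthogonal to it is handled by
    rewriting the word in the plane of m, the rest by [longX_comm1]. *)
Lemma longX_comm n m v w a b : indep n m -> off n v -> off m v -> off n w ->
  form w v = 0 ->
  commute (X n w b) (longX n v a).
Proof.
move=> nm on om ow wv; have mn : indep m n by indt.
rewrite -(perpD m w) (X_split b 0); [|exact: perp_offW|exact: plane_off].
apply: commuteMl.
  rewrite (longX_indep _ nm on om); apply: Levi_longX_comm => //.
    by apply: XLevi => //; [exact: perp_offW|exact: perp_off].
  apply: actX_perp; rewrite ?off_form //; first exact: perp_offW.
  by rewrite /perp formDl formNl wv form_planel // subr0.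
rewrite X_plane //; do !apply: commuteMl; try by apply: longX_comm1 => //; offt.
  by apply: longX_comm1 => //; offt; indt.
rewrite (longX_indep _ nm on om); apply: Levi_longX_comm => //.
  by apply: XLevi => //; offt.
by rewrite actX_perp ?form0l ?off_form //; offt.
Qed.

Lemma longX_commN n m v w a b : indep n m -> off n v -> off m v -> off n w ->
  form w v = 0 ->
  commute (X (negi n) w b) (longX n v a).
Proof.
move=> nm on om ow wv; rewrite -(longX_neg a nm on om).
by apply: (@longX_comm _ m) => //; [indt | offt..].
Qed.

(** T(v + w, 0, a) = T(v, 0, a) T(v, w a, 0) T(w, 0, a); the middle factor is
    lifted by a commutator. *)
Lemma longX_add n m k v w a : indep n m -> indep n k -> off n v -> off m v ->
  off n w -> off k w -> form v w = 0 ->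
  longX n (v + w) a = (longX n v a * commut (X n ((a * eps n) *: w) 0) (X (negi n) v 0)
    * longX n w a)%g.
Proof.
move=> nm nk nv mv nw kw vw; have wv := form0C vw.
rewrite {1}/longX; have e1 := eps_sqr R n.
have -> : X n ((a * eps n) *: (v + w)) (- a) =
    (X n ((a * eps n) *: w) 0 * X n ((a * eps n) *: v) (- a))%g.
  by rewrite XM; [|offt..]; rewrite !formE wv; congr X; [vring|ring].
have -> : X (negi n) (v + w) 0 = (X (negi n) v 0 * X (negi n) w 0)%g.
  by rewrite XM; [|offt..]; rewrite vw !addr0.
apply: (@add_word _ _ _ _ _ _ (X n ((a * eps n) *: w) (- a))) => //.
- rewrite XV; last by offt.
  rewrite XM; [|offt..]; rewrite !formE; congr X; [vring|ring].
- by apply: (@longX_commN _ k).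
- by apply: (@longX_comm _ m) => //; [offt|rewrite formZl wv mulr0].
Qed.

(** Compare [longX_add] for v + w and for w + v. *)
Lemma commut_swap n m k v w s : indep n m -> indep n k -> off n v -> off m v ->
  off n w -> off k w -> form v w = 0 ->
  commut (X n (s *: w) 0) (X (negi n) v 0) = commut (X n (s *: v) 0) (X (negi n) w 0).
Proof.
move=> nm nk nv mv nw kw vw; have wv := form0C vw.
have := longX_add (s * eps n) nk nm nw kw nv mv wv.
rewrite addrC (longX_add (s * eps n) nm nk nv mv nw kw vw) -!mulrA eps_sqr mulr1.
set K := commut _ _; set K' := commut _ _; set a := s * _ => E.
have vK : commute (longX n v a) K.
  by apply: commute_commut; apply/commute_sym;
    [apply: (@longX_comm _ m)|apply: (@longX_commN _ m)];
    rewrite ?formZl ?wv ?mulr0 ?formvv //; offt.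
have wK : commute (longX n w a) K'.
  by apply: commute_commut; apply/commute_sym;
    [apply: (@longX_comm _ k)|apply: (@longX_commN _ k)];
    rewrite ?formZl ?vw ?mulr0 ?formvv //; offt.
have vwY : commute (longX n v a) (longX n w a).
  by apply: commute_longX => c b; apply/commute_sym;
    [apply: (@longX_comm _ m)|apply: (@longX_commN _ m)];
    rewrite ?formZl ?wv ?mulr0 ?formvv //; offt.
by move: E; rewrite vK wK -[LHS]mulgA -[RHS]mulgA vwY => /mulIg.
Qed.

(** Over T(v, p a, 0) with p = al e_n + be e_{-n}, for v orthogonal to the
    plane of e_n. *)
Definition mixedX n v (al be a : R) : St :=
  (longX n v (al * be * a ^+ 2 * eps n) * X (negi n) ((be * a) *: v) 0
    * X n ((al * a) *: v) 0)%g.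

Lemma commute_mixedX n v al be a g : (forall c b, commute g (X n (c *: v) b)) ->
  (forall c b, commute g (X (negi n) (c *: v) b)) -> commute g (mixedX n v al be a).
Proof.
by move=> h1 h2; rewrite /mixedX; apply: commuteM; first apply: commuteM; rewrite //;
  apply: commute_longX.
Qed.

Lemma commut_short n m v s c : indep n m -> off n v -> off m v ->
  commut (X n ((s * c) *: e m) 0) (X (negi n) v 0) = X m ((s * eps n * c) *: v) 0.
Proof.
move=> nm nv mv; have mn : indep m n by indt.
have Lz : Levi m (X (negi n) v 0) by apply: XLevi; [indt|offt..].
rewrite X_sym //; have -> (x z : St) : (commut x z = x * (z * x * z^-1)^-1)%g.
  by rewrite /commut !gnorm.
rewrite LeviXcj //; last by offt.
rewrite actZ actXN_opp // XV; [|offt..].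
rewrite XM; [|offt..]; rewrite !formE off_form //.
by congr X; [vring|ring].
Qed.

Lemma commut_long n v c : off n v ->
  commut (X n 0 c) (X (negi n) v 0) = (X n ((c * eps n) *: v) 0 * longX n v (- c))%g.
Proof.
move=> nv; rewrite /longX opprK !mulgA XM; [|offt..].
rewrite !formE /commut; have -> : X n ((c * eps n) *: v + (- c * eps n) *: v)
    (0 + c + c * eps n * (- c * eps n * 0)) = X n 0 c by congr X; [vring|ring].
have -> : X n 0 (- c) = ((X n 0 c)^-1)%g by rewrite XV ?oppr0 //; offt.
by [].
Qed.

(** Two lifts of T(v, p a, 0) with p in the plane of e_m agree: the commutator
    formed in the plane of e_n, and the word formed in the plane of e_m. *)
Lemma commut_plane n m v c d a : indep n m -> off n v -> off m v ->
  commut (X n ((a * eps n) *: (c *: e m + d *: e (negi m))) 0) (X (negi n) v 0) =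
    mixedX m v c d a.
Proof.
move=> nm nv mv; have mn : indep m n by indt.
have e1 := eps_sqr R n; have f1 := eps_sqr R m.
rewrite scalerDr !scalerA X_plane // add0r.
set x1 := X n _ 0; set x2 := X n _ 0; set b := - (_ * _ * _).
have bE : b = - (a ^+ 2 * c * d * eps m) by rewrite /b; ring: e1.
have Yc w b' : off n w -> form w v = 0 -> commute (X n w b') (longX n v (- b)).
  by move=> nw wv; apply: (@longX_comm _ m).
have vv c' : form (c' *: v) v = 0 by rewrite formZl formvv mulr0.
have x1v b' : commute x1 (X n (b' *: v) 0).
  by apply: X_comm; [offt..|]; rewrite !formE off_form //; ring.
have x2v b' : commute x2 (X n (b' *: v) 0).
  by apply: X_comm; [offt..|]; rewrite !formE off_formN //; ring.
have x1Y : commute x1 (longX n v (- b)) by apply: Yc;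
  [offt|rewrite !formE off_form //; ring].
have x2Y : commute x2 (longX n v (- b)) by apply: Yc;
  [offt|rewrite !formE off_formN //; ring].
have E1 : commut x1 (X (negi n) v 0) = X m ((c * a) *: v) 0.
  by rewrite /x1 commut_short //; congr X; congr (_ *: _); ring: e1.
have E2 : commut x2 (X (negi n) v 0) = X (negi m) ((d * a) *: v) 0.
  by rewrite /x2 commut_short //; [congr X; congr (_ *: _); ring: e1|indt|offt].
have E3 : (x1 * X (negi m) ((d * a) *: v) 0 * x1^-1 =
   X n (- (b * eps n) *: v) 0 * X (negi m) ((d * a) *: v) 0)%g.
  have Lz : Levi n (X (negi m) ((d * a) *: v) 0) by apply: XLevi; [indt|offt..].
  set z := X _ _ _; have -> : (x1 * z * x1^-1 = x1 * (z * x1 * z^-1)^-1 * z)%g.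
    by rewrite !gnorm.
  congr (_ * _)%g; rewrite LeviXcj //; last by offt.
  rewrite actZ actXN_opp; [|offt..]; rewrite XV; [|offt..].
  rewrite XM; [|offt..]; rewrite bE !formE off_form //; congr X; last by ring.
  by vring.
rewrite -mulgA commutMl commutMl commut_long // E1 E2 /mixedX -(longX_indep _ nm nv mv).
have -> : c * d * a ^+ 2 * eps m = - b by rewrite bE; ring.
have -> : (x2 * (X n ((b * eps n) *: v) 0 * longX n v (- b)) * x2^-1 =
   X n ((b * eps n) *: v) 0 * longX n v (- b))%g.
  by apply/commute_conjP; apply: commuteM.
set N := X (negi m) _ 0 in E3 *; set Z := X n ((b * eps n) *: v) 0.
have -> : (x1 * (Z * longX n v (- b) * N) * x1^-1 =
   (x1 * (Z * longX n v (- b)) * x1^-1) * (x1 * N * x1^-1))%g by rewrite !gnorm.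
have -> : (x1 * (Z * longX n v (- b)) * x1^-1 = Z * longX n v (- b))%g.
  by apply/commute_conjP; apply: commuteM; [apply: x1v|].
rewrite E3; congr (_ * _)%g; rewrite -mulgA; set Z' := X n _ 0.
have -> : (longX n v (- b) * (Z' * N) = Z' * longX n v (- b) * N)%g.
  by rewrite mulgA /Z' (Yc _ 0) //; offt.
rewrite !mulgA XM; [|offt..].
have -> : X n ((b * eps n) *: v + - (b * eps n) *: v)
   (0 + 0 + form ((b * eps n) *: v) (- (b * eps n) *: v)) = 1%g; last by rewrite mul1g.
by rewrite -(X00 n) !formE; congr X; [vring|ring].
Qed.

Lemma mixedX_add n m k v p al be a : indep n m -> indep n k -> off n v -> off m v ->
  off n p -> off k p -> form v p = 0 ->
  (forall s, commute (X (negi n) (s *: v) 0)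
    (commut (X n ((al * be * a ^+ 2) *: p) 0) (X (negi n) v 0))) ->
  mixedX n (v + p) al be a = (mixedX n v al be a * mixedX n p al be a)%g.
Proof.
move=> nm nk nv mv np kp vp Kv; have pv := form0C vp.
have e1 := eps_sqr R n.
rewrite /mixedX (longX_add _ nm nk) //; set c := al * be * a ^+ 2 * eps n.
have -> : c * eps n = al * be * a ^+ 2 by rewrite /c; ring: e1.
set K := commut _ _ in Kv *.
have KY : commute (longX n p c) K.
  by apply: commute_commut; apply/commute_sym;
    [apply: (@longX_comm _ k)|apply: (@longX_commN _ k)];
    rewrite ?formZl ?formvv ?vp ?mulr0 //; offt.
rewrite !scalerDr.
have -> : X (negi n) ((be * a) *: v + (be * a) *: p) 0 =
    (X (negi n) ((be * a) *: v) 0 * X (negi n) ((be * a) *: p) 0)%g.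
  by rewrite XM; [|offt..]; rewrite !formE vp; congr X; ring.
have -> : X n ((al * a) *: v + (al * a) *: p) 0 =
    (X n ((al * a) *: v) 0 * X n ((al * a) *: p) 0)%g.
  by rewrite XM; [|offt..]; rewrite !formE vp; congr X; ring.
set Nv := X (negi n) _ 0; set Np := X (negi n) _ 0; set Xv := X n _ 0; set Xp := X n _ 0.
have KE : K = commut Xv Np.
  have := @commut_swap n m k v ((be * a) *: p) (al * a) nm nk nv mv (offZ _ np)
    (offZ _ kp).
  by rewrite formZr vp mulr0 scalerA => <- //; rewrite /K;
    congr (commut (X n (_ *: _) _) _); ring.
have NpXv : (Np * Xv = K^-1 * Xv * Np)%g by rewrite KE /commut !gnorm.
have YN' : commute (longX n p c) Nv.
  by apply/commute_sym; apply: (@longX_commN _ k) => //; [offt|rewrite formZl vp mulr0].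
have YX : commute (longX n p c) Xv.
  by apply/commute_sym; apply: (@longX_comm _ k) => //; [offt|rewrite formZl vp mulr0].
have KN : commute K Nv by apply/commute_sym/Kv.
clear Kv KE; clearbody K Nv Np Xv Xp.
have KYN : (K * (longX n p c * Nv) * K^-1 = longX n p c * Nv)%g.
  by apply/commute_conjP; apply: commuteM => //; apply: commute_sym.
move: (longX n v c) (longX n p c) KYN YN' YX {KY} => Yv Yp KYN YN' YX.
transitivity (Yv * (K * (Yp * Nv) * K^-1) * Xv * Np * Xp)%g.
  by rewrite !mulgA -(mulgA _ Np Xv) NpXv !mulgA.
by rewrite KYN YN' !mulgA -(mulgA _ Yp Xv) YX !mulgA.
Qed.

(** The lift of T(u, 0, a), from u = u' + p with p in the plane of e_n and u'
    orthogonal to it: T(u, 0, a) = T(u', 0, a) T(u', p a, 0) T(p, 0, a). The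
    last factor is formed in the plane of e_m. *)
Definition transvX n m u a : St :=
  (longX n (perp n u) a * mixedX n (perp n u) (u n) (u (negi n)) a
    * longX m (plane n u) a)%g.

Hypothesis third : forall i j, exists k, indep i k /\ indep j k.

(** Splitting u' once more, along the plane of e_m, makes the roles of the two
    planes comparable. *)
Lemma transvX_expand n m k u a : indep n m -> indep n k -> indep m k ->
  let v := perp n (perp m u) in
  transvX n m u a = (longX n v a * mixedX m v (u m) (u (negi m)) a * longX n (plane m u) a
    * (mixedX n v (u n) (u (negi n)) a * mixedX n (plane m u) (u n) (u (negi n)) a)
      * longX m (plane n u) a)%g.
Proof.
move=> nm nk mk v; have mn : indep m n by indt.
have nv : off n v by apply: perp_off.
have mv : off m v by apply: perp_offW => //; apply: perp_off.
have np := plane_off u nm; have kp : off k (plane m u) by apply: plane_off; indt.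
have vp := form_planer u mv.
have perpE : perp n u = v + plane m u.
  have planeE : plane n (perp m u) = plane n u.
    rewrite /perp /plane !(V_opp, VE) !eq_negi !(indepE nm) /=.
    by vring.
  have -> : v = u - plane m u - plane n u by rewrite -planeE.
  by rewrite addrAC subrK.
rewrite /transvX perpE (longX_add _ nm nk) // {1}/plane commut_plane //
  (mixedX_add nm nk) //.
move=> s; set b := _ * _ * _.
have -> : b = (b * eps n) * eps n by ring: (eps_sqr R n).
rewrite /plane commut_plane //.
have Lg : Levi m (X (negi n) (s *: v) 0) by apply: XLevi; [indt|offt..].
have gv c : act (X (negi n) (s *: v) 0) (c *: v) = c *: v.
  by rewrite actZ actX_perp ?off_formN ?formZl ?formvv ?mulr0 //; offt.
by apply: commute_mixedX => c b'; apply: LeviX_comm => //; try exact: LeviN; offt.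
Qed.

(** For p in the plane of e_m and q in that of e_n, both sides are commutators
    formed in a third plane, equal by [commut_swap]. *)
Lemma mixedX_swap n m k u a : indep n m -> indep n k -> indep m k ->
  mixedX n (plane m u) (u n) (u (negi n)) a = mixedX m (plane n u) (u m) (u (negi m)) a.
Proof.
move=> nm nk mk; have [kn km mn] : [/\ indep k n, indep k m & indep m n] by split; indt.
have kpm := plane_off u km; have kpn := plane_off u kn.
have npm := plane_off u nm; have mpn := plane_off u mn.
have f0 := form_planer u npm.
by rewrite -(commut_plane _ _ _ kn kpm npm) -(commut_plane _ _ _ km kpn mpn);
  apply: commut_swap kn km _ _ _ _ _.
Qed.

(** After expansion both sides have the same factors, in a different order. *)
Lemma transvX_swap n m u a : indep n m -> transvX n m u a = transvX m n u a.
Proof.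
move=> nm; have [k [nk mk]] := third n m; have mn : indep m n by indt.
rewrite (transvX_expand _ _ nm nk mk) (transvX_expand _ _ mn mk nk).
have -> : perp m (perp n u) = perp n (perp m u).
  by rewrite /perp /plane !(V_opp, VE) !eq_negi !(indepE nm) /=; vring.
set v := perp n (perp m u).
have nv : off n v by apply: perp_off.
have mv : off m v by apply: perp_offW => //; apply: perp_off.
rewrite (mixedX_swap _ _ nm nk mk) (longX_indep _ nm nv mv).
have [kn km] : indep k n /\ indep k m by split; indt.
have npm := plane_off u nm; have mpn := plane_off u mn.
have kpm := plane_off u km; have kpn := plane_off u kn.
have vp := form_planer u mv; have vq := form_planer u nv; have qp := form_planer u npm.
have comm_pv n' m' w : indep n' m' -> indep n' k -> indep m' k -> off n' w -> off m' w ->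
    off n' (plane m' u) -> off k (plane m' u) -> form w (plane m' u) = 0 ->
    commute (longX n' (plane m' u) a) (mixedX n' w (u n') (u (negi n')) a).
  move=> nm' nk' mk' nw mw np' kp' wp'; apply: commute_mixedX => c b; apply/commute_sym;
    [apply: (@longX_comm _ k)|apply: (@longX_commN _ k)];
    by rewrite ?formZl ?wp' ?mulr0 //; offt.
apply: swap_blocks.
- exact: comm_pv.
- have vX n' m' c b c' b' : indep n' m' -> off n' v -> off m' v ->
    commute (X n' (c *: v) b) (X m' (c' *: v) b').
    move=> nm' nv' mv'; apply: LeviX_comm; [apply: XLevi; [indt|offt..]|offt|].
    by rewrite actZ actX_perp ?off_form ?formZl ?formvv ?mulr0 //; offt.
  apply: commute_mixedX => c b; apply/commute_sym; apply: commute_mixedX => c' b';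
    apply: vX; try indt; offt.
- rewrite -(mixedX_swap _ _ nm nk mk); apply: commute_mixedX => c b; apply/commute_sym;
    [apply: (@longX_comm _ k)|apply: (@longX_commN _ k)];
    by rewrite ?formZl ?formvv ?mulr0 //; offt.
- apply: commute_mixedX => c b; apply/commute_sym;
    [apply: (@longX_comm _ k)|apply: (@longX_commN _ k)];
    by rewrite ?formZl ?formvv ?mulr0 //; offt.
- exact: comm_pv.
- rewrite (longX_indep _ mk mpn kpn) (longX_indep _ nk npm kpm).
  apply: commute_longX => c b; apply/commute_sym;
    [apply: (@longX_comm _ n)|apply: (@longX_commN _ n)];
    by rewrite ?formZl ?qp ?(form0C qp) ?mulr0 //; offt.
Qed.

(** The auxiliary plane only enters through a [longX], which does not depend
    on it. *)
Lemma transvX_aux n m j u a : indep n m -> indep n j -> transvX n m u a = transvX n j u a.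
Proof.
move=> nm nj; rewrite /transvX; congr (_ * _)%g.
have [mn jn] : indep m n /\ indep j n by split; indt.
have mp := plane_off u mn; have jp := plane_off u jn.
case mj: (indep m j); first exact: longX_indep.
case/negbT/indepPn: mj => jE; rewrite jE in nj jp *; first by [].
by have [k [nk mk]] := third n m; rewrite (longX_neg _ mk) //; apply: plane_off; indt.
Qed.

(** Planes of independent indices can be exchanged by [transvX_swap]; a third
    one joins n to -n. *)
Lemma transvX_indep n m n' m' u a : indep n m -> indep n' m' ->
  transvX n m u a = transvX n' m' u a.
Proof.
have key i j i' j' : indep i j -> indep i' j' -> indep i i' ->
  transvX i j u a = transvX i' j' u a.
  move=> ij ij' ii; rewrite (transvX_aux _ _ ij ii) transvX_swap //;
    apply: transvX_aux => //; indt.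
move=> nm nm'; case nn: (indep n n'); first exact: key.
have [k [nk _]] := third n n.
have nk' : indep n' k by case/negbT/indepPn: nn => ->; rewrite ?indepNl.
by rewrite (key n m k n nm _ nk) ?(key k n n' m') //; indt.
Qed.

Lemma transvX_e n m a : indep n m -> transvX n m (e n) a = X n 0 a.
Proof.
move=> nm; have mn : indep m n by indt.
have [f1 e1] := (eps_sqr R m, eps_sqr R n).
have nN := negiN n.
have planeE : plane n (e n) = e n.
  by rewrite /plane !VE eqxx negi_neq scale1r scale0r addr0.
have perpE : perp n (e n) = 0 by rewrite /perp planeE subrr.
have Y0 j b : longX j 0 b = 1%g.
  by rewrite /longX scaler0 X00 invg1 !mulg1 XM ?form0l ?addr0 ?addNr ?X00 //; offt.
rewrite /transvX perpE planeE /mixedX !Y0 !scaler0 !X00 !mul1g.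
have LA : Levi n (X m 0 a) by apply: XLevi; [indt|offt..].
rewrite /longX; have XmN : X (negi m) (e n) 0 = X n (e (negi m)) 0.
  by rewrite -[e n]scale1r X_sym ?scale1r //; indt.
have -> : (X m ((a * eps m) *: e n) (- a) = X n ((a * eps m) *: e m) 0 * (X m 0 a)^-1)%g.
  rewrite -X_sym // XV; [|offt..]; rewrite XM; [|offt..].
  by rewrite oppr0 !formE; congr X; [vring|ring].
rewrite XmN; set P := X n (e (negi m)) 0; set A := X m 0 a.
set w := X n _ 0.
have -> : (w * A^-1 * P * A * P^-1 = w * A^-1 * (P * (A * P^-1 * A^-1)) * A)%g.
  by rewrite !gnorm.
have -> : (P * (A * P^-1 * A^-1) = X n (- (a * eps m) *: e m) a)%g.
  rewrite /P XV ?oppr0; [|offt..].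
  rewrite LeviXcj //; last by offt.
  rewrite -scaleN1r actZ actX_opp; last by offt.
  by rewrite XM; [|offt..]; rewrite !formE; congr X; [vring|ring: f1].
have AX : commute A (X n (- (a * eps m) *: e m) a).
  by apply: LeviX_comm => //; [offt|rewrite actX_perp ?formE ?form0l ?mulr0 //; offt].
rewrite -!mulgA -AX mulKg /w XM; [|offt..].
by rewrite !formE; congr X; [vring|ring].
Qed.

(** All factors but the last are equivariant under Levi n already, and g fixes
    the vector on which the last one is built. *)
Lemma Levi_transvX n m g u a : indep n m -> Levi n g ->
  act g (u : V) = act g (perp n u) + plane n u ->
  commute g (longX m (plane n u) a) ->
    (g * transvX n m u a * g^-1 = transvX n m (act g u) a)%g.
Proof.
move=> nm Lg ug /commute_conjP gY; have mn : indep m n by indt.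
set w := act g (perp n u); have ow : off n w by apply: Levi_off => //; apply: perp_off.
have u1 : act g u n = u n :> R.
  have nN := negiN n.
  by rewrite ug /plane !VE ow.1 !eqxx (negbTE nN) /=; ring.
have u2 : act g u (negi n) = u (negi n) :> R.
  by rewrite ug /plane !VE ow.2 !eqxx negi_neq /=; ring.
have planeE : plane n (act g u) = plane n u by rewrite /plane u1 u2.
have perpE : perp n (act g u) = w by rewrite /perp planeE ug addrK.
have oc := perp_off n u.
rewrite /transvX perpE planeE u1 u2.
have conj3 (x y z : St) :
  (g * (x * y * z) * g^-1 = g * x * g^-1 * (g * y * g^-1) * (g * z * g^-1))%g.
  by rewrite !gnorm.
rewrite conj3 Levi_longX // gY /mixedX conj3 Levi_longX // !LeviXcj ?actZ //;
  try exact: LeviN; offt.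
Qed.

Lemma longX_plane_short n m h k a b u : indep n m -> indep n h -> indep n k ->
  indep h k ->
  commute (X h (b *: e k) 0) (longX m (plane n u) a).
Proof.
move=> nm nh nk hk.
have pE : longX m (plane n u) a = longX h (plane n u) a.
  have [mn hn] : indep m n /\ indep h n by split; indt.
  have mp := plane_off u mn; have hp := plane_off u hn.
  case mh: (indep m h); first exact: longX_indep.
  case/negbT/indepPn: mh => hE; rewrite hE in hp *; first by [].
  by have [j [nj mj]] := third n m; rewrite (longX_neg _ mj) //; apply: plane_off; indt.
by rewrite pE; apply: longX_comm1 => //; apply: plane_off; indt.
Qed.

Lemma longX_plane_long n m h a b u : indep n m -> indep n h ->
  commute (X h 0 b) (longX m (plane n u) a).
Proof.
move=> nm nh; have [j [nj hj]] := third n h.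
have [mn hn jn] : [/\ indep m n, indep h n & indep j n] by split; indt.
have mp := plane_off u mn; have hp := plane_off u hn; have jp := plane_off u jn.
have -> : longX m (plane n u) a = longX j (plane n u) a.
  case mh: (indep m j); first exact: longX_indep.
  case/negbT/indepPn: mh => hE; rewrite hE in jp *; first by [].
  by have [i [ni mi]] := third n m; rewrite (longX_neg _ mi) //; apply: plane_off; indt.
apply: Levi_longX_comm => //; first by apply: XLevi => //; [offt..].
by rewrite actX_perp ?form0l ?off_form //; offt.
Qed.

End Transvections.

(** * The kernel of the projection is central *)

Section Centrality.
Variables (R : comPzRingType) (l : nat).
Hypothesis l3 : (3 <= l)%N.
Local Notation idx := (idx l).
Local Notation St := (StSp R l).
Local Notation eps := (@eps R l).
Local Notation e i := (@e_ R l i).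
Implicit Types (i j h k m n : idx) (a b c d : R) (g : St) (u v : V R l).

(** The form in which the assumption l >= 3 is used. *)
Lemma third i j : exists k, indep i k /\ indep j k.
Proof.
have : ~~ (predT \subset [set i.2; j.2]).
  apply/negP => /subset_leq_card; rewrite cardT size_enum_ord cards2.
  by case: eqP => _ /(leq_trans l3).
case/subsetPn => t _; rewrite !inE negb_or => /andP[ti tj].
by exists (true, t); rewrite !indep_snd /= eq_sym ti eq_sym tj.
Qed.

Local Notation TX := (transvX (@Xlift R l)).

Lemma xroot_xshort_opp i j a : xroot i j a = xshort i (negi j) (a * eps (negi j)) :> St.
Proof. by rewrite /xshort negiK -mulrA eps_sqr mulr1. Qed.

Let iZ := @actZ R l.
Let iO := @Levi_off R l.
Let iN := @LeviN R l.
Let iL := @Levi_comm R l.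
Let iXL := @Levi_Xlift R l.
Let iM := @XliftM R l.
Let i0 := @Xlift0 R l.
Let iS := @Xlift_sym R l.
Let iA := @act_Xlift R l.

(** The root element X_ij(c) fixes the plane of any third index k, in which
    [transvX] may be computed. *)
Lemma transvX_conj_root n m i j c u a : indep n m -> i != j ->
  (xroot i j c * TX n m u a * (xroot i j c)^-1 = TX n m (act (xroot i j c) u) a)%g.
Proof.
move=> nm ij; have [k [ik jk]] := third i j.
have [ki kj] : indep k i /\ indep k j by rewrite !(indep_sym k).
have TXi := transvX_indep iZ iO iN iL iXL iM i0 iS iA third _ _ nm ki.
rewrite !TXi; have Lx : Levi k (xroot i j c : St) by apply: Levi_xroot.
apply: (Levi_transvX iZ iO iN iL ki Lx).
  rewrite -{1}(perpD k u) actD; congr (_ + _); rewrite /plane actD !actZ.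
  by rewrite !(Levi_fix Lx) ?indepnn ?indepnN.
case i_j: (indep i j).
  rewrite xroot_xshort_opp -Xlift_short ?indepNr //.
  by apply: (longX_plane_short iZ iO iN iL iXL iM i0 iS iA third); rewrite ?indepNr.
have -> : j = negi i by case/negbT/indepPn: i_j => E //; rewrite E eqxx in ij.
rewrite -[xroot _ _ _]/(xlong i c) -Xlift_long.
exact: (longX_plane_long iZ iO iN iL iXL iM i0 iS iA third).
Qed.

Lemma transvX_conj g n m u a : indep n m ->
  (g * TX n m u a * g^-1 = TX n m (act g u) a)%g.
Proof.
move=> nm; elim/StSp_ind: g u => [|i j c g ij IH] u.
  by rewrite act1 mul1g invg1 mulg1.
by rewrite actM -transvX_conj_root // -IH conj_mul.
Qed.

Lemma phi_conj (k g : St) : phi k = 1%g -> phi (g^-1 * k * g)%g = 1%g.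
Proof.
have pM (x y : St) : phi (x * y)%g = (phi x * phi y)%g by apply: gmulfM.
by move=> k1; rewrite !pM k1 mulg1 -pM mulVg multiplicative1.
Qed.

(** An element k of the kernel fixes e_i, so that conjugation by k sends
    X(e_i, a) to itself. *)
Lemma ker_commute_long (k : St) i a : phi k = 1%g -> commute k (xlong i a).
Proof.
move=> k1; have [j [ij _]] := third i i.
have E := transvX_e iZ iL iXL iM i0 iS iA a ij; have H := transvX_conj k (e i) a ij.
by rewrite (act_ker k1) E Xlift_long in H; apply/commute_conjP.
Qed.

(** By R4 a short root element is a product of long ones and their conjugates. *)
Lemma ker_central (k g : St) : phi k = 1%g -> commute k g.
Proof.
move=> k1; elim/StSp_ind: g => [|i j a g ij IH]; first by rewrite /commute mulg1 mul1g.
apply: commuteM IH; have [jNi|jNi] := eqVneq j (negi i).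
  by rewrite jNi; apply: ker_commute_long.
have := @xroot_R4 R l i j (a * eps i) 1 _ ij.
have -> : a * eps i * 1 * eps i = a by ring: (eps_sqr R i).
set y := xroot (negi i) j 1; set z := xroot (negi j) j _ => E.
have cy : commute k (commut (xlong i (a * eps i)) y).
  rewrite (_ : commut _ _ =
    xlong i (a * eps i) * (y * (xlong i (a * eps i))^-1 * y^-1))%g;
    last by rewrite /commut !mulgA.
  apply: commuteM; first exact: ker_commute_long.
  have /(ker_commute_long i (a * eps i)) /commuteV : phi (y^-1 * k * y)%g = 1%g.
    exact: phi_conj.
  move: (xlong i _) => x /commute_conjP xk; apply/commute_conjP.
  by rewrite -{2}xk !gnorm.
have zE : xroot i j a = (commut (xlong i (a * eps i)) y * z^-1)%g by rewrite E
  1?eq_sym // mulgK.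
rewrite zE; apply: commuteM => //; apply: commuteV.
by rewrite /z -{2}[j]negiK; apply: ker_commute_long.
Qed.

End Centrality.

(** * Lifting root elements to a central extension *)

(** Holds for l >= 4, see [fourth]. *)
Definition fourth_index l := forall i j k : idx l,
  exists m, [/\ indep i m, indep j m & indep k m].

(** A proper ideal J as below would make R/J a nonzero ring in which all
    elements are idempotent. *)
Definition no_boolean_quotient (R : comPzRingType) := forall J : R -> Prop,
  (forall a b, J a -> J b -> J (a + b)) -> (forall a b, J b -> J (a * b)) ->
  (forall b, J (b ^+ 2 - b)) -> J 1.

(** A family xroot in S with the relations of the symplectic Steinberg group is
    lifted along a surjection pr with central kernel; L is any choice of lifts. *)
Section Splitting.
Variables (R : comPzRingType) (l : nat) (S E : groupType).
Local Notation idx := (idx l).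
Local Notation eps := (@eps R l).
Variable (xroot : idx -> idx -> R -> S).
Variable pr : {multiplicative E -> S}.
Variable L : S -> E.
Implicit Types (i j h k m n : idx) (a b c d : R) (x y z : S) (p q : E).

Hypothesis LK : cancel L pr.
Hypothesis pr_central : forall p q, pr p = 1%g -> commute p q.
Hypothesis third : forall i j, exists k, indep i k /\ indep j k.
Hypothesis xrootD : forall i j a b, (xroot i j a * xroot i j b)%g = xroot i j (a + b).
Hypothesis xroot_R0 : forall i j a, i != j ->
  xroot i j a = xroot (negi j) (negi i) (- a * eps i * eps j).
Hypothesis xroot_R2 : forall i j h k a b, i != j -> h != k ->
  h \notin [:: j; negi i] -> k \notin [:: i; negi j] ->
  commute (xroot i j a) (xroot h k b).
Hypothesis xroot_R3 : forall i j k a b, indep i j -> indep j k -> indep i k ->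
  commut (xroot i j a) (xroot j k b) = xroot i k (a * b).
Hypothesis xroot_R4 : forall i j a b, indep i j ->
  commut (xroot i (negi i) a) (xroot (negi i) j b) =
  (xroot i j (a * b * eps i) * xroot (negi j) j (- (a * b ^+ 2)))%g.
Hypothesis xroot_R5 : forall i j a b, indep i j ->
  commut (xroot i j a) (xroot j (negi i) b) = xroot i (negi i) (2%:R * a * b * eps i).

(** The commutator of lifts of x and y. The choice of the lifts does not
    matter ([commutE]), since two lifts of an element differ by a central
    element. *)
Definition lcommut x y : E := commut (L x) (L y).
(** Some, equivalently all, lifts of x and y commute. *)
Definition lcommute x y := lcommut x y = 1%g.

Lemma pr_commut p q : pr (commut p q) = commut (pr p) (pr q).
Proof. by rewrite /commut !gmulfM !multiplicativeV. Qed.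

Lemma pr_eq p q : pr p = pr q -> exists2 c, (forall r, commute c r) & p = (c * q)%g.
Proof.
move=> pq; exists (p * q^-1)%g; last by rewrite mulgVK.
by move=> r; apply: pr_central; rewrite gmulfM multiplicativeV pq mulgV.
Qed.

Lemma commut_central (c d : E) p q : (forall r, commute c r) -> (forall r, commute d r) ->
  commut (c * p)%g (d * q)%g = commut p q.
Proof.
move=> cC dC; rewrite /commut !invgM.
have -> : (c * p * (d * q) * (p^-1 * c^-1) * (q^-1 * d^-1) =
  (c * (p * d * q * p^-1) * c^-1) * q^-1 * d^-1)%g by rewrite !gnorm.
have /commute_conjP -> := cC (p * d * q * p^-1)%g.
rewrite -(dC p).
have -> : (d * p * q * p^-1 * q^-1 * d^-1 = d * (p * q * p^-1 * q^-1) * d^-1)%g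
  by rewrite !gnorm.
by have /commute_conjP -> := dC (p * q * p^-1 * q^-1)%g.
Qed.

Lemma commutE p q : commut p q = lcommut (pr p) (pr q).
Proof.
have [c cC pE] := pr_eq (esym (LK (pr p))).
have [d dC qE] := pr_eq (esym (LK (pr q))).
by rewrite {1}pE {1}qE commut_central.
Qed.

Lemma pr_lcommut x y : pr (lcommut x y) = commut x y.
Proof. by rewrite pr_commut !LK. Qed.

Lemma lcommuteP p q : lcommute (pr p) (pr q) -> commute p q.
Proof. by rewrite /lcommute -commutE => /commut1P. Qed.

Lemma commute_lcommute p q : commute p q -> lcommute (pr p) (pr q).
Proof. by move=> pq; rewrite /lcommute -commutE; apply/commut1P. Qed.

Lemma lcommute_sym x y : lcommute x y -> lcommute y x.
Proof.
rewrite -{1}[x]LK -{1}[y]LK => /lcommuteP/commute_sym/commute_lcommute.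
by rewrite !LK.
Qed.

Lemma lcommuteL x y : lcommute x y -> commute (L x) (L y).
Proof. by move=> xy; apply: lcommuteP; rewrite !LK. Qed.

Lemma lcommuteM x y z : lcommute x y -> lcommute x z -> lcommute x (y * z)%g.
Proof.
move=> /lcommuteL xy /lcommuteL xz.
have := commute_lcommute (commuteM xy xz); by rewrite gmulfM !LK.
Qed.

Lemma lcommuteV x y : lcommute x y -> lcommute x (y^-1)%g.
Proof. by move=> /lcommuteL /commuteV /commute_lcommute; rewrite multiplicativeV !LK. Qed.

Lemma lcommuteMr x y z : lcommute x z -> lcommute x (y * z)%g -> lcommute x y.
Proof. by move=> xz /lcommuteM /(_ (lcommuteV xz)); rewrite mulgK. Qed.

Lemma lcommuteMl x y z : lcommute x y -> lcommute x (y * z)%g -> lcommute x z.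
Proof. by move=> xy /(lcommuteM (lcommuteV xy)); rewrite mulKg. Qed.

Lemma lcommutMr x y z : lcommute x z -> lcommut x (y * z)%g = lcommut x y.
Proof.
move=> xz; rewrite -{1}[x]LK -{1}[y]LK -{1}[z]LK -gmulfM -commutE commutMr.
by move: xz; rewrite /lcommute /lcommut => ->; rewrite mulg1 mulgV mulg1.
Qed.

Lemma lcommut_inv x y : ((lcommut x y)^-1 = lcommut y x)%g.
Proof. exact: commut_inv. Qed.

Lemma lcommutMl x y z : lcommute y z -> lcommut (x * y)%g z = lcommut x z.
Proof.
by move=> yz; apply: invg_inj; rewrite !lcommut_inv lcommutMr //; apply: lcommute_sym.
Qed.

(** Lifts of x and y commute up to a central element, and so do lifts of x and
    z; central elements do not change a commutator. *)
Lemma lcommute_commut x y z : commute x y -> commute x z -> lcommute x (commut y z).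
Proof.
move=> xy xz; rewrite /lcommute -{1}[x]LK -{1}[y]LK -{1}[z]LK -pr_commut -commutE.
apply/commut1P/commute_conjP.
have conjx u : commute x u ->
  (L x * L u * (L x)^-1 = lcommut x u * L u)%g /\ (forall r, commute (lcommut x u) r).
  move=> xu; split; first by rewrite conj_commut.
  by move=> r; apply: pr_central; rewrite pr_lcommut; apply/commut1P.
have [[Ey Cy] [Ez Cz]] := (conjx y xy, conjx z xz).
transitivity (commut (lcommut x y * L y) (lcommut x z * L z))%g;
  last exact: commut_central.
by rewrite -Ey -Ez /commut !gnorm.
Qed.

Ltac indt := solve [ done | by rewrite ?indepNl ?indepNr // indep_sym ?indepNl ?indepNr ].

Lemma commute_long_long i c j b : indep i j ->
  commute (xroot i (negi i) c) (xroot j (negi j) b).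
Proof.
move=> ij; apply: xroot_R2;
  rewrite ?negiN // !inE ?negb_or ?eq_negi ?negiK ?(indepE ij) //.
Qed.

Lemma commute_long_short i c h k b : indep i h -> indep i k -> h != k ->
  commute (xroot i (negi i) c) (xroot h k b).
Proof.
move=> ih ik hk; apply: xroot_R2;
  rewrite ?negiN // !inE ?negb_or ?eq_negi ?negiK ?(indepE ih) ?(indepE ik) //.
Qed.

Lemma commute_long_start i c j b : indep i j ->
  commute (xroot i (negi i) c) (xroot i j b).
Proof.
move=> ij; apply: xroot_R2;
  rewrite ?negiN ?(indepE ij) // !inE ?negb_or ?negiK ?negiN ?(indepE ij) //.
Qed.

Lemma commute_start i j k a b : indep i j -> indep i k -> k != negi j ->
  commute (xroot i j a) (xroot i k b).
Proof.
move=> ij ik jk; apply: xroot_R2;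
  rewrite ?(indepE ij) ?(indepE ik) // !inE ?negb_or ?negiN ?(indepE ij) ?(indepE ik) //.
Qed.

Lemma commute_end i j k a b : indep i k -> indep j k -> j != negi i ->
  commute (xroot i k a) (xroot j k b).
Proof.
move=> ik jk ij; apply: xroot_R2;
  rewrite ?(indepE ik) ?(indepE jk) //
  !inE ?negb_or ?negiN ?(indepE ik) ?(indepE jk) ?ij //.
Qed.

Lemma lcommute_long_start i j c b : indep i j ->
  lcommute (xroot i (negi i) c) (xroot i j b).
Proof.
move=> ij; have [k [ik jk]] := third i j.
rewrite -[b]mulr1 -(@xroot_R3 i k j); [|indt..].
by apply: lcommute_commut;
  [apply: commute_long_start|apply: commute_long_short; rewrite ?(indepE jk)].
Qed.

Lemma lcommute_long_end i j c b : indep i j ->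
  lcommute (xroot i (negi i) c) (xroot j (negi i) b).
Proof.
move=> ij; rewrite (xroot_R0 b) ?negiK; last by rewrite (indepE ij).
by apply: lcommute_long_start; indt.
Qed.

Lemma lcommute_same i j a b : indep i j -> lcommute (xroot i j a) (xroot i j b).
Proof.
move=> ij; have [k [ik jk]] := third i j.
rewrite -[b]mulr1 -(@xroot_R3 i k j); [|indt..].
apply: lcommute_commut; first by apply: commute_start => //; rewrite (indepE jk).
by apply: commute_end => //; [indt|rewrite (indepE ik)].
Qed.

Lemma lcommute_long_same i a b : lcommute (xroot i (negi i) a) (xroot i (negi i) b).
Proof.
have [j [ij _]] := third i i.
have := @xroot_R4 j (negi i) (- b) 1;
  rewrite indepNr indep_sym negiK expr1n mulr1 opprK => /(_ ij) H.
apply: (@lcommuteMl _ (xroot j (negi i) (- b * eps j))); first exact: lcommute_long_end.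
by rewrite -H; apply: lcommute_commut;
  [apply: commute_long_long|rewrite (xroot_R0 1);
  [rewrite negiK; apply: commute_long_start; indt|]; rewrite eq_negi (indepE ij)].
Qed.

Let xroot_R4N k j a b : indep k j ->
  commut (xroot (negi k) k a) (xroot k j b) =
  (xroot (negi k) j (a * b * eps (negi k)) * xroot (negi j) j (- (a * b ^+ 2)))%g.
Proof. by move=> kj; rewrite -xroot_R4 ?indepNl // negiK. Qed.

Lemma eps1 i a : a * eps i * eps i = a.
Proof. by rewrite -mulrA eps_sqr mulr1. Qed.

Lemma xroot_R4_1 i j a : indep i j ->
  commut (xroot i (negi i) (a * eps i)) (xroot (negi i) j 1) =
  (xroot i j a * xroot (negi j) j (- (a * eps i)))%g.
Proof. by move=> ij; rewrite xroot_R4 // mulr1 eps1 expr1n mulr1. Qed.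

Lemma xroot_R4N_1 k j a : indep k j ->
  commut (xroot (negi k) k (a * eps (negi k))) (xroot k j 1) =
  (xroot (negi k) j a * xroot (negi j) j (- (a * eps (negi k))))%g.
Proof. by move=> kj; rewrite xroot_R4N // mulr1 eps1 expr1n mulr1. Qed.

Lemma xroot_flip i j : i != j ->
  exists2 f : R -> R, forall a, xroot i j a = xroot (negi j) (negi i) (f a) &
  forall a, xroot (negi j) (negi i) a = xroot i j (f a).
Proof.
move=> ij; exists (fun a => - a * eps i * eps j) => a; first exact: xroot_R0.
rewrite xroot_R0 ?eq_negi 1?eq_sym // !negiK; congr xroot; rewrite !epsN; ring.
Qed.

(** By R4, X_ik(b) is the product of a commutator of elements that commute
    with X_ij(a) and of a long root element covered by [lcommute_long_start]. *)
Lemma lcommute_start i j k a b : indep i j -> indep i k -> indep j k ->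
  lcommute (xroot i j a) (xroot i k b).
Proof.
move=> ij ik jk; have ik' : i != k by rewrite (indepE ik).
have [f -> _] := xroot_flip ik'.
have ki : indep k (negi i) by indt.
apply: (@lcommuteMr _ _ (xroot (negi (negi i)) (negi i) (- (f b * eps (negi k))))).
  by rewrite negiK; apply/lcommute_sym/lcommute_long_start.
rewrite -xroot_R4N_1 //; apply: lcommute_commut.
  by apply/commute_sym; rewrite -{2}[k]negiK; apply: commute_long_short;
    [indt|indt|rewrite (indepE ij)].
have kNi : k != negi i by rewrite (indepE ik).
have [g -> _] := xroot_flip kNi.
by rewrite negiK; apply: commute_start => //; [indt|rewrite eq_negi eq_sym (indepE jk)].
Qed.

Lemma lcommute_end i j k a b : indep i j -> indep k j -> indep i k ->
  lcommute (xroot i j a) (xroot k j b).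
Proof.
move=> ij kj ik; have ij' : i != j by rewrite (indepE ij).
have kj' : k != j by rewrite (indepE kj).
have [f -> _] := xroot_flip ij'; have [g -> _] := xroot_flip kj'.
by apply: lcommute_start; indt.
Qed.

Hypothesis Hc : fourth_index l \/ no_boolean_quotient R.

Let xroot_0 i j : xroot i j 0 = 1%g.
Proof. by apply: (@mulgI _ (xroot i j 0)); rewrite xrootD addr0 mulg1. Qed.

Let xrootV i j a : ((xroot i j a)^-1)%g = xroot i j (- a).
Proof. by apply: (@mulgI _ (xroot i j a)); rewrite xrootD subrr xroot_0 mulgV. Qed.

Lemma lcommute_R4 i h k a b c : indep i h -> indep i k -> indep h k ->
  lcommute (xroot i (negi i) c)
    (xroot h k (a * b * eps h) * xroot (negi k) k (- (a * b ^+ 2)))%g.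
Proof.
move=> ih ik hk; rewrite -xroot_R4 //; apply: lcommute_commut;
  first exact: commute_long_long.
by apply: commute_long_short; [indt|indt|rewrite (indepE hk)].
Qed.

(** With a fourth index m, R3 writes X_{h,-k} as a commutator of root elements
    through m that commute with X_{i,-i}(c), and then R4 gives the claim.
    Without it, comparing R4 for the parameters (-r, s) and (-r s, 1), whose
    short factors agree, shows that the lifts commute for t = r (s^2 - s); the
    elements s such that the claim holds for all multiples of s form an ideal. *)
Lemma lcommute_long_long i k c t : indep i k ->
  lcommute (xroot i (negi i) c) (xroot k (negi k) t).
Proof.
move=> ik; have [h [ih kh]] := third i k; have hk : indep h (negi k) by indt.
have iNk : indep i (negi k) by indt.
set x := xroot i (negi i) c.
have comh a b : lcommute x
  (xroot h (negi k) (a * b * eps h) * xroot k (negi k) (- (a * b ^+ 2)))%g.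
  by have := lcommute_R4 a b c ih iNk hk; rewrite negiK.
case: Hc => [four|idem].
  have short : lcommute x (xroot h (negi k) (- t * 1 * eps h)).
    have [m [im hm km]] := four i h k.
    rewrite -[_ * _]mulr1 -(@xroot_R3 h m (negi k)); [|indt..].
    by apply: lcommute_commut; apply: commute_long_short;
      rewrite ?(indepE hm) ?(indepE km) //; indt.
  by have := lcommuteMl short (comh (- t) 1); rewrite expr1n mulr1 opprK.
have /(_ t) : forall r, lcommute x (xroot k (negi k) (r * 1)); last by rewrite mulr1.
apply: (idem (fun s => forall r, lcommute x (xroot k (negi k) (r * s)))).
- by move=> s s' Js Js' r; rewrite mulrDr -xrootD; apply: lcommuteM.
- by move=> s s' Js r; rewrite mulrA; apply: Js.
- move=> s r; have := lcommuteM (lcommuteV (comh (- r) s)) (comh (- (r * s)) 1).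
  rewrite !mulNr !mulr1 invgM -mulgA mulKg expr1n mulr1 !opprK xrootV xrootD.
  by rewrite (_ : _ + _ = - (r * (s ^+ 2 - s))) -?xrootV;
    [move=> /lcommuteV; rewrite invgK|ring].
Qed.

Lemma lcommute_long_disjoint i h k c b : indep i h -> indep i k -> h != k ->
  lcommute (xroot i (negi i) c) (xroot h k b).
Proof.
move=> ih ik hk'; case hk: (indep h k); last first.
  by case/negbT/indepPn: hk => kEq; rewrite kEq ?eqxx // in hk' *;
    apply: lcommute_long_long.
have := lcommute_R4 (b * eps h) 1 c ih ik hk; rewrite mulr1 eps1 => /(lcommuteMr _);
  apply.
by rewrite -{2}[k]negiK; apply: lcommute_long_long; indt.
Qed.

Lemma lcommute_disjoint i j h k a b : indep i j -> indep i h -> indep i k ->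
  indep j h -> indep j k ->
  indep h k -> lcommute (xroot i j a) (xroot h k b).
Proof.
move=> ij ih ik jh jk hk; have ij' : i != j by rewrite (indepE ij).
apply: (@lcommuteMr _ _ (xroot (negi k) k (- (b * eps h)))).
  by apply: lcommute_sym; rewrite -{2}[k]negiK; apply: lcommute_long_disjoint => //; indt.
rewrite -xroot_R4_1 //; apply: lcommute_commut.
  by apply: commute_sym; apply: commute_long_short => //; indt.
apply: xroot_R2; rewrite // ?inE ?negb_or ?(indepE hk) // ?eq_negi ?eq_negiC.
  by rewrite [h == _]eq_sym [h == _]eq_sym ?(indepE jh) ?(indepE ih) //.
by rewrite [k == _]eq_sym [k == _]eq_sym (indepE jk) (indepE ik).
Qed.

Lemma lcommute_long i h k a b : h != k -> h != negi i -> k != i ->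
  lcommute (xroot i (negi i) a) (xroot h k b).
Proof.
move=> hk hNi ki; have [->|hi] := eqVneq h i.
  have [->|kNi] := eqVneq k (negi i); first exact: lcommute_long_same.
  by apply: lcommute_long_start; rewrite /indep eq_sym ki -eq_negiC eq_sym kNi.
have ih : indep i h by rewrite indep_sym /indep hi hNi.
have [->|kNi] := eqVneq k (negi i); first exact: lcommute_long_end.
by apply: lcommute_long_disjoint => //; rewrite indep_sym /indep ki kNi.
Qed.

(** The pairs of roots to which R2 applies, sorted by their relative position. *)
Lemma lcommute_R2 i j h k a b : i != j -> h != k ->
  h \notin [:: j; negi i] -> k \notin [:: i; negi j] ->
    lcommute (xroot i j a) (xroot h k b).
Proof.
move=> ij hk; rewrite !inE !negb_or => /andP[hj hNi] /andP[ki kNj].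
have [jE|jNi] := eqVneq j (negi i); first by rewrite jE; apply: lcommute_long.
have ij2 : indep i j by rewrite /indep ij -eq_negiC eq_sym jNi.
have [kEq|kNh] := eqVneq k (negi h).
  rewrite kEq; apply/lcommute_sym/lcommute_long => //; last by rewrite eq_sym.
  by rewrite -kEq eq_sym.
have hk2 : indep h k by rewrite /indep hk -eq_negiC eq_sym kNh.
have [hE|hi] := eqVneq h i.
  rewrite {}hE in hk2 *; have [->|kj] := eqVneq k j; first exact: lcommute_same.
  by apply: lcommute_start => //; rewrite indep_sym /indep kj kNj.
have ih : indep i h by rewrite indep_sym /indep hi hNi.
have [kEq|kj] := eqVneq k j.
  by rewrite kEq in hk2 *; apply: lcommute_end.
have jk : indep j k by rewrite indep_sym /indep kj kNj.
have [hE|hNj] := eqVneq h (negi j).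
  have [f -> _] := xroot_flip hk; rewrite hE negiK in hk2 *.
  have [-> | kNi] := eqVneq k (negi i); first by rewrite negiK; apply: lcommute_same.
  apply: lcommute_end => //; first by indt.
  by rewrite indepNr indep_sym /indep ki kNi.
have jh : indep j h by rewrite indep_sym /indep hj hNj.
have [kEq|kNi] := eqVneq k (negi i).
  have [f -> _] := xroot_flip hk; rewrite kEq negiK; apply: lcommute_start => //; indt.
by apply: lcommute_disjoint => //; rewrite indep_sym /indep ki kNi.
Qed.

(** The Hall-Witt identity in the extension, for lifts of x, y and z. *)
Lemma lcommut_hall_witt x y z : lcommute x z ->
  lcommut x (commut y z) = (L y * lcommut (commut y^-1 x)%g z * (L y)^-1)%g.
Proof.
move=> /lcommuteL xz; have := hall_witt (L y) xz.
have -> : commut (L x) (commut (L y) (L z)) =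
  lcommut x (commut y z) by rewrite commutE pr_commut !LK.
by rewrite commutE pr_commut multiplicativeV !LK.
Qed.

Lemma lcommut_hall_witt_comm x y z : lcommute x z ->
  lcommute y (commut (commut y^-1 x) z)%g ->
  lcommut x (commut y z) = lcommut (commut y^-1 x)%g z.
Proof.
move=> xz yc; rewrite lcommut_hall_witt //; apply/commute_conjP/lcommuteP.
by rewrite pr_lcommut LK.
Qed.

(** The candidate for a lift of X_ij(ab) that passes through the index k. *)
Definition via i k j a b : E := lcommut (xroot i k a) (xroot k j b).

(** The Hall-Witt identity with y = X_{-k,k}(b eps_{-k}), which takes
    X_{i,-k}(a) to X_ik(ab) and X_kj(c) to X_{-k,j}(bc), up to long root
    elements whose lifts commute with those of the other entry. *)
Lemma via_opp i k j a b c : indep i k -> indep k j -> indep i j ->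
  via i k j (a * b) c = via i (negi k) j a (b * c).
Proof.
move=> ik kj ij; have ik' : i != negi k by rewrite (indepE ik).
have ij' : i != j by rewrite (indepE ij).
have ki' : negi k != negi i by rewrite eq_negi (indepE ik).
have kj' : k != j by rewrite (indepE kj).
have xz : lcommute (xroot i (negi k) a) (xroot k j c).
  have [f -> _] := xroot_flip ik'; rewrite negiK; apply: lcommute_start => //; indt.
pose y := xroot (negi k) k (b * eps (negi k)).
have yxE : commut (y^-1)%g (xroot i (negi k) a) =
  (xroot i k (a * b) * xroot i (negi i)
  (- (- (b * eps (negi k)) * (a * eps i * eps k) ^+ 2)))%g.
  rewrite /y xrootV (xroot_R0 a) // negiK epsN xroot_R4N ?negiK; last by indt.
  rewrite (xroot_R0 _ ki') !negiK !epsN; congr (xroot _ _ _ * xroot _ _ _)%g;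
    last by ring.
  by ring: (eps_sqr R k) (eps_sqr R i).
have := @lcommut_hall_witt_comm (xroot i (negi k) a) y (xroot k j c) xz.
rewrite yxE /via => H; rewrite
  -[LHS](@lcommutMl _ (xroot i (negi i)
  (- (- (b * eps (negi k)) * (a * eps i * eps k) ^+ 2)))); last first.
  by apply: lcommute_long_disjoint; indt.
rewrite -{}H; last first.
  rewrite -pr_lcommut lcommutMl; last by apply: lcommute_long_disjoint; indt.
  rewrite pr_lcommut xroot_R3; [|indt..].
  by rewrite /y -{2}[k]negiK; apply: lcommute_long_disjoint => //; indt.
rewrite /y xroot_R4N // lcommutMr; first by congr (lcommut _ (xroot _ _ _));
  ring: (eps_sqr R (negi k)).
by apply: lcommute_sym; rewrite -{2}[j]negiK; apply: lcommute_long_disjoint => //; indt.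
Qed.

(** The Hall-Witt identity for X_im(a), X_mk(b) and X_kj(c). *)
Lemma via_A3 i k m j a b c : indep i j -> indep i k -> indep k j -> indep i m ->
  indep m j ->
  indep m k -> via i k j (a * b) c = via i m j a (b * c).
Proof.
move=> ij ik kj im mj mk; rewrite /via -(@xroot_R3 m k j) //.
have yxE : commut ((xroot m k b)^-1)%g (xroot i m a) = xroot i k (a * b).
  by rewrite xrootV -commut_inv xroot_R3 // xrootV mulrN opprK.
rewrite lcommut_hall_witt_comm ?yxE //; last first.
  by rewrite xroot_R3 //; apply: lcommute_disjoint => //; indt.
by apply: lcommute_disjoint => //; indt.
Qed.

Lemma via_shift i k m j a b c : indep i j -> indep i k -> indep k j -> indep i m ->
  indep m j ->
  via i k j (a * b) c = via i m j a (b * c).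
Proof.
move=> ij ik kj im mj; case mk: (indep m k); first exact: via_A3.
have kk : via i k j (a * b) c = via i k j a (b * c).
  have ik' : indep i (negi k) by indt.
  have kj' : indep (negi k) j by indt.
  have := via_opp (a) 1 (b * c) ik' kj' ij; rewrite negiK mulr1 mul1r => <-.
  by rewrite -via_opp.
case/negbT/indepPn: mk => kEq; first by rewrite -kEq.
by rewrite via_opp // kEq negiK.
Qed.

Lemma via_add i k j a a' b : indep i j -> indep i k -> indep k j ->
  via i k j (a + a') b = (via i k j a b * via i k j a' b)%g.
Proof.
move=> ij ik kj; rewrite /via -xrootD.
have pr_via t : pr (via i k j t b) = xroot i j (t * b) by rewrite pr_lcommut xroot_R3.
rewrite -[xroot i k a]LK -[xroot i k a']LK -[xroot k j b]LK -gmulfM -!commutE commutMl.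
rewrite -[commut (L (xroot i k a')) _]/(via i k j a' b)
  -[commut (L (xroot i k a)) _]/(via i k j a b).
have -> : (L (xroot i k a) * via i k j a' b * (L (xroot i k a))^-1 = via i k j a' b)%g.
  by apply/commute_conjP/lcommuteP; rewrite LK pr_via; apply: lcommute_start => //; indt.
by apply: lcommuteP; rewrite !pr_via; apply: lcommute_same.
Qed.

Definition mid i j := sval (cid (third i j)).
Definition yshort i j a : E := via i (mid i j) j a 1.

Lemma midP i j : indep i (mid i j) /\ indep (mid i j) j.
Proof. by rewrite /mid; case: cid => k /= [ik jk]; split=> //; indt. Qed.

Lemma viaE i k j a b : indep i j -> indep i k -> indep k j ->
  via i k j a b = yshort i j (a * b).
Proof.
move=> ij ik kj; have [ix xj] := midP i j.
by rewrite /yshort (via_shift _ _ _ ij ix xj ik kj) mulr1.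
Qed.

Lemma pr_yshort i j a : indep i j -> pr (yshort i j a) = xroot i j a.
Proof. by move=> ij; have [ix xj] := midP i j; rewrite pr_lcommut xroot_R3 // mulr1. Qed.

Lemma yshort_R1 i j a b : indep i j ->
  (yshort i j a * yshort i j b)%g = yshort i j (a + b).
Proof. by move=> ij; have [ix xj] := midP i j; rewrite /yshort via_add. Qed.

Lemma yshort_R3 i j k a b : indep i j -> indep j k -> indep i k ->
  lcommut (xroot i j a) (xroot j k b) = yshort i k (a * b).
Proof. by move=> ij jk ik; rewrite -(viaE a b ik ij jk). Qed.

Lemma yshort_0 i j : indep i j -> yshort i j 0 = 1%g.
Proof.
by move=> ij; apply: (@mulgI _ (yshort i j 0)); rewrite yshort_R1 // addr0 mulg1.
Qed.

Lemma yshortV i j a : indep i j -> ((yshort i j a)^-1)%g = yshort i j (- a).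
Proof.
by move=> ij; apply: (@mulgI _ (yshort i j a));
  rewrite yshort_R1 // subrr yshort_0 // mulgV.
Qed.

Lemma yshort_R0 i j a : indep i j ->
  yshort i j a = yshort (negi j) (negi i) (- a * eps i * eps j).
Proof.
move=> ij; have [k [ik jk]] := third i j.
rewrite -[a in LHS]mulr1 -(@yshort_R3 i k j); [|indt..].
rewrite (xroot_R0 a) ?(indepE ik) // (xroot_R0 1) 1?eq_sym ?(indepE jk) // -lcommut_inv.
rewrite yshort_R3; [|indt..]; rewrite yshortV; last by indt.
by congr yshort; ring: (eps_sqr R k).
Qed.

Lemma lcommutMl_swap u v z : lcommute u (commut v z) ->
  lcommut (u * v)%g z = (lcommut v z * lcommut u z)%g.
Proof.
rewrite -{1}[u]LK -pr_lcommut => /lcommuteP/commute_conjP uv.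
rewrite -{1}[u]LK -{1}[v]LK -{1}[z]LK -gmulfM -commutE commutMl.
by rewrite -[commut (L v) _]/(lcommut v z) uv.
Qed.

(** R4 says that this lies over the long root element X_{-j,j}(-ab^2), see
    [pr_R4tail]. *)
Definition R4tail i j a b : E :=
  ((yshort i j (a * b * eps i))^-1 * lcommut (xroot i (negi i) a) (xroot (negi i) j b))%g.

Lemma lcommut_R4 i j a b :
  lcommut (xroot i (negi i) a) (xroot (negi i) j b) =
    (yshort i j (a * b * eps i) * R4tail i j a b)%g.
Proof. by rewrite /R4tail mulVKg. Qed.

Lemma pr_R4tail i j a b : indep i j ->
  pr (R4tail i j a b) = xroot (negi j) j (- (a * b ^+ 2)).
Proof.
by move=> ij; rewrite /R4tail gmulfM multiplicativeV pr_yshort //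
  pr_lcommut xroot_R4 // mulKg.
Qed.

Lemma lcommute_startN i j a b : indep i j -> lcommute (xroot i j a) (xroot (negi j) j b).
Proof.
move=> ij; apply: lcommute_sym; rewrite -{2}[j]negiK -[X in xroot i X]negiK.
by apply: lcommute_long_end; indt.
Qed.

Lemma lcommute_long_sameN i a b : lcommute (xroot (negi i) i a) (xroot (negi i) i b).
Proof. by rewrite -{2 4}[i]negiK; apply: lcommute_long_same. Qed.

Lemma lcommute_disjointN h k i a b : indep h i -> indep k i -> h != k ->
  lcommute (xroot h k a) (xroot (negi i) i b).
Proof.
by move=> hi ki hk; apply: lcommute_sym; rewrite -{2}[i]negiK;
  apply: lcommute_long_disjoint => //; indt.
Qed.

Lemma yshort_R4tail i j a c b : indep i j -> commute (yshort i j c) (R4tail i j a b).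
Proof.
by move=> ij; apply: lcommuteP; rewrite pr_yshort // pr_R4tail //; apply: lcommute_startN.
Qed.

Lemma R4tail_comm i k j a b c d : indep i j -> indep k j ->
  commute (R4tail i j a b) (R4tail k j c d).
Proof.
by move=> ij kj; apply: lcommuteP; rewrite !pr_R4tail //; apply: lcommute_long_sameN.
Qed.

(** The Hall-Witt identity for X_{i,-i}(a), X_{-i,k}(b) and X_kj(c). *)
Lemma R4tail_shift i k j a b c : indep i j -> indep i k -> indep k j ->
  R4tail i j a (b * c) = R4tail (negi k) j (a * b ^+ 2) c.
Proof.
move=> ij ik kj; have kj' : k != j by rewrite (indepE kj).
have ij' : i != j by rewrite (indepE ij).
set t := a * b * c * eps i.
apply: (@mulgI _ (yshort i j t)).
have tE : yshort i j t = yshort i j (a * (b * c) * eps i) by congr yshort; rewrite /t;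
  ring.
rewrite {1}tE -lcommut_R4; pose y := xroot (negi i) k b.
have yx : commut (y^-1)%g (xroot i (negi i) a) =
  (xroot (negi k) k (a * b ^+ 2) * xroot i k (a * b * eps i))%g.
  rewrite /y xrootV -commut_inv xroot_R4 // invgM !xrootV;
    congr (xroot _ _ _ * xroot _ _ _)%g; ring.
have xz : lcommute (xroot i (negi i) a) (xroot k j c) by apply: lcommute_long_disjoint.
have := @lcommut_hall_witt _ y _ xz; rewrite yx xroot_R3; [|indt..] => ->.
rewrite lcommutMl_swap; last by rewrite xroot_R3 //;
  apply/lcommute_sym/lcommute_disjointN; rewrite ?indepNl //; indt.
have -> : lcommut (xroot i k (a * b * eps i)) (xroot k j c) = yshort i j t.
  by rewrite yshort_R3 //; congr yshort; rewrite /t; ring.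
have := @lcommut_R4 (negi k) j (a * b ^+ 2) c; rewrite negiK => ->.
set u := yshort (negi k) j _; set M := R4tail (negi k) j _ _.
have Nkj : indep (negi k) j by indt.
have yM : (L y * M * (L y)^-1 = M)%g.
  apply/commute_conjP/lcommuteP; rewrite LK pr_R4tail // /y;
    apply: lcommute_disjointN => //; first by indt.
  by rewrite (indepE ik).
have yu : (L y * u * (L y)^-1 = u)%g.
  apply/commute_conjP/lcommuteP; rewrite LK pr_yshort //; apply: lcommute_R2;
    rewrite ?(indepE ik) ?(indepE Nkj) //.
    by rewrite !inE negb_or negi_neq eq_negi eq_sym (indepE ik).
  by rewrite !inE negb_or eq_sym (indepE ij) eq_sym (indepE kj).
have yt : (L y * yshort i j t * (L y)^-1 = u^-1 * yshort i j t)%g.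
  rewrite conj_commut; congr (_ * _)%g; rewrite commutE LK pr_yshort // /y.
  rewrite xroot_R0 ?(indepE ik) // negiK yshort_R3; [|indt..].
  by rewrite /u yshortV //; congr yshort; rewrite /t !epsN; ring: (eps_sqr R i).
have ut : commute u (yshort i j t).
  by apply: lcommuteP; rewrite !pr_yshort //; apply: lcommute_end => //; indt.
transitivity ((L y * yshort i j t * (L y)^-1)
  * ((L y * u * (L y)^-1) * (L y * M * (L y)^-1)))%g.
  by rewrite !gnorm.
by rewrite yt yu yM; apply: cancel_word.
Qed.

(** The lift of X_{i,-i}(a) read off from R4; [mid i i] is some index
    independent of i. *)
Definition ylong i a : E := R4tail (mid i i) (negi i) (- a) 1.

(** By [R4tail_shift] for k = -i', if i and i' are independent; otherwise
    through a third index. *)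
Lemma R4tail_swap i i' j a b : indep i j -> indep i' j ->
  R4tail i j a b = R4tail i' j (a * b ^+ 2) 1.
Proof.
have key k k' c d : indep k j -> indep k' j -> indep k k' ->
   R4tail k j c d = R4tail k' j (c * d ^+ 2) 1.
  move=> kj kj' kk; rewrite -[d in LHS]mulr1 (@R4tail_shift _ (negi k')) ?negiK //; indt.
move=> ij ij'; case ii: (indep i i'); first exact: key.
have [m [im jm]] := third i j; have mj : indep m j by indt.
rewrite (@key i m) // (@key m i') ?expr1n ?mulr1 //.
by case/negbT/indepPn: ii => ->; indt.
Qed.

Lemma mid_indep i : indep (mid i i) i.
Proof. by have [] := midP i i. Qed.

Lemma R4tailE i j a b : indep i j -> R4tail i j a b = ylong (negi j) (- (a * b ^+ 2)).
Proof.
move=> ij; rewrite /ylong opprK negiK; apply: R4tail_swap => //.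
by have := mid_indep (negi j); rewrite indepNr.
Qed.

Lemma R4tail_addl i j a a' b : indep i j ->
  R4tail i j (a + a') b = (R4tail i j a b * R4tail i j a' b)%g.
Proof.
move=> ij; apply: (@mulgI _ (yshort i j ((a + a') * b * eps i)));
  rewrite -lcommut_R4 -xrootD.
rewrite lcommutMl_swap; last first.
  by rewrite xroot_R4 //; apply: lcommuteM;
    [apply: lcommute_long_start|rewrite -{2}[j]negiK; apply: lcommute_long_long; indt].
rewrite !lcommut_R4 !mulrDl -yshort_R1 //.
set s := yshort _ _ _; set s' := yshort _ _ _; set M := R4tail _ _ _ _;
  set M' := R4tail _ _ _ _.
have sM : commute s' M by apply: yshort_R4tail.
have ss : commute s' s by apply: lcommuteP; rewrite !pr_yshort //; apply: lcommute_same.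
have MM : commute M' M by apply: R4tail_comm.
by apply: swap_word.
Qed.

Lemma ylong_R1 i a b : (ylong i a * ylong i b)%g = ylong i (a + b).
Proof. by rewrite /ylong opprD R4tail_addl // indepNr mid_indep. Qed.

Lemma pr_ylong i a : pr (ylong i a) = xroot i (negi i) a.
Proof. by rewrite /ylong pr_R4tail ?indepNr ?mid_indep // negiK expr1n mulr1 opprK. Qed.

(** The commutator of X_{i,-i}(1) and a sum in the second argument; comparing
    with [R4tailE], which makes the outer terms quadratic, yields R5. *)
Lemma R4tail_addr i j b b' : indep i j ->
  R4tail i j 1 (b + b') =
  (R4tail i j 1 b * lcommut (xroot (negi i) j b) (xroot i j (b' * eps i))
    * R4tail i j 1 b')%g.
Proof.
move=> ij; have ij' : negi i != j by rewrite (indepE ij).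
set t := b' * eps i; set K := lcommut _ _.
have prK : exists c, pr K = xroot (negi j) j c.
  rewrite pr_lcommut xroot_R0 // negiK -{3}[j]negiK xroot_R5; last by indt.
  by rewrite negiK; eexists.
have [c Kc] := prK.
apply: (@mulgI _ (yshort i j (1 * (b + b') * eps i))); rewrite -lcommut_R4 -xrootD.
rewrite -{1}[xroot _ _ b]LK -{1}[xroot _ _ b']LK -{1}[xroot i (negi i) 1]LK -gmulfM
  -commutE commutMr.
rewrite !commutE !LK !lcommut_R4 !mul1r -/t mulrDl -yshort_R1 //.
set s := yshort i j (b * eps i); set s' := yshort i j t; set M := R4tail i j 1 b;
  set M' := R4tail i j 1 b'.
set y := L _.
have yM : (y * M' * y^-1 = M')%g.
  by apply/commute_conjP/lcommuteP; rewrite LK pr_R4tail //; apply: lcommute_startN; indt.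
have ys : (y * s' * y^-1 = K * s')%g.
  by rewrite conj_commut commutE LK pr_yshort.
have -> : (y * (s' * M') * y^-1 = (y * s' * y^-1) * (y * M' * y^-1))%g by rewrite !gnorm.
rewrite yM ys.
have sK : commute s' K by apply: lcommuteP; rewrite Kc pr_yshort //;
  apply: lcommute_startN.
have sM : commute s' M by apply: yshort_R4tail.
by apply: swap_word3.
Qed.

Lemma ylong_0 i : ylong i 0 = 1%g.
Proof. by apply: (@mulgI _ (ylong i 0)); rewrite ylong_R1 addr0 mulg1. Qed.

Lemma ylongV i a : ((ylong i a)^-1)%g = ylong i (- a).
Proof. by apply: (@mulgI _ (ylong i a)); rewrite ylong_R1 subrr ylong_0 mulgV. Qed.

Lemma yroot_R5_aux i j a b : indep i j ->
  lcommut (xroot j i a) (xroot i (negi j) b) = ylong j (2%:R * a * b * eps j).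
Proof.
move=> ij; have ij' : indep i (negi j) by indt.
have := R4tail_addr (- a * eps i * eps j) (b * eps i) ij'; rewrite eps1.
rewrite (xroot_R0 (- a * eps i * eps j)); last by rewrite eq_negi (indepE ij).
rewrite !negiK (_ : - (- a * eps i * eps j) * eps (negi i) * eps (negi j) = a);
  last first.
  by rewrite !epsN; ring: (eps_sqr R i) (eps_sqr R j).
rewrite !R4tailE // !negiK => /mid_word ->; rewrite !ylongV !ylong_R1.
by congr ylong; ring: (eps_sqr R i) (eps_sqr R j).
Qed.

Definition yroot i j a : E := if j == negi i then ylong i a else yshort i j a.

Lemma yroot_short i j a : indep i j -> yroot i j a = yshort i j a.
Proof. by move=> ij; rewrite /yroot (indepE ij). Qed.
Lemma yroot_long i a : yroot i (negi i) a = ylong i a.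
Proof. by rewrite /yroot eqxx. Qed.

Lemma indep_or i j : i != j -> j = negi i \/ indep i j.
Proof.
move=> ij; case ii: (indep i j); first by right.
by left; case/negbT/indepPn: ii => // E0; rewrite E0 eqxx in ij.
Qed.

Lemma pr_yroot i j a : i != j -> pr (yroot i j a) = xroot i j a.
Proof.
by case/indep_or => [->|ij];
  [rewrite yroot_long pr_ylong|rewrite yroot_short // pr_yshort].
Qed.

Lemma yroot_R0 i j a : i != j ->
  yroot i j a = yroot (negi j) (negi i) (- a * eps i * eps j).
Proof.
case/indep_or => [->|ij]; last by rewrite !yroot_short; [apply: yshort_R0|indt..].
by rewrite negiK !yroot_long epsN; congr ylong; ring: (eps_sqr R i).
Qed.

Lemma yroot_R1 i j a b : i != j -> (yroot i j a * yroot i j b)%g = yroot i j (a + b).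
Proof.
by case/indep_or => [->|ij];
  [rewrite !yroot_long ylong_R1|rewrite !yroot_short // yshort_R1].
Qed.

Lemma yroot_R2 i j h k a b : i != j -> h != k ->
  h \notin [:: j; negi i] -> k \notin [:: i; negi j] ->
    commut (yroot i j a) (yroot h k b) = 1%g.
Proof. by move=> ij hk c1 c2; rewrite commutE !pr_yroot //; apply: lcommute_R2. Qed.

Lemma yroot_R3 i j k a b : indep i j -> indep j k -> indep i k ->
  commut (yroot i j a) (yroot j k b) = yroot i k (a * b).
Proof.
move=> ij jk ik; rewrite commutE !pr_yroot ?(indepE ij) ?(indepE jk) // yshort_R3 //
  yroot_short //.
Qed.

Lemma yroot_R4 i j a b : indep i j ->
  commut (yroot i (negi i) a) (yroot (negi i) j b) =
  (yroot i j (a * b * eps i) * yroot (negi j) j (- (a * b ^+ 2)))%g.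
Proof.
move=> ij; rewrite commutE !pr_yroot ?negiN ?(indepE ij) // lcommut_R4 R4tailE //
  yroot_short //.
by rewrite [yroot (negi j) j _]/yroot negiK eqxx.
Qed.

Lemma yroot_R5 i j a b : indep i j ->
  commut (yroot i j a) (yroot j (negi i) b) = yroot i (negi i) (2%:R * a * b * eps i).
Proof.
move=> ij; rewrite commutE !pr_yroot ?(indepE ij) // yroot_long yroot_R5_aux //; indt.
Qed.

End Splitting.

(** * Central extensions of the Steinberg group split *)

Definition central_ker (E S : groupType) (p : E -> S) : Prop :=
  forall x y, p x = 1%g -> commute x y.

Section Split.
Variables (R : comPzRingType) (l : nat).
Hypothesis l3 : (3 <= l)%N.
Local Notation idx := (idx l).
Local Notation eps := (@eps R l).
Local Notation xroot := (@xroot R l).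
Implicit Types (i j h k : idx) (a b : R).

Hypothesis Hc : fourth_index l \/ no_boolean_quotient R.

Lemma xroot_R3i i j k a b : indep i j -> indep j k -> indep i k ->
  commut (xroot i j a) (xroot j k b) = xroot i k (a * b).
Proof.
by move=> ij jk ik; rewrite xroot_R3 ?inE ?negb_or ?(indepE ij) ?(indepE jk) ?(indepE ik).
Qed.

Lemma xroot_R4i i j a b : indep i j ->
  commut (xroot i (negi i) a) (xroot (negi i) j b) =
  (xroot i j (a * b * eps i) * xroot (negi j) j (- (a * b ^+ 2)))%g.
Proof. by move=> ij; rewrite xroot_R4 ?(indepE ij). Qed.

Lemma xroot_R5i i j a b : indep i j ->
  commut (xroot i j a) (xroot j (negi i) b) = xroot i (negi i) (2%:R * a * b * eps i).
Proof. by move=> ij; rewrite xroot_R5 ?(indepE ij). Qed.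

Variables (E : groupType) (p : {multiplicative E -> StSp R l}).
Hypothesis p_surj : surjective p.
Hypothesis p_central : central_ker p.

Definition lift_elt x := sval (cid (p_surj x)).
Lemma lift_eltK : cancel lift_elt p.
Proof. by move=> x; rewrite /lift_elt; case: cid. Qed.

Let y i j a : E := yroot xroot lift_elt (third l3) i j a.
Let h0 := @xroot_R0 R l.
Let h2 := @xroot_R2 R l.
Let hD := @xrootD R l.

Definition lift_gen (x : St_gen R l) : E := y (val x.1).1 (val x.1).2 x.2.

Lemma lift_eval i j (ij : i != j) a : word_eval lift_gen (Xw ij a) = y i j a.
Proof. by rewrite word_eval1. Qed.

Lemma lift_rel u v : St_rel u v -> word_eval lift_gen u = word_eval lift_gen v.
Proof.
have LK := lift_eltK; have th := third l3.
case=> {u v}.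
- move=> i j a ij ji; rewrite !lift_eval.
  exact: (yroot_R0 LK p_central (third l3) hD h0 h2 xroot_R3i xroot_R4i Hc).
- move=> i j a b ij; rewrite word_eval_cat !lift_eval.
  exact: (yroot_R1 LK p_central (third l3) hD h0 h2 xroot_R3i xroot_R4i Hc).
- move=> i j h k a b ij hk c1 c2; rewrite word_eval_comm !lift_eval /word_eval big_nil.
  exact: (yroot_R2 LK p_central (third l3) hD h0 h2 xroot_R3i xroot_R4i Hc).
- move=> i j k a b ij jk ik; rewrite !inE !negb_or => /andP[iNj iNk] jNk.
  rewrite word_eval_comm !lift_eval.
  by apply: (yroot_R3 LK p_central (third l3) hD h0 h2 xroot_R3i xroot_R4i Hc);
    apply/andP.
- move=> i j a b iNi Nij ij Njj; rewrite word_eval_comm word_eval_cat !lift_eval.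
  apply: (yroot_R4 LK p_central (third l3) hD h0 h2 xroot_R3i xroot_R4i Hc).
  by rewrite /indep ij -eq_negiC.
- move=> i j a b ij jNi iNi; rewrite word_eval_comm !lift_eval.
  apply: (yroot_R5 LK p_central (third l3) hD h0 h2 xroot_R3i xroot_R4i xroot_R5i Hc).
  by rewrite /indep ij -eq_negiC eq_sym.
Qed.

(** The lifted root elements satisfy the defining relations. *)
Definition splitting : StSp R l -> E := pres_lift lift_rel.
HB.instance Definition _ := Multiplicative.on splitting.

Lemma splittingK : cancel splitting p.
Proof.
have pM (u v : E) : p (u * v)%g = (p u * p v)%g by apply: gmulfM.
have sM u v : splitting (u * v)%g = (splitting u * splitting v)%g by apply: gmulfM.
apply: StSp_ind; first by rewrite multiplicative1 multiplicative1.
move=> i j a g ij IH; rewrite sM pM IH; congr (_ * _)%g.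
have -> : splitting (xroot i j a) = y i j a.
  by rewrite (xrootE ij) /splitting pres_lift_gen.
by apply: pr_yroot ij => //; [apply: lift_eltK|apply: xroot_R3i|apply: xroot_R4i].
Qed.

End Split.

Lemma fourth l : (4 <= l)%N -> fourth_index l.
Proof.
move=> l4 i j k; have : ~~ (predT \subset [set i.2; j.2; k.2]).
  apply/negP => /subset_leq_card; rewrite cardT size_enum_ord => /(leq_trans l4).
  by rewrite finset.setUC cardsU1 cards2; case: (_ \notin _); case: (_ != _).
case/subsetPn => t _; rewrite !inE !negb_or => /andP[/andP[ti tj] tk].
by exists (true, t); rewrite !indep_snd /= eq_sym ti eq_sym tj eq_sym tk.
Qed.

(** * Residue fields with two elements *)

Section ResidueFields.
Variable R : comPzRingType.
Implicit Types (I J A : set R).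

Definition is_ideal J : Prop :=
  [/\ J 0, forall a b, J a -> J b -> J (a + b) & forall a b, J b -> J (a * b)].

Lemma ideal_opp J a : is_ideal J -> J a -> J (- a).
Proof. by move=> [_ _ JM] Ja; rewrite -mulN1r; apply: JM. Qed.

(** Zorn's lemma. As the union of the empty chain is empty, the empty set is
    admitted along with the proper ideals above J. *)
Lemma maximal_over_ex J : is_ideal J -> ~ J 1 -> exists M : set R,
  [/\ is_ideal M, ~ M 1, forall a, J a -> M a &
    forall I, is_ideal I -> ~ I 1 -> (forall a, M a -> I a) -> forall a, I a -> M a].
Proof.
move=> iJ J1; pose P A :=
  (forall a, ~ A a) \/ [/\ is_ideal A, ~ A 1 & forall a, J a -> A a].
have [|M [PM Mmax]] := @Zorn_bigcup R P.
  move=> F FP Ftot; case: (pselect (exists2 A, F A & exists a, A a)) =>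
    [[A FA [a Aa]]|nF]; last first.
    by left=> a [A FA Aa]; apply: nF; exists A => //; exists a.
  have Fi B : F B -> (exists b, B b) -> [/\ is_ideal B, ~ B 1 & forall b, J b -> B b].
    by move=> FB [b Bb]; case: (FP B FB) => // nB; case: (nB b).
  have [iA A1 JA] := Fi A FA (ex_intro _ a Aa).
  right; split; last by move=> b Jb; exists A => //; apply: JA.
    split; first by exists A => //; case: iA.
      move=> x y [B FB Bx] [C FC Cy].
      have [[B0 BD BM] _ _] := Fi B FB (ex_intro _ x Bx).
      have [[C0 CD CM] _ _] := Fi C FC (ex_intro _ y Cy).
      have [BC|CB] := Ftot B C FB FC.
        by exists C => //; apply: CD => //; apply: BC.
      by exists B => //; apply: BD => //; apply: CB.
    move=> x y [B FB By]; have [[B0 BD BM] _ _] := Fi B FB (ex_intro _ y By).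
    by exists B => //; apply: BM.
  by move=> [B FB B1]; have [_ /(_ B1)] := Fi B FB (ex_intro _ 1 B1).
case: PM => [Memp|[iM M1 JM]].
  case: (Mmax J); last by right.
  split=> [a /Memp//|]; move=> JM; case: (Memp 0); apply: JM; by case: iJ.
exists M; split=> // I iI I1 MI a Ia; apply: contrapT => Ma.
apply: (Mmax I); last by right; split=> // b /JM /MI.
by split=> [b /MI//|IM]; apply: Ma; apply: IM.
Qed.

(** If J were proper, a maximal ideal M above it would contain all b^2 - b.
    Then every b lies in M or in 1 + M, and R/M has two elements. *)
Lemma no_boolean_quotientP : ~ has_residue_field R 'F_2 -> no_boolean_quotient R.
Proof.
move=> noF J JD JM Jb; apply: contrapT => J1; apply: noF.
have J0 : J 0 by have := JM 0 _ (Jb 0); rewrite mul0r.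
have [M [iM M1 JsM Mmax]] := @maximal_over_ex J (And3 J0 JD JM) J1.
have [M0 MD MM] := iM; have MN a : M a -> M (- a) by apply: ideal_opp.
pose Mp : {pred R} := fun x => `[<M x>].
have MpP x : reflect (M x) (x \in Mp) by exact: asboolP.
have iMp : ideal_closed Mp.
  split; first split; first exact/MpP.
    by move=> x y /MpP Mx /MpP My; apply/MpP; apply: MD => //; apply: MN.
  by move=> a x /MpP Mx; apply/MpP; apply: MM.
pose m := Ideal iMp.
have maxm : maximal m.
  split; first by apply/MpP.
  move=> I I1 mI x Ix; apply/MpP.
  have [[I0 IB] IM] := idealP I.
  apply: (Mmax (fun x => x \in (I : {pred R}))) => //; last by move=> a /MpP /mI.
    split=> [|a b Ia Ib|a b Ib]; rewrite //.
      by rewrite -[b]opprK; apply: (IB) => //; rewrite -[- b]add0r; apply: IB.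
    by apply: IM.
  exact/negP.
have dich x : ~ M x -> M (x - 1).
  move=> nx; pose I y := exists2 r, M (y - x * r) & True.
  have iI : is_ideal I.
    split; first by exists 0; rewrite // mulr0 subrr.
      move=> a b [r Ma _] [s Mb _]; exists (r + s) => //.
      by rewrite mulrDr opprD addrACA; apply: MD.
    by move=> a b [r Mb _]; exists (a * r) => //;
      rewrite (_ : _ - _ = a * (b - x * r)); [apply: MM|ring].
  have [r Mr _] : I 1.
    apply: contrapT => I1; apply: nx; apply: (Mmax I) => //.
      by move=> a Ma; exists 0; rewrite // mulr0 subr0.
    by exists 1; rewrite // mulr1 subrr.
  (* r inverts x modulo M, and x * (x - 1) lies in M *)
  rewrite (_ : x - 1 = (x - 1) * (1 - x * r) + r * (x ^+ 2 - x)); last by ring.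
  by apply: MD; apply: MM => //; apply: JsM.
exists m; split=> //.
have repM x : M (repr (\pi_(quot_ring m) x) - x).
  have := @quot_ring_eqP R m (repr (\pi_(quot_ring m) x)) x; rewrite reprK eqxx => /esym.
  by move/MpP.
pose f (q : quot_ring m) : 'F_2 := (repr q \notin Mp)%:R.
have fE x : f (\pi x) = (x \notin Mp)%:R.
  rewrite /f; congr (~~ _)%:R; apply/MpP/MpP => H.
    by rewrite -[x](subKr (repr (\pi_(quot_ring m) x))); apply: MD => //; apply/MN/repM.
  by rewrite -[repr _](subrK x); apply: MD.
have zmodM x y : (x - y \notin Mp)%:R = (x \notin Mp)%:R - (y \notin Mp)%:R :> 'F_2.
  case: (MpP x) => Mx; case: (MpP y) => My; case: (MpP (x - y)) => Mxy;
    try (by apply/eqP); exfalso.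
  - by apply: Mxy; apply: MD => //; apply: MN.
  - by apply: My; rewrite -[y](subKr x); apply: MD => //; apply: MN.
  - by apply: Mx; rewrite -[x](subrK y); apply: MD.
  - apply: Mxy; rewrite (_ : x - y = (x - 1) - (y - 1)); last by ring.
    by apply: MD; [|apply: MN]; apply: dich.
have mulM x y : (x * y \notin Mp)%:R = (x \notin Mp)%:R * (y \notin Mp)%:R :> 'F_2.
  case: (MpP x) => Mx; case: (MpP y) => My; case: (MpP (x * y)) => Mxy;
    try (by apply/eqP); exfalso.
  - by apply: Mxy; apply: MM.
  - by apply: Mxy; rewrite mulrC; apply: MM.
  - by apply: Mxy; apply: MM.
  - apply: Mx; rewrite (_ : x = x * y - x * (y - 1)); last by ring.
    by apply: MD => //; apply: MN; apply: MM; apply: dich.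
have fB : zmod_morphism f.
  move=> a b; have [[x ->] [y ->]] := (quot_ring_surj a, quot_ring_surj b).
  rewrite !fE -zmodM -fE; congr f; apply/eqP.
  have -> : \pi_(quot_ring m) x - \pi_(quot_ring m) y = \pi_(quot_ring m) (x - y).
    by apply: (addIr (\pi_(quot_ring m) y)); rewrite subrK -qaddE subrK.
  by [].
have fM : monoid_morphism f.
  split; first by rewrite -[1]/(\pi_(quot_ring m) 1) fE; case: MpP.
  move=> a b; have [[x ->] [y ->]] := (quot_ring_surj a, quot_ring_surj b).
  by rewrite (fE x) (fE y) -mulM -fE; congr f; apply: qmulE.
have q0 : \pi_(quot_ring m) 0 = 0.
  by apply: (addrI (\pi_(quot_ring m) 0)); rewrite -qaddE !addr0.
pose fz := GRing.isZmodMorphism.Build _ _ f fB.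
pose fm := GRing.isMonoidMorphism.Build _ _ f fM.
pose fr : {rmorphism quot_ring m -> 'F_2} := HB.pack f fz fm.
exists fr; exists (fun z : 'F_2 => if z == 0 then 0 else 1) => [q|z] /=.
  have [x ->] := quot_ring_surj q; rewrite fE.
  case: (MpP x) => Mx; rewrite /= ?mulr0n ?mulr1n ?eqxx ?oner_eq0; apply/esym/eqP.
    by rewrite -q0 quot_ring_eqP subr0; apply/MpP.
  by rewrite -[1]/(\pi_(quot_ring m) 1) quot_ring_eqP; apply/MpP/dich.
case: eqVneq => [->|z0].
  by rewrite -q0 fE; case: MpP.
rewrite -[1]/(\pi_(quot_ring m) 1) fE; case: MpP => //= _.
by apply/val_inj; case: z z0 => [[|[|z]] zP].
Qed.

End ResidueFields.

(** * The bar complex of a perfect group *)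

Section FreeAbelian.
Variable X : choiceType.
Local Notation F := {freeg X / int}.

(** Differences of generators yield all integral combinations. *)
Lemma freegB_ind (P : F -> Prop) : P 0 -> (forall x, P << x >>) ->
  (forall u v, P u -> P v -> P (u - v)) -> forall u, P u.
Proof.
move=> P0 P1 PB u; have PN v : P v -> P (- v) by rewrite -sub0r; apply: PB.
have PD v w : P v -> P w -> P (v + w) by move=> Pv Pw; rewrite -[w]opprK; apply/PB/PN.
rewrite -[u]freeg_sumE; elim/big_ind: _ => // x _.
rewrite -[coeff x u]intz -freegU_mulz.
have Pn n : P (<< x >> *+ n) by elim: n => [|n IH]; rewrite ?mulr0n // mulrS; apply: PD.
by case: (coeff x u) => n; [apply: Pn|rewrite NegzE mulrNz; apply/PN/Pn].
Qed.

Lemma freeg_hom0 (A : zmodType) (f : {additive F -> A}) :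
  (forall x, f << x >> = 0) -> forall u, f u = 0.
Proof.
move=> f0; apply: freegB_ind => [|//|u v fu fv]; first by rewrite raddf0.
by rewrite raddfB /= fu fv subrr.
Qed.

Lemma freeg_lift_ex (A : zmodType) (f : X -> A) :
  exists g : {additive F -> A}, forall x, g << x >> = f x.
Proof.
pose g : F -> A := fglift (f : X -> ssrint.zmodule A).
have gB : zmod_morphism (g : F -> ssrint.zmodule A) by apply: lift_is_additive.
pose ga : {additive F -> A} := HB.pack g (GRing.isZmodMorphism.Build F A g gB).
exists ga => x /=.
by rewrite /g liftU scale1r.
Qed.

End FreeAbelian.

(** Quotients by a subgroup that is given as a predicate. Below, inclusions
    between subgroups of chains are proved by showing that an additive map
    vanishes. *)
Lemma quotient_ex (A : zmodType) (P : A -> Prop) : P 0 ->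
  (forall x y, P x -> P y -> P (x - y)) ->
  exists (D : zmodType) (c : {additive A -> D}), forall x, c x = 0 <-> P x.
Proof.
move=> P0 PB; pose S : {pred A} := fun x => `[<P x>].
have Scl : zmod_closed S by split=> [|x y /asboolP Px /asboolP Py];
  apply/asboolP => //; apply: PB.
pose SZ : zmodClosed A := HB.pack S (GRing.isZmodClosed.Build A S Scl).
pose c : A -> Quotient.quot SZ := fun x => \pi x.
have cB : zmod_morphism c by move=> x y; rewrite /c !piE.
pose ca : {additive A -> Quotient.quot SZ} :=
  HB.pack c (GRing.isZmodMorphism.Build _ _ c cB).
exists (Quotient.quot SZ), ca => x /=.
have -> : (c x = 0) <-> (c x == c 0).
  have -> : c 0 = 0 by exact: (raddf0 ca).
  by split=> [->|/eqP].
rewrite /c -Quotient.idealrBE subr0; split; first by move/asboolP.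
by move=> Px; apply/asboolP.
Qed.

Section Bar.
Variable G : groupType.
Local Notation bar1 := {freeg G / int}.
Local Notation bar2 := {freeg (G * G)%type / int}.
Implicit Types g h k x y : G.

Lemma bar_d2U g h : bar_d2 << (g, h) >> = << h >> - << (g * h)%g >> + << g >> :> bar1.
Proof. by rewrite /bar_d2 liftU scale1r. Qed.

Lemma bar_d3U g h k : bar_d3 << (g, h, k) >> =
  << (h, k) >> - << ((g * h)%g, k) >> + << (g, (h * k)%g) >> - << (g, h) >> :> bar2.
Proof. by rewrite /bar_d3 liftU scale1r. Qed.

Definition perfect := forall g, in_gen (fun x => exists a b, x = commut a b) g.

Hypothesis Gp : perfect.

Lemma perfect_hom0 (D : zmodType) (f : G -> D) :
  (forall x y, f (x * y)%g = f x + f y) -> forall x, f x = 0.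
Proof.
move=> fM; have f1 : f 1%g = 0 by apply: (@addrI _ (f 1%g)); rewrite -fM mulg1 addr0.
have fV x : f x^-1%g = - f x by apply: (@addrI _ (f x)); rewrite -fM mulgV f1 subrr.
move=> x; elim: (Gp x) => {x} [_ [a [b ->]]||x y _ fx _ fy|x _ fx].
- by rewrite /commut !fM !fV -addrA addrACA !subrr addr0.
- exact: f1.
- by rewrite fM fx fy addr0.
- by rewrite fV fx oppr0.
Qed.

(** Modulo boundaries, << g >> is additive in g, hence zero for perfect G. *)
Lemma bar_d2_onto (b : bar1) : exists c : bar2, bar_d2 c = b.
Proof.
have [|x y [a ax] [c cy]|D [cl clP]] :=
  @quotient_ex bar1 (fun b => exists c : bar2, bar_d2 c = b).
  by exists 0; rewrite raddf0.
  by exists (a - c); rewrite raddfB /= ax cy.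
apply/clP; move: b; apply: freeg_hom0 => x.
move: x; apply: perfect_hom0 => x y.
apply/esym/subr0_eq; rewrite -raddfD -raddfB; apply/clP; exists << (x, y) >>.
by rewrite bar_d2U addrAC [_ + << x >>]addrC.
Qed.

(** A map on 2-chains that vanishes on cycles factors through the boundary,
    hence is the coboundary of a function on G. *)
Lemma coboundary_ex (D : zmodType) (lam : {additive bar2 -> D}) :
  (forall z, bar_d2 z = 0 -> lam z = 0) ->
  exists t : G -> D, forall x y, lam << (x, y) >> = t y - t (x * y)%g + t x.
Proof.
move=> l0; pose s x := sval (cid (bar_d2_onto << x >>)).
have sE x : bar_d2 (s x) = << x >> by rewrite /s; case: cid.
exists (lam \o s) => x y /=; apply/subr0_eq.
by rewrite -raddfB -raddfD -raddfB; apply: l0;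
  rewrite raddfB raddfD raddfB /= !sE bar_d2U subrr.
Qed.

End Bar.

Lemma perfect_img (S E : groupType) (p : {multiplicative S -> E}) :
  surjective p -> perfect S -> perfect E.
Proof.
move=> ps Sp g; have [s <-] := ps g;
  elim: (Sp s) => {s g}[_ [a [b ->]]||x y _ gx _ gy|x _ gx].
- by apply: in_gen_base; exists (p a), (p b); rewrite /commut !gmulfM !multiplicativeV.
- by rewrite multiplicative1; apply: in_gen1.
- by rewrite gmulfM; apply: in_genM.
- by rewrite multiplicativeV; apply: in_genV.
Qed.

Section CocycleExt.
Variables (G : groupType) (D : zmodType) (u : G -> G -> D).
Definition cocycle := forall g h k, u h k + u g (h * k)%g = u g h + u (g * h)%g k.
Hypothesis cu : cocycle.
(** The central extension of G by D with 2-cocycle u. The cocycle is not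
    normalised, so the identity is (- u 1 1, 1). *)
Definition cocycle_ext of cocycle := (D * G)%type.
HB.instance Definition _ := Choice.on (cocycle_ext cu).
Implicit Types x y z : cocycle_ext cu.

Definition ext_mul x y : cocycle_ext cu := (x.1 + y.1 + u x.2 y.2, (x.2 * y.2)%g).
Definition ext_one : cocycle_ext cu := (- u 1%g 1%g, 1%g).
Definition ext_inv x : cocycle_ext cu := (- x.1 - u x.2^-1%g x.2 - u 1%g 1%g, (x.2^-1)%g).

Lemma cocycle1g g : u 1%g g = u 1%g 1%g.
Proof. by have := cu 1%g 1%g g; rewrite !mul1g => /addIr. Qed.
Lemma cocycleg1 g : u g 1%g = u 1%g 1%g.
Proof. by have := cu g 1%g 1%g; rewrite !mulg1 => /addIr/esym. Qed.

Lemma ext_mulA : associative ext_mul.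
Proof.
move=> [a g] [b h] [c k]; rewrite /ext_mul /= mulgA; congr (_, _).
transitivity (a + b + c + (u h k + u g (h * k)%g)); first by rewrite !addrA.
by rewrite cu addrA; congr (_ + _); rewrite addrAC.
Qed.
Lemma ext_mul1 : left_id ext_one ext_mul.
Proof. by move=> [a g]; rewrite /ext_mul /= mul1g cocycle1g addrAC addNr add0r. Qed.
Lemma ext_mulr1 : right_id ext_one ext_mul.
Proof. by move=> [a g]; rewrite /ext_mul /= mulg1 cocycleg1 subrK. Qed.
Lemma ext_mulV : left_inverse ext_one ext_inv ext_mul.
Proof.
move=> [a g]; rewrite /ext_mul /ext_inv /ext_one /= mulVg; congr (_, _).
by rewrite -opprD -addrA addrAC addNr add0r.
Qed.
Lemma ext_mulrV : right_inverse ext_one ext_inv ext_mul.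
Proof.
have uV g : u g^-1%g g = u g g^-1%g.
  by have := cu g g^-1%g g; rewrite mulgV mulVg cocycleg1 cocycle1g => /addIr.
move=> [a g]; rewrite /ext_mul /ext_inv /ext_one /= mulgV; congr (_, _).
by rewrite uV addrAC -opprD addrA subrr add0r.
Qed.

HB.instance Definition _ := isGroup.Build (cocycle_ext cu)
  ext_mulA ext_mul1 ext_mulr1 ext_mulV ext_mulrV.

Lemma ext_mulE x y : (x * y)%g = (x.1 + y.1 + u x.2 y.2, (x.2 * y.2)%g) :> cocycle_ext cu.
Proof. by []. Qed.

Definition ext_proj (x : cocycle_ext cu) : G := x.2.
Lemma ext_prM : {morph ext_proj : x y / (x * y)%g}. Proof. by []. Qed.
HB.instance Definition _ := isMultiplicative.Build (cocycle_ext cu) G ext_proj ext_prM.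

Definition ext_in (d : D) : cocycle_ext cu := (d - u 1%g 1%g, 1%g).
Definition ext_sec (g : G) : cocycle_ext cu := (0, g).

Lemma ext_inD d e : ext_in (d + e) = (ext_in d * ext_in e)%g.
Proof.
rewrite /ext_in ext_mulE /= mulg1; congr (_, _).
by rewrite addrA subrK addrAC.
Qed.

Lemma ext_in_central d x : commute (ext_in d) x.
Proof.
case: x => a g; rewrite /commute !ext_mulE /= mulg1 mul1g; congr (_, _).
by rewrite cocycle1g cocycleg1 addrAC subrK addrA subrK addrC.
Qed.

Lemma ext_ker x : ext_proj x = 1%g -> exists d, x = ext_in d.
Proof.
by case: x => a g /= ->; exists (a + u 1%g 1%g); rewrite /ext_in addrK.
Qed.

Lemma ext_secM g h : (ext_sec g * ext_sec h = ext_in (u g h) * ext_sec (g * h))%g.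
Proof.
rewrite !ext_mulE /= mul1g cocycle1g; congr (_, _).
by rewrite !add0r addr0 subrK.
Qed.

Lemma ext_in_inj : injective ext_in.
Proof. by move=> d e [] /addIr. Qed.

End CocycleExt.

(** A central kernel is abelian; [i] passes from additive to multiplicative
    notation. *)
Lemma kernel_zmod (E S : groupType) (p : {multiplicative E -> S}) : central_ker p ->
  exists (A : zmodType) (i : A -> kernel p),
    bijective i /\ forall a b, i (a + b) = (i a * i b)%g.
Proof.
move=> p_central.
pose add (x y : kernel p) : kernel p := (x * y)%g.
have addC : commutative add.
  move=> x y; apply: val_inj; rewrite !valM; apply: p_central; exact: (eqP (valP x)).
pose m := GRing.isZmodule.Build (kernel p) (@mulgA (kernel p)) addC (@mul1g (kernel p))
  (@mulVg (kernel p)).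
pose A : zmodType := HB.pack (kernel p) m.
by exists A, (fun x : A => x : kernel p); split; first exists (fun x => x).
Qed.

(** * Homology of central extensions *)

Section Push.
Variables (X E : groupType) (v : {multiplicative X -> E}).
Definition push2 : {freeg (X * X)%type / int} -> {freeg (E * E)%type / int} :=
  fglift (fun x => << (v x.1, v x.2) >> : {freeg (E * E)%type / int}).
Fact push2_zmod : zmod_morphism push2. Proof. exact: lift_is_additive. Qed.
HB.instance Definition _ := GRing.isZmodMorphism.Build _ _ push2 push2_zmod.
Definition push3 : {freeg (X * X * X)%type / int} -> {freeg (E * E * E)%type / int} :=
  fglift (fun x => << (v x.1.1, v x.1.2, v x.2) >> : {freeg (E * E * E)%type / int}).
Fact push3_zmod : zmod_morphism push3. Proof. exact: lift_is_additive. Qed.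
HB.instance Definition _ := GRing.isZmodMorphism.Build _ _ push3 push3_zmod.

Lemma push2U x y : push2 << (x, y) >> = << (v x, v y) >>.
Proof. by rewrite /push2 liftU scale1r. Qed.
Lemma push3U x y z : push3 << (x, y, z) >> = << (v x, v y, v z) >>.
Proof. by rewrite /push3 liftU scale1r. Qed.

Lemma push2_cycle z : bar_d2 z = 0 -> bar_d2 (push2 z) = 0.
Proof.
have [push1 p1] := freeg_lift_ex (fun x => << v x >> : {freeg E / int}).
suff H : bar_d2 (push2 z) = push1 (bar_d2 z) by rewrite H => ->; rewrite raddf0.
move: z; apply: freegB_ind => [|[x y]|a b IHa IHb]; first by rewrite !raddf0.
  by rewrite push2U !bar_d2U raddfD raddfB /= !p1 gmulfM.
by rewrite !raddfB /= IHa IHb.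
Qed.

Lemma push2_d3 w : push2 (bar_d3 w) = bar_d3 (push3 w).
Proof.
move: w; apply: freegB_ind => [|[[x y] z]|a b IHa IHb]; first by rewrite !raddf0.
  by rewrite push3U !bar_d3U raddfB raddfD raddfB /= !push2U !gmulfM.
by rewrite !raddfB /= IHa IHb.
Qed.
End Push.

(** A surjection p with kernel A, a section sg, and its 2-cocycle kappa, which is
    extended to 2-chains. *)
Section Central.
Variables (S E : groupType) (p : {multiplicative S -> E}).
Variables (A : zmodType) (i : A -> S) (sg : E -> S).
Hypothesis p_central : central_ker p.
Hypothesis i_inj : injective i.
Hypothesis iD : forall a b, i (a + b) = (i a * i b)%g.
Hypothesis p_i : forall a, p (i a) = 1%g.
Hypothesis ker_i : forall s, p s = 1%g -> exists a, i a = s.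
Hypothesis sgK : forall g, p (sg g) = g.
Variable kappa : {additive {freeg (E * E)%type / int} -> A}.
Hypothesis kappaE : forall g h, (i (kappa << (g, h) >>) * sg (g * h))%g = (sg g * sg h)%g.

Lemma i_central a s : commute (i a) s.
Proof. exact: p_central. Qed.

Lemma kappa_cocycle : cocycle (fun g h => kappa << (g, h) >>).
Proof.
move=> g h k; apply: i_inj; rewrite !iD; apply: (@mulIg _ (sg (g * h * k)%g)).
transitivity (sg g * sg h * sg k)%g.
  by rewrite -mulgA -(mulgA g h k) kappaE mulgA i_central -mulgA kappaE mulgA.
by rewrite -[RHS]mulgA kappaE mulgA kappaE.
Qed.

Lemma kappa_d3 w : kappa (bar_d3 w) = 0.
Proof.
move: w; apply: (@freeg_hom0 _ _ (kappa \o @bar_d3 E)) => -[[g h] k] /=.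
rewrite bar_d3U raddfB raddfD raddfB /=.
by have := kappa_cocycle g h k; rewrite (addrAC (kappa _)) => ->; rewrite addrK subrr.
Qed.

Lemma deviation_ex s : exists a, s = (i a * sg (p s))%g.
Proof.
have [|a ia] := ker_i (s := s * (sg (p s))^-1)%g;
  first by rewrite gmulfM multiplicativeV sgK mulgV.
by exists a; rewrite ia mulgVK.
Qed.

(** The map j differs from sg \o v by a function r from X to A, so lam and the
    pull-back of kappa differ by the coboundary of r. *)
Lemma kappa_push (X : groupType) (v : {multiplicative X -> E}) (j : X -> S)
  (lam : {additive {freeg (X * X)%type / int} -> A}) :
  (forall x, p (j x) = v x) ->
  (forall x y, (i (lam << (x, y) >>) * j (x * y))%g = (j x * j y)%g) ->
  forall z, bar_d2 z = 0 -> lam z = kappa (push2 v z).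
Proof.
move=> pj jM; pose r x := sval (cid (deviation_ex (j x))).
have rE x : j x = (i (r x) * sg (v x))%g by rewrite /r; case: cid => a /= {1}->;
  rewrite pj.
have [T TE] := freeg_lift_ex r.
suff H z : lam z = T (bar_d2 z) + kappa (push2 v z) by move=> z dz;
  rewrite H dz raddf0 add0r.
move: z; apply: freegB_ind => [|[x y]|a b IHa IHb]; first by rewrite !raddf0 addr0.
  rewrite bar_d2U raddfD raddfB /= !TE push2U.
  have H : lam << (x, y) >> + r (x * y)%g = r x + r y + kappa << (v x, v y) >>.
    apply: i_inj; rewrite !iD; apply: (@mulIg _ (sg (v (x * y)%g))).
    rewrite -mulgA -rE jM !rE -[RHS]mulgA gmulfM kappaE.
    by rewrite -!mulgA (mulgA (sg _)) -(i_central (r y)) !mulgA.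
  by apply: (addIr (r (x * y)%g));
    rewrite H [in RHS]addrAC [r y - _ + _]addrAC subrK [r x + _]addrC.
by rewrite !raddfB /= IHa IHb opprD addrACA.
Qed.

Hypothesis p_surj : surjective p.
Hypothesis Sp : perfect S.

(** Let cl be the quotient map of A by the values of kappa on cycles. Then cl
    \o kappa vanishes on cycles, so it is the coboundary of some m. Adding m
    \o p to cl of the A-component with respect to the section gives a
    homomorphism on S, which is trivial as S is perfect; restricted to A it is
    cl. *)
Lemma kappa_onto a : exists z, bar_d2 z = 0 /\ kappa z = a.
Proof.
have [|x y [z [dz <-]] [w [dw <-]]|D [cl clP]] :=
  @quotient_ex A (fun a => exists z, bar_d2 z = 0 /\ kappa z = a).
- by exists 0; rewrite !raddf0.
- by exists (z - w); rewrite !raddfB /= dz dw subrr.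
apply/clP.
have [z dz|m mE] := coboundary_ex (perfect_img p_surj Sp) (lam := cl \o kappa).
  by apply/clP; exists z.
pose r s := sval (cid (deviation_ex s)).
have rE s : s = (i (r s) * sg (p s))%g by rewrite /r; case: cid.
have rU s b : s = (i b * sg (p s))%g -> r s = b.
  by move=> sE; apply: i_inj; apply: (@mulIg _ (sg (p s))); rewrite -rE.
have rM s t : r (s * t)%g = r s + r t + kappa << (p s, p t) >>.
  apply: rU; rewrite !iD -mulgA gmulfM kappaE {1}[s]rE {1}[t]rE.
  by rewrite -!mulgA (mulgA (sg _)) -(i_central (r t)) !mulgA.
pose h s := cl (r s) + m (p s).
have hM s t : h (s * t)%g = h s + h t.
  rewrite /h rM !raddfD /= gmulfM -[cl (kappa _)]/((cl \o kappa) _) mE.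
  by rewrite [m (p t) - _ + _]addrAC addrA subrK [m (p t) + _]addrC addrACA.
have h0 := perfect_hom0 Sp hM.
have p1 : p (sg 1%g) = 1%g by [].
have := h0 (sg 1%g); rewrite /h (rU _ 0) ?raddf0 ?add0r; last first.
  by rewrite p1; apply: (@mulIg _ (i 0)); rewrite -mulgA -i_central mulgA -iD addr0.
rewrite p1 => m1; have := h0 (i a * sg 1%g)%g.
have pa : p (i a * sg 1%g)%g = 1%g by rewrite gmulfM p_i p1 mulg1.
by rewrite /h (rU _ a) ?pa // m1 addr0.
Qed.

(** Let cl be the quotient map of 2-chains of E by boundaries and images of
    cycles of S. On S, cl becomes a coboundary, of t say. Restricted to A, t
    is additive up to the constant om, and evaluating the coboundary of t at
    the lifts of g and h expresses cl << (g, h) >> by a coboundary on E and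
    kappa. *)
Lemma kappa_exact z : bar_d2 z = 0 -> kappa z = 0 ->
  exists z' w, bar_d2 z' = 0 /\ z = push2 p z' + bar_d3 w.
Proof.
move=> dz kz; pose P z := exists z' w, bar_d2 z' = 0 /\ z = push2 p z' + bar_d3 w.
have [||D [cl clP]] := @quotient_ex _ P.
- by exists 0, 0; rewrite !raddf0 addr0.
- move=> x y [x' [w [dx ->]]] [y' [w' [dy ->]]]; exists (x' - y'), (w - w').
  by rewrite !raddfB /= dx dy subrr; split=> //; rewrite opprD addrACA.
apply/clP.
have [x dx|t tE] := coboundary_ex Sp (lam := cl \o push2 p).
  by apply/clP; exists x, 0; rewrite raddf0 addr0.
have tM x y : t (x * y)%g + cl << (p x, p y) >> = t x + t y.
  have := tE x y; rewrite /= push2U => ->.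
  by rewrite addrA [t (x * y)%g + _]addrC subrK addrC.
pose om := cl << (1%g, 1%g) >>.
have om1 g : cl << (1%g, g) >> = om.
  apply/subr0_eq; rewrite -raddfB; apply/clP; exists 0, << (1%g, 1%g, g) >>.
  by rewrite !raddf0 add0r bar_d3U !mul1g subrr add0r.
pose t' a := t (i a) - om.
have t'D a b : t' (a + b) = t' a + t' b.
  have := tM (i a) (i b); rewrite !p_i -/om -iD => H.
  by rewrite -![t' _]/(t (i _) - om) addrACA -H addrA addrK.
have t'B : zmod_morphism t'.
  by move=> a b; apply: (addIr (t' b)); rewrite -t'D !subrK.
pose ta : {additive A -> D} := HB.pack t' (GRing.isZmodMorphism.Build A D t' t'B).
have [M ME] := freeg_lift_ex (fun g => t (sg g)).
suff -> : cl z = M (bar_d2 z) - ta (kappa z) by rewrite dz kz !raddf0 addr0.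
move: z {dz kz}; apply: freegB_ind => [|[g h]|x y IHx IHy];
  first by rewrite !raddf0 addr0.
  rewrite bar_d2U raddfD raddfB /= !ME.
  have := tM (sg g) (sg h); rewrite !sgK -kappaE.
  have := tM (i (kappa << (g, h) >>)) (sg (g * h)%g); rewrite p_i sgK om1 => H1 H2.
  rewrite -[t' _]/(t (i (kappa << (g, h) >>)) - om).
  have -> : t (i (kappa << (g, h) >>)) - om =
      t (i (kappa << (g, h) >>) * sg (g * h))%g - t (sg (g * h)%g).
    by apply/eqP; rewrite subr_eq addrAC eq_sym subr_eq; apply/eqP.
  by rewrite opprB [_ - _ + t (sg g)]addrAC addrA subrK [t _ + t _]addrC -H2 addrAC
    subrr add0r.
rewrite [cl _]raddfB IHx IHy [bar_d2 (_ - _)]raddfB [M (_ - _)]raddfB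
  [kappa (_ - _)]raddfB [ta (_ - _)]raddfB.
by rewrite !opprD addrACA.
Qed.

End Central.

Section Data.
Variables (S E : groupType) (p : {multiplicative S -> E}).
Hypothesis p_surj : surjective p.
Hypothesis p_central : central_ker p.

(** The data of a central extension in terms of a section sg: the kernel
    written additively as A, and the 2-cocycle of sg as a map on 2-chains. *)
Lemma section_cocycle_ex : exists (A : zmodType) (i : A -> kernel p) (sg : E -> S)
    (kappa : {additive {freeg (E * E)%type / int} -> A}),
  [/\ bijective i, forall a b, i (a + b) = (i a * i b)%g, cancel sg p &
      forall g h, (val (i (kappa << (g, h) >>)) * sg (g * h))%g = (sg g * sg h)%g].
Proof.
have [A [i [ib iD]]] := kernel_zmod p_central; have [i' iK i'K] := ib.
pose sg g := sval (cid (p_surj g)).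
have sgK : cancel sg p by move=> g; rewrite /sg; case: cid.
have cker g h : kernel_pred p (sg g * sg h * (sg (g * h))^-1)%g.
  by apply/eqP; rewrite !gmulfM multiplicativeV !sgK mulgV.
have [kappa kappaE] := freeg_lift_ex (fun x : E * E => i' (Kernel (cker x.1 x.2))).
by exists A, i, sg, kappa; split=> // g h; rewrite kappaE i'K /= mulgVK.
Qed.

End Data.

Section Boundaries.
Variable S : groupType.

(** The class of (g, h) in 2-chains modulo boundaries is the universal
    2-cocycle. *)
Lemma boundary_class_ex :
  exists (D : zmodType) (cl : {additive {freeg (S * S)%type / int} -> D}),
  (forall z, cl z = 0 <-> exists w, bar_d3 w = z) /\ cocycle (fun x y => cl << (x, y) >>).
Proof.
have [|x y [a <-] [b <-]|D [cl clP]] :=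
  @quotient_ex {freeg (S * S)%type / int} (fun z => exists w, bar_d3 w = z).
- by exists 0; rewrite raddf0.
- by exists (a - b); rewrite raddfB.
exists D, cl; split=> // g h k.
have : cl (bar_d3 << (g, h, k) >>) = 0 by apply/clP; exists << (g, h, k) >>.
rewrite bar_d3U raddfB raddfD raddfB /= => H; apply: subr0_eq; rewrite -[RHS]H.
by rewrite opprD addrA (addrAC (cl _ + cl _)) (addrAC (cl << (h, k) >>)).
Qed.

(** A splitting of the extension with the universal cocycle writes the class
    of every 2-chain as a function of its boundary. *)
Lemma split_boundary :
  (forall (U : groupType) (q : {multiplicative U -> S}), surjective q -> central_ker q ->
     exists s : {multiplicative S -> U}, cancel s q) ->
  forall z : {freeg (S * S)%type / int}, bar_d2 z = 0 -> exists w, bar_d3 w = z.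
Proof.
move=> split z dz; have [D [cl [clP cu]]] := boundary_class_ex; apply/clP.
have [x|x y x1|s sK] := split (cocycle_ext cu) (@ext_proj _ _ _ cu).
- by exists (ext_sec cu x).
- by have [d ->] := ext_ker x1; apply: ext_in_central.
have tex x : exists t, s x = (ext_in cu t * ext_sec cu x)%g.
  have [|t tE] := @ext_ker _ _ _ cu (s x * (ext_sec cu x)^-1)%g.
    by rewrite gmulfM multiplicativeV sK mulgV.
  by exists t; rewrite -tE mulgVK.
pose t x := sval (cid (tex x)).
have tE x : s x = (ext_in cu (t x) * ext_sec cu x)%g by rewrite /t; case: cid.
have tM x y : t (x * y)%g = t x + t y + cl << (x, y) >>.
  apply: (@ext_in_inj _ _ _ cu); apply: (@mulIg _ (ext_sec cu (x * y)%g)).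
  rewrite -tE gmulfM !tE !ext_inD -!mulgA; congr (_ * _)%g.
  by rewrite -ext_secM !mulgA ext_in_central.
have [T TE] := freeg_lift_ex t.
suff -> : cl z = - T (bar_d2 z) by rewrite dz raddf0 oppr0.
move: z {dz}; apply: freegB_ind => [|[x y]|x y IHx IHy]; first by rewrite !raddf0.
  rewrite bar_d2U raddfD raddfB !TE tM.
  rewrite [t y - _ + _]addrAC [t y + _]addrC opprB.
  by rewrite addrAC subrr add0r.
by rewrite [cl _]raddfB IHx IHy [bar_d2 (_ - _)]raddfB [T (_ - _)]raddfB opprD.
Qed.

End Boundaries.

Section Injectivity.
Variables (S E : groupType) (p : {multiplicative S -> E}).
Hypothesis p_surj : surjective p.
Hypothesis p_central : central_ker p.
Hypothesis Sp : perfect S.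

(** For central k, the difference u k y - u y k is a homomorphism in y, hence
    zero on a perfect group. *)
Lemma cocycle_central_sym (D : zmodType) (u : S -> S -> D) : cocycle u ->
  forall k, (forall x, commute k x) -> forall y, u k y = u y k.
Proof.
move=> cu k kC y; apply: subr0_eq; move: y.
apply: (perfect_hom0 Sp) => y z.
have E1 := cu k y z; have E2 := cu y z k; have E3 := cu y k z.
rewrite (kC y) in E1; rewrite -(kC z) in E2.
have -> : u k (y * z)%g = u k y + u (y * k)%g z - u y z by rewrite -E1 addrAC subrr add0r.
have -> : u (y * z)%g k = u z k + u y (k * z)%g - u y z by rewrite E2 addrAC subrr add0r.
have -> : u (y * k)%g z = u k z + u y (k * z)%g - u y k by rewrite E3 addrAC subrr add0r.
rewrite opprB addrA subrK [u k z + _ - _]addrAC addrA [u z k + _]addrC.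
by rewrite opprD [LHS]addrA addrK [u k z - u y k]addrC !addrA.
Qed.

(** The extension of S by 2-chains modulo boundaries is central over E too: a
    preimage of the kernel of p commutes with everything by
    [cocycle_central_sym]. On cycles z of S the 2-cocycle of this extension
    over E takes the image of z to the class of z, so that z is a boundary if
    its image is one. *)
Lemma push2_boundary z w : bar_d2 z = 0 -> push2 p z = bar_d3 w ->
  exists w', bar_d3 w' = z.
Proof.
move=> dz pz; have [D [cl [clP cu]]] := boundary_class_ex S; apply/clP.
pose P0 (x : cocycle_ext cu) : E := p (ext_proj x).
have P0M : {morph P0 : x y / (x * y)%g} by move=> x y; rewrite /P0 !gmulfM.
pose P : {multiplicative cocycle_ext cu -> E} :=
  HB.pack P0 (isMultiplicative.Build (cocycle_ext cu) E P0 P0M).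
have P_surj : surjective P by move=> g; have [x <-] := p_surj g; exists (ext_sec cu x).
have Pc : central_ker P.
  move=> [a k] [b y] /= k1; have kC : forall x, commute k x by move=> x; apply: p_central.
  rewrite /commute !ext_mulE /= (kC y) [b + a]addrC; congr (_ + _, _).
  exact: (cocycle_central_sym cu kC).
have [A [i [sg [kappa [ib iD sgK kappaE]]]]] := section_cocycle_ex P_surj Pc.
have [i' iK i'K] := ib.
have Pin d : kernel_pred P (ext_in cu d) by apply/eqP; rewrite /= /P0 /= multiplicative1.
pose b d := i' (Kernel (Pin d)).
have bE d : val (i (b d)) = ext_in cu d by rewrite /b i'K.
have vi : injective (fun a => val (i a)) by apply: inj_comp;
  [apply: val_inj|apply: bij_inj].
have bD d e : b (d + e) = b d + b e.
  by apply: vi; rewrite /= iD valM !bE ext_inD.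
have bB : zmod_morphism b by move=> d e; apply: (addIr (b e)); rewrite -bD !subrK.
pose ba : {additive D -> A} := HB.pack b (GRing.isZmodMorphism.Build D A b bB).
have Bw : ba (cl z) = kappa (push2 p z).
  apply: (@kappa_push _ _ P A (fun a => val (i a)) sg Pc vi _ _ _ sgK kappa kappaE S p
     (ext_sec cu) (ba \o cl)) => //.
  - by move=> a c; rewrite iD valM.
  - by move=> a; apply/eqP/(valP (i a)).
  - by move=> x x1; exists (i' (Kernel (introT eqP x1))); rewrite i'K.
  - move=> x y; transitivity (val (i (b (cl << (x, y) >>))) * ext_sec cu (x * y))%g => //.
    by rewrite bE ext_secM.
have kd3 : kappa (bar_d3 w) = 0.
  apply: (@kappa_d3 _ _ P A (fun a => val (i a)) sg Pc vi) => //.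
  - by move=> a c; rewrite iD valM.
  - by move=> a; apply/eqP/(valP (i a)).
rewrite pz kd3 in Bw.
apply: (@ext_in_inj _ _ _ cu); rewrite -bE [b _]Bw -[in RHS]bE.
by have -> : b 0 = 0 by exact: (raddf0 ba).
Qed.

End Injectivity.

Section HomologyClass.
Variable G : groupType.
Local Notation bar2 := {freeg (G * G)%type / int}.

Definition hclass (z : cycles2 G) : H2 G := \pi_(@Quotient.quot _ (@boundary_pred G)) z.

Lemma hclass_onto q : exists z, q = hclass z.
Proof.
by exists (repr (q : @Quotient.quot _ (@boundary_pred G))); rewrite /hclass reprK.
Qed.

Lemma hclassM z w : hclass (z + w) = (hclass z * hclass w)%g.
Proof. by rewrite /hclass Quotient.pi_add. Qed.

Lemma hclass_eqP z w : hclass z = hclass w <-> exists c, bar_d3 c = val z - val w.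
Proof.
rewrite -raddfB; split=> [/eqP|H].
  by rewrite -Quotient.idealrBE => /asboolP.
by apply/eqP; rewrite -Quotient.idealrBE; apply/asboolP.
Qed.

Lemma hclass0 : hclass 0 = 1%g.
Proof. by apply: (@mulgI _ (hclass 0)); rewrite -hclassM mulg1 addr0. Qed.

Lemma hclass_eq1P z : hclass z = 1%g <-> exists c, bar_d3 c = val z.
Proof.
rewrite -hclass0; have [h h'] := hclass_eqP z 0; split=> [/h|] [c cE].
  by exists c; rewrite cE raddf0 addr0.
by apply: h'; exists c; rewrite cE raddf0 addr0.
Qed.

Lemma H2_hom_ex (K : groupType) (F : cycles2 G -> K) :
  (forall z w, F (z + w) = (F z * F w)%g) ->
  (forall z c, bar_d3 c = val z -> F z = 1%g) ->
  exists f : {multiplicative H2 G -> K}, forall z, f (hclass z) = F z.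
Proof.
move=> FM F0; pose r q := sval (cid (hclass_onto q)).
have rE q : hclass (r q) = q by rewrite /r; case: cid.
have FE z w : hclass z = hclass w -> F z = F w.
  move=> /hclass_eqP[c cE]; have d1 : F (z - w) = 1%g by apply: (F0 _ c); rewrite raddfB.
  by rewrite -[z](subrK w) FM d1 mul1g.
pose f0 q := F (r q).
have f0M : {morph f0 : x y / (x * y)%g}.
  by move=> x y; rewrite /f0 -FM; apply: FE; rewrite hclassM !rE.
pose f : {multiplicative H2 G -> K} :=
  HB.pack f0 (isMultiplicative.Build (H2 G) K f0 f0M).
by exists f => z; apply: FE; rewrite rE.
Qed.

End HomologyClass.

Lemma isomorphic_sym (G H : groupType) (f : {multiplicative G -> H}) :
  bijective f -> isomorphic H G.
Proof.
move=> [g fK gK].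
pose g' : {multiplicative H -> G} :=
  HB.pack g (isMultiplicative.Build H G g (can2_gmulfM fK gK)).
by exists g', f.
Qed.

Lemma inj_surj_bij (A B : Type) (f : A -> B) : injective f -> surjective f -> bijective f.
Proof.
move=> fi fs; exists (fun y => sval (cid (fs y))) => x; case: cid => //= y.
exact: fi.
Qed.

Lemma multiplicative_inj (G H : groupType) (f : {multiplicative G -> H}) :
  (forall x, f x = 1%g -> x = 1%g) -> injective f.
Proof.
move=> f1 x y xy; apply: (@mulIg _ y^-1%g); rewrite mulgV.
by apply: f1; rewrite gmulfM multiplicativeV xy mulgV.
Qed.

(** Perfectness makes the five-term exact sequence of p end with H1(S) = 0; as
    the kernel is central, it also makes the first map injective. *)
Theorem H2_central_extension (S E : groupType) (p : {multiplicative S -> E}) :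
  surjective p -> central_ker p -> perfect S ->
  exists f : {multiplicative H2 E -> kernel p},
    [/\ surjective f, isomorphic (kernel f) (H2 S) &
        (forall (U : groupType) (q : {multiplicative U -> S}),
           surjective q -> central_ker q ->
           exists s : {multiplicative S -> U}, cancel s q) -> bijective f].
Proof.
move=> ps p_central Sp; have [A [i [sg [kappa [ib iD sgK kappaE]]]]] :=
  section_cocycle_ex ps p_central.
pose vi a := val (i a).
have vI : injective vi by apply: inj_comp; [apply: val_inj|apply: bij_inj].
have viD a c : vi (a + c) = (vi a * vi c)%g by rewrite /vi iD valM.
have pvi a : p (vi a) = 1%g by apply/eqP/(valP (i a)).
have kvi s : p s = 1%g -> exists a, vi a = s.
  move=> s1; have [i' _ i'K] := ib.
  by exists (i' (Kernel (introT eqP s1))); rewrite /vi i'K.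
have i0 : i 0 = 1%g by apply: val_inj; apply: (@mulgI _ (vi 0));
  rewrite -viD addr0 val1 mulg1.
have kd3 := kappa_d3 p_central vI viD pvi kappaE.
have [z w|z c cz|f fE] := @H2_hom_ex E _ (fun z => i (kappa (val z))).
- by rewrite -iD -raddfD.
- by rewrite -cz kd3 i0.
have f1 z : f (hclass z) = 1%g -> kappa (val z) = 0.
  by rewrite fE -i0 => /(bij_inj ib).
have ex z : f (hclass z) = 1%g ->
  exists z' w, bar_d2 z' = 0 /\ val z = push2 p z' + bar_d3 w.
  move=> /f1; apply: (kappa_exact viD pvi sgK kappaE Sp).
  exact/eqP/(valP z).
have f_surj : surjective f.
  move=> y; have [i' _ i'K] := ib.
  have [z [dz kz]] := kappa_onto p_central vI viD pvi kvi sgK kappaE ps Sp (i' y).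
  by exists (hclass (Cycles2 (introT eqP dz))); rewrite fE /= kz i'K.
exists f; split=> //.
- have pcy (z : cycles2 S) : cycle_pred (push2 p (val z)).
    by apply/eqP; apply: push2_cycle; apply/eqP/(valP z).
  have kp z : kernel_pred f (hclass (Cycles2 (pcy z))).
    apply/eqP; rewrite fE /= -i0; congr i.
    have dz : bar_d2 (val z) = 0 by apply/eqP/(valP z).
    rewrite -(kappa_push p_central vI viD pvi kvi sgK kappaE (j := id) (lam := \0) _ _
      dz) //.
    by move=> x y; rewrite /= /vi i0 val1 mul1g.
  have [z w|z c cz|g gE] := @H2_hom_ex S _ (fun z => Kernel (kp z)).
  + apply: val_inj; rewrite valM -hclassM /=; congr hclass; apply: val_inj => /=.
    by rewrite raddfD.
  + apply: val_inj; rewrite val1.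
    by apply/hclass_eq1P; exists (push3 p c); rewrite -push2_d3 cz.
  apply: (isomorphic_sym (f := g)); apply: inj_surj_bij.
  + apply: multiplicative_inj => q; have [z ->] := hclass_onto q;
      rewrite gE => /(congr1 val).
    rewrite val1 /=.
    move=> /hclass_eq1P[w /= wE]; have dz : bar_d2 (val z) = 0 by apply/eqP/(valP z).
    by have [c cE] := push2_boundary ps p_central Sp dz (esym wE); apply/hclass_eq1P;
      exists c.
  + move=> [q kq]; have [z zE] := hclass_onto q; subst q.
    have [z' [w [dz' zE]]] := ex z (eqP kq).
    exists (hclass (Cycles2 (introT eqP dz'))); rewrite gE; apply: val_inj => /=.
    by apply/hclass_eqP; exists (- w); rewrite /= zE raddfN opprD addNKr.
- move=> split; apply: inj_surj_bij => //.
  apply: multiplicative_inj => q; have [z ->] := hclass_onto q => /ex[z' [w [dz' zE]]].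
  have [w' w'E] := split_boundary split dz'.
  by apply/hclass_eq1P; exists (push3 p w' + w); rewrite zE raddfD /= -push2_d3 w'E.
Qed.

(** * The symplectic groups *)

(** Short root elements are commutators by R3; R4 then yields the long ones. *)
Lemma StSp_perfect (R : comPzRingType) l : (3 <= l)%N -> perfect (StSp R l).
Proof.
move=> l3; pose C : StSp R l -> Prop := in_gen (fun x => exists a b, x = commut a b).
have Ccg x y : C (commut x y) by apply: in_gen_base; exists x, y.
have short i j a : indep i j -> C (xroot i j a).
  move=> ij; have [k [ik jk]] := third l3 i j.
  have kj : indep k j by rewrite indep_sym.
  by rewrite -[a]mulr1 -(xroot_R3i (R := R) a 1 ik kj ij).
have long j a : C (xroot (negi j) j a).
  have [i [ji _]] := third l3 j j; have ij : indep i j by rewrite indep_sym.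
  have := xroot_R4i (R := R) (- a) 1 ij; set y := xroot i j _.
  rewrite expr1n mulr1 opprK => /(congr1 (fun x => y^-1 * x)%g).
  rewrite mulKg => <-; apply: in_genM; last exact: Ccg.
  by apply: in_genV; apply: short.
move=> g; elim/StSp_ind: g => [|i j a g ij IH]; first exact: in_gen1.
apply: in_genM IH; case i_j: (indep i j); first exact: short.
have [E|->] := indepPn (negbT i_j); first by rewrite E eqxx in ij.
by have := long (negi i) a; rewrite negiK.
Qed.

Theorem corollary2 (R : comPzRingType) (l : nat) (l_ge3 : (3 <= l)%N) :
  exists f : {multiplicative H2 (Ep R l) -> K2Sp R l},
    [/\ surjective f,
        isomorphic (kernel f) (H2 (StSp R l)) &
        (4 <= l)%N \/ l = 3%N /\ ~ has_residue_field R 'F_2 -> bijective f].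
Proof.
have p_central : central_ker (@phi R l) by move=> x y; apply: ker_central.
have [f [f_surj f_ker f_bij]] :=
  H2_central_extension (@phi_surj R l) p_central (@StSp_perfect R l l_ge3).
exists f; split=> // hyp; apply: f_bij => U q q_surj qc.
have Hc : fourth_index l \/ no_boolean_quotient R.
  by case: hyp => [/fourth|[_ /no_boolean_quotientP]]; [left|right].
by exists (splitting l_ge3 Hc q_surj qc); apply: splittingK.
Qed.
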